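(* Let $d\ge1$, let $\mathsf a,\mathsf c\in\mathbb R$ and let $c_1,\dots,c_d>0$ satisfy $-c_d<\mathsf a<-\mathsf c$, and let $0=x_0<x_1<\cdots<x_d=1$. Write $\boldsymbol x=(x_1,\dots,x_d)$ and $\boldsymbol c=(c_1,\dots,c_d)$. Then $$\frac1{\mathcal H(\mathsf a/\sqrt2,\mathsf c/\sqrt2)}\sum_{\ell=0}^d\Phi_{d,\ell}(\boldsymbol x,\boldsymbol c)=\mathbb E\left[\exp\left(-\frac1{\sqrt2}\sum_{k=1}^d c_k\,\eta^{(\mathsf a/\sqrt2,\mathsf c/\sqrt2)}_{x_k}\right)\right].$$
   Context: The process $\eta$. For $\mathsf a,\mathsf c\in\mathbb R$, $\eta^{(\mathsf a,\mathsf c)}=(\eta^{(\mathsf a,\mathsf c)}_t)_{t\in[0,1]}$ is the continuous process whose law $\mathbb P_{\eta^{(\mathsf a,\mathsf c)}}$ on $C([0,1])$ has Radon–Nikodym derivative $$\frac{d\mathbb P_{\eta^{(\mathsf a,\mathsf c)}}}{d\mathbb P_{\rm Bm}}(\omega)=\frac{e^{(\mathsf a+\mathsf c)\min_{t\in[0,1]}\omega_t-\mathsf a\omega_1}}{\mathcal H(\mathsf a,\mathsf c)}$$ with respect to the law $\mathbb P_{\rm Bm}$ of a standard Brownian motion on $[0,1]$, where $\mathcal H(\mathsf a,\mathsf c)=\mathbb E_{\rm Bm}[e^{(\mathsf a+\mathsf c)\min_{t\in[0,1]}\omega_t-\mathsf a\omega_1}]$. Explicitly, with $H(x)=e^{x^2}\frac2{\sqrt\pi}\int_x^\infty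 e^{-t^2}dt$, one has $\mathcal H(\mathsf a,\mathsf c)=\frac{\mathsf aH(\mathsf a/\sqrt2)-\mathsf cH(\mathsf c/\sqrt2)}{\mathsf a-\mathsf c}$ if $\mathsf a\ne\mathsf c$ and $\mathcal H(\mathsf a,\mathsf a)=(1+\mathsf a^2)H(\mathsf a/\sqrt2)-\sqrt{2/\pi}\,\mathsf a$. The functions $\Phi_{d,\ell}$. Put $s_k=c_k+\cdots+c_d$ and $\Delta x_k=x_k-x_{k-1}$ for $k=1,\dots,d$, and for $t>0$, $u,v\ge 0$, $$\mathsf p_t(u,v)=\frac{2t\sqrt v}{\pi\,(t^4+2(u+v)t^2+(u-v)^2)}.$$ Empty products equal $1$. Then $$\Phi_{d,d}(\boldsymbol x,\boldsymbol c)=\exp\Big(\tfrac14\sum_{k=1}^d\Delta x_k(s_k-\mathsf c)^2\Big)\frac{2\mathsf c-2s_d}{\mathsf c-2s_d-\mathsf a},$$ $$\Phi_{d,0}(\boldsymbol x,\boldsymbol c)=\frac{\mathsf a+\mathsf c}\pi\int_{(0,\infty)^d}e^{-\frac14\sum_{k=1}^d u_k\Delta x_k}\,\frac{\sqrt{u_1}}{(\mathsf c-s_1)^2+u_1}\,\frac1{(\mathsf a+s_d)^2+u_d}\prod_{k=2}^d\mathsf p_{c_{k-1}}(u_{k-1},u_k)\,du_1\cdots du_d,$$ and for $\ell=1,\dots,d-1$, $$\Phi_{d,\ell}(\boldsymbol x,\boldsymbol c)=\frac{\mathsf a+\mathsf c}\pi\int_{(0,\infty)^{d-\ell}}e^{-\frac14\sum_{k=\ell+1}^d\Delta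 x_ku_k+\frac14\sum_{k=1}^\ell\Delta x_k(s_k-\mathsf c)^2}\prod_{k=\ell+2}^d\mathsf p_{c_{k-1}}(u_{k-1},u_k)\,\frac{\sqrt{u_{\ell+1}}}{(\mathsf a+s_d)^2+u_d}$$ $$\qquad\times\frac{4(\mathsf c-s_\ell)(s_{\ell+1}-s_\ell)}{((\mathsf c-s_{\ell+1})^2+u_{\ell+1})((\mathsf c-2s_\ell+s_{\ell+1})^2+u_{\ell+1})}\,du_{\ell+1}\cdots du_d.$$ *)

(* Defs.v *)
From HB Require Import structures.
From mathcomp Require Import all_boot all_order all_algebra.
From mathcomp Require Import all_classical all_reals all_analysis.

Set Implicit Arguments.
Unset Strict Implicit.
Unset Printing Implicit Defensive.

Import Order.TTheory GRing.Theory Num.Theory.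
Import numFieldNormedType.Exports.

Local Open Scope classical_set_scope.
Local Open Scope ring_scope.

Section path_space.
Variable R : realType.

Definition I01 : Type := set_type (`[0, 1]%classic : set R).
HB.instance Definition _ := Topological.on I01.

Lemma I01_zero_subproof : (0 : R) \in (`[0, 1]%classic : set R).
Proof. by rewrite inE /= in_itv /= lexx ler01. Qed.

Definition I01_zero : I01 := exist _ (0 : R) I01_zero_subproof.

Definition path01 : Type := continuousType I01 R.
HB.instance Definition _ := Choice.on path01.

Lemma cst0_continuous : continuous (fun _ : I01 => 0 : R).
Proof. exact: cst_continuous. Qed.

HB.instance Definition _ := isPointed.Build path01 (mkcts cst0_continuous).

(* The sigma-algebra of C([0,1]) generated by the evaluations; since C([0,1])
   is separable it is the Borel sigma-algebra of the uniform norm. *)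
Definition cylinders : set (set path01) :=
  [set A | exists2 t : I01, True & exists2 B : set R,
     measurable B & A = [set w : path01 | B (w t)]].

Definition C01 : Type := g_sigma_algebraType cylinders.
HB.instance Definition _ := Measurable.on C01.

Definition path_at (w : C01) (t : R) : R := (w : path01) (insubd I01_zero t).

Definition increment (s t : R) (w : C01) : R := path_at w t - path_at w s.

(* A minimum, since w is continuous on a compact set. *)
Definition path_min (w : C01) : R := inf (range (w : path01)).

End path_space.

Section brownian_tilt.
Variable R : realType.

Definition is_standard_Bm (W : probability (C01 R) R) : Prop :=
  [/\ W [set w | path_at w 0 = 0] = 1%E,
      forall s t : R, 0 <= s -> s < t -> t <= 1 ->
        forall B : set R, measurable B ->
          W (increment s t @^-1` B) = normal_prob 0 (Num.sqrt (t - s)) B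
    & forall (n : nat) (t : nat -> R) (B : nat -> set R),
        0 <= t 0%N -> (forall i, (i < n)%N -> t i < t i.+1) -> t n <= 1 ->
        (forall i, measurable (B i)) ->
        W (\bigcap_(i < n) (increment (t i) (t i.+1) @^-1` B i)) =
        (\prod_(i < n) W (increment (t i) (t i.+1) @^-1` B i))%E].

Definition eta_weight (a c : R) (w : C01 R) : R :=
  expR ((a + c) * path_min w - a * path_at w 1).

Definition calH (W : probability (C01 R) R) (a c : R) : R :=
  fine 'E_W[eta_weight a c].

(* eta is a process whose law has density eta_weight a c / calH a c with
   respect to the Wiener measure W. *)
Definition is_eta (W : probability (C01 R) R) (a c : R)
    (d : measure_display) (Omega : measurableType d) (P : probability Omega R)
    (eta : {mfun Omega >-> C01 R}) : Prop :=
  forall A : set (C01 R), measurable A ->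
    distribution P eta A =
    (\int[W]_(w in A) (eta_weight a c w / calH W a c)%:E)%E.

End brownian_tilt.

Section lebesgue_tuple.
Variable R : realType.
Local Notation mR := (measurableTypeR R).

Definition cons_pair (n : nat) (z : mR * n.-tuple mR) : n.+1.-tuple mR :=
  [tuple of z.1 :: z.2].

Lemma measurable_cons_pair n :
  measurable_fun [set: mR * n.-tuple mR] (@cons_pair n).
Proof. exact: measurable_cons. Qed.

Section step.
Local Open Scope ereal_scope.
Variables (n : nat) (m : {sigma_finite_measure set (n.-tuple mR) -> \bar R}).

Definition lebesgue_cons : set (n.+1.-tuple mR) -> \bar R :=
  pushforward (@lebesgue_measure R \x m) (@cons_pair n).

Let nu : {measure set (n.+1.-tuple mR) -> \bar R} :=
  measure_function_pushforward__canonical__measure_function_Measure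
    (@lebesgue_measure R \x m) (@measurable_cons_pair n).

Let lebesgue_cons0 : lebesgue_cons set0 = 0.
Proof. exact: (measure0 nu). Qed.

Let lebesgue_cons_ge0 A : 0 <= lebesgue_cons A.
Proof. exact: (measure_ge0 nu). Qed.

Let lebesgue_cons_sigma_additive : semi_sigma_additive lebesgue_cons.
Proof. exact: (@measure_semi_sigma_additive _ _ _ nu). Qed.

HB.instance Definition _ := isMeasure.Build _ _ _ lebesgue_cons
  lebesgue_cons0 lebesgue_cons_ge0 lebesgue_cons_sigma_additive.

Let lebesgue_cons_sigma_finite : sigma_finite setT lebesgue_cons.
Proof.
have /sigma_finiteP[F [FT ndF Foo]] := sigma_finiteT (@lebesgue_measure R).
have /sigma_finiteP[G [GT ndG Goo]] := sigma_finiteT m.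
pose g (u : n.+1.-tuple mR) : mR * n.-tuple mR :=
  (thead u, [tuple of behead u]).
have mg : measurable_fun setT g.
  apply: measurable_fun_pair; last exact: measurable_behead.
  exact: measurable_tnth.
have gK z : g (cons_pair z) = z.
  by case: z => y u; rewrite /g theadE; congr pair; apply: val_inj.
exists (fun k => g @^-1` (F k `*` G k)).
  apply/esym; rewrite -subTset => u _.
  have [i _ Fi] : (\bigcup_k F k) (g u).1 by rewrite -FT.
  have [j _ Gj] : (\bigcup_k G k) (g u).2 by rewrite -GT.
  exists (maxn i j) => //; split.
    by apply: (subsetPset _ _ (ndF _ _ (leq_maxl i j))).
  by apply: (subsetPset _ _ (ndG _ _ (leq_maxr i j))).
move=> k; have [mF Fk] := Foo k; have [mG Gk] := Goo k; split.
  by rewrite -[X in measurable X]setTI; apply: mg => //; exact: measurableX.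
rewrite /lebesgue_cons /pushforward -comp_preimage.
rewrite (_ : g \o _ = id) ?preimage_id; last by apply/funext => z; exact: gK.
by rewrite product_measure1E// lte_mul_pinfty// ge0_fin_numE.
Qed.

HB.instance Definition _ := Measure_isSigmaFinite.Build _ _ _ lebesgue_cons
  lebesgue_cons_sigma_finite.

End step.

Fixpoint lebesgue_tuple (n : nat) :
    {sigma_finite_measure set (n.-tuple mR) -> \bar R} :=
  match n with
  | 0 => (\d_([tuple] : 0.-tuple mR))
  | n'.+1 => lebesgue_cons (lebesgue_tuple n')
  end.

End lebesgue_tuple.

Section Phi.
Variable R : realType.
Variables (a c : R) (d : nat) (x_ c_ : nat -> R).

Definition pkern (t u v : R) : R :=
  2 * t * Num.sqrt v /
  (pi * (t ^+ 4 + 2 * (u + v) * t ^+ 2 + (u - v) ^+ 2)).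

Definition tail_sum (k : nat) : R := \sum_(k <= j < d.+1) c_ j.
Definition step_size (k : nat) : R := x_ k - x_ k.-1.
Local Notation s_ := tail_sum.
Local Notation dx_ := step_size.

Definition pos_orthant (n : nat) : set (n.-tuple (measurableTypeR R)) :=
  [set u | forall i, 0 < tnth u i].

Definition Phi_top : R :=
  expR (4^-1 * \sum_(1 <= k < d.+1) dx_ k * (s_ k - c) ^+ 2) *
  ((2 * c - 2 * s_ d) / (c - 2 * s_ d - a)).

(* In both integrals u_(l+1), ..., u_d are the entries 0, ..., d-l-1 of the
   tuple u. *)
Definition Phi_bot : R :=
  (a + c) / pi *
  \int[lebesgue_tuple R d]_(u in @pos_orthant d)
    (let u_ k := nth 0 u k.-1 in
     expR (- 4^-1 * \sum_(1 <= k < d.+1) u_ k * dx_ k) *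
     (Num.sqrt (u_ 1%N) / ((c - s_ 1) ^+ 2 + u_ 1%N)) *
     ((a + s_ d) ^+ 2 + u_ d)^-1 *
     \prod_(2 <= k < d.+1) pkern (c_ k.-1) (u_ k.-1) (u_ k)).

Definition Phi_mid (l : nat) : R :=
  (a + c) / pi *
  \int[lebesgue_tuple R (d - l)]_(u in @pos_orthant (d - l))
    (let u_ k := nth 0 u (k - l.+1) in
     expR (- 4^-1 * \sum_(l.+1 <= k < d.+1) dx_ k * u_ k +
           4^-1 * \sum_(1 <= k < l.+1) dx_ k * (s_ k - c) ^+ 2) *
     (\prod_(l.+2 <= k < d.+1) pkern (c_ k.-1) (u_ k.-1) (u_ k)) *
     (Num.sqrt (u_ l.+1) / ((a + s_ d) ^+ 2 + u_ d)) *
     (4 * (c - s_ l) * (s_ l.+1 - s_ l) /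
      (((c - s_ l.+1) ^+ 2 + u_ l.+1) *
       ((c - 2 * s_ l + s_ l.+1) ^+ 2 + u_ l.+1)))).

Definition Phi (l : nat) : R :=
  if l == d then Phi_top else if l == 0%N then Phi_bot else Phi_mid l.

End Phi.

(* Main.v *)
(* Write p for the path divided by [sqrt 2] and y for its height above its
   running minimum.  On a time grid, y is a Gaussian walk reflected at 0, and a
   new minimum multiplies the exponential weight by a factor of rate
   kap_k = s_k - c, which depends only on the interval [x_(k-1), x_k].  The
   weighted expectation over one interval is therefore an iterate of a
   reflection operator, and a Lyapunov estimate that absorbs the error made at
   the boundary shows that the iterates converge, as the mesh goes to 0, to the
   heat semigroup on the half-line with the Robin condition
   f'(0) = - kap_k * f(0).  This semigroup is diagonalised by the bound state
   exp(- kap_k * y) and by the functions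
   (k * cos (k * y) - kap_k * sin (k * y)) / (kap_k ^ 2 + k ^ 2), with u = k ^ 2.

   At x_k one multiplies by exp(- c_k * y): this maps the bound state of kap_(k+1)
   to that of kap_k, and an oscillating function to an integral of oscillating
   ones against the kernel p_(c_k) plus a multiple of the bound state.  Going
   backwards from exp(- (a + c_d) * y), the term Phi_(d,l) collects the
   contributions that enter the bound state at level l (never, if l = 0).
   Finally the grid minima converge from above to the minimum of the path, and
   monotonicity together with Fatou's lemma identifies the limit. *)

Require Import Defs.
From mathcomp Require Import all_boot all_order all_algebra.
From mathcomp Require Import all_classical all_reals all_analysis.
From mathcomp Require Import measurable_realfun.
From mathcomp Require Import ring lra.
Set Implicit Arguments.
Unset Strict Implicit.
Unset Printing Implicit Defensive.
Import Order.TTheory GRing.Theory Num.Theory.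
Import numFieldNormedType.Exports.
Local Open Scope classical_set_scope.
Local Open Scope ring_scope.

(** * Integration on the half-line and Fubini's theorem *)

(** At a crossing of 0 the walk is continued with the weight e^(kap |z|), a Robin function
    analytically; the two agree only to first order. A step started near 0 thus has an error of
    order h, and over 1/h steps this uniform bound does not vanish. The walk is seldom near 0,
    however: z^2 is split, up to exponentials, into eps |z| + eps^(-2) z^4. The second part is
    O(h^2) in mean; the first is eps times the expected undershoot, whose sum over the steps is a
    discrete local time, and this is what the Lyapunov function bounds. The bound state is continued
    exactly and has no error.

    The constants blow up with the frequency, and the weight 1/(alpha^2 + u) at which the recursion
    starts is not integrable. Weights are therefore measured in L^1 against 1/sqrt(kap^2 + u), which
    bounds the Robin functions for all y, and high frequencies are cut off before the mesh is
    refined.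

    The hypothesis a < - c gives the minimum a positive rate and makes kap_d larger than the rate a
    + c_d of the exponential expanded against it; - c_d < a makes that rate positive. *)

Section half_line_integrals.
Context {R : realType}.
Implicit Types (f g F G : R -> R) (a b t x y z : R).
Notation mu := (@lebesgue_measure R).

(** Both [g] and [f + g] are nonnegative on the ray, so the monotone fundamental theorem applies to
    each; the signed [f] follows by subtraction. *)
Lemma integral_ray f g F G a (lF lG : R) :
  continuous f -> continuous g ->
  (forall x, is_derive x 1 F (f x)) -> (forall x, is_derive x 1 G (g x)) ->
  (forall x, a <= x -> `|f x| <= g x) ->
  F x @[x --> +oo] --> lF -> G x @[x --> +oo] --> lG ->
  mu.-integrable `[a, +oo[ (EFin \o f) /\
  (\int[mu]_(x in `[a, +oo[) (f x)%:E = (lF - F a)%:E)%E.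
Proof.
move=> cf cg dF dG fg cvF cvG.
have mI : measurable (`[a, +oo[ : set (measurableTypeR R)) by [].
have key (h H : R -> R) (l : R) : continuous h -> (forall x, is_derive x 1 H (h x)) ->
    (forall x, a <= x -> 0 <= h x) -> H x @[x --> +oo] --> l ->
    mu.-integrable `[a, +oo[ (EFin \o h) /\
    (\int[mu]_(x in `[a, +oo[) (h x)%:E = (l - H a)%:E)%E.
  move=> ch dH h0 cvH.
  have E : (\int[mu]_(x in `[a, +oo[) (h x)%:E = (l - H a)%:E)%E.
    rewrite (@ge0_continuous_FTC2y _ h H a l)// ?EFinB//.
    - by apply: continuous_subspaceT.
    - by apply: cvg_at_right_filter; apply/differentiable_continuous/derivable1_diffP.
    - by move=> x _; rewrite derive1E; apply: derive_val.
  split => //; apply/integrableP; split.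
    apply/measurable_EFinP; apply: measurable_funTS.
    exact: continuous_measurable_fun.
  rewrite (_ : integral _ _ _ = (l - H a)%:E) ?ltry// -E.
  apply: eq_integral => x.
  by rewrite inE/= in_itv/= andbT => ax; rewrite /= ger0_norm// h0.
have [ig Eg] := key _ _ _ cg dG (fun x ax => le_trans (normr_ge0 _) (fg x ax)) cvG.
have [| | |i2 E2] := key (f \+ g) (F \+ G) (lF + lG).
- by move=> x; apply: cvgD; [exact: cf|exact: cg].

- by move=> x /fg; rewrite ler_norml /= => /andP[]; lra.
- exact: cvgD.
have fE : EFin \o f = ((EFin \o (f \+ g)%R) \- (EFin \o g))%E.
  by apply/funext => x /=; rewrite -EFinB addrK.
split; first by rewrite fE; exact: integrableB.
transitivity (\int[mu]_(x in `[a, +oo[) ((EFin \o (f \+ g)%R) \- (EFin \o g)) x)%E.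
  by apply: eq_integral => x _; rewrite /= -EFinB addrK.
rewrite integralB// E2 Eg -EFinB; congr EFin => /=; lra.
Qed.

(** Differentiation acts linearly on the pair (A, B), so an antiderivative in the same family is
    found by inverting a 2 x 2 matrix of determinant a^2 + b^2. *)
Definition damped a b A B x : R := expR (- (a * x)) * (A * cos (b * x) + B * sin (b * x)).

Lemma is_derive_damped a b A B x :
  is_derive x 1 (damped a b A B) (damped a b (b * B - a * A) (- (a * B) - b * A) x).
Proof.
rewrite /damped; apply: is_derive_eq.
rewrite /GRing.scale/=; ring.
Qed.

Lemma continuous_damped a b A B : continuous (damped a b A B).
Proof.
by move=> x; apply/differentiable_continuous/derivable1_diffP; have [] := is_derive_damped a b A B x.
Qed.

Lemma damped_le a b A B x : `|damped a b A B x| <= (`|A| + `|B|) * expR (- (a * x)).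
Proof.
rewrite /damped normrM ger0_norm ?expR_ge0// mulrC ler_wpM2r ?expR_ge0//.
apply: le_trans (ler_normD _ _) _; rewrite !normrM.
by apply: lerD; rewrite ler_piMr// ler_norml ?cos_geN1 ?cos_le1 ?sin_geN1 ?sin_le1.
Qed.

Lemma cvg_expRNM a : 0 < a -> expR (- (a * x)) @[x --> +oo] --> (0 : R).
Proof.
move=> a0; apply: (@cvg_comp _ _ _ ( *%R a) (fun x => expR (- x)) _ (pinfty_nbhs R)).
  by apply: gt0_cvgMry a0 _; exact: cvg_id.
exact: cvgr_expR.
Qed.

Lemma cvg_damped a b A B : 0 < a -> damped a b A B x @[x --> +oo] --> (0 : R).
Proof.
move=> a0; apply/cvgr0Pnorm_le => e e0.
have /cvgr0Pnorm_le H : (`|A| + `|B|) * expR (- (a * x)) @[x --> +oo] --> (0 : R).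
  by rewrite -[X in _ --> X](mulr0 (`|A| + `|B|)); apply: cvgMr; exact: cvg_expRNM.
near=> x; apply: le_trans (damped_le _ _ _ _ _) _.
rewrite -[leLHS]ger0_norm ?mulr_ge0 ?expR_ge0 ?addr_ge0//.
by near: x; exact: H.
Unshelve. all: by end_near. Qed.

Lemma damped_ray a b A B t : 0 < a ->
  mu.-integrable `[t, +oo[ (EFin \o damped a b A B) /\
  (\int[mu]_(x in `[t, +oo[) (damped a b A B x)%:E =
   (damped a b ((a * A + b * B) / (a ^+ 2 + b ^+ 2))
               ((a * B - b * A) / (a ^+ 2 + b ^+ 2)) t)%:E)%E.
Proof.
move=> a0; set A' := _ / _; set B' := _ / _.
have n0 : a ^+ 2 + b ^+ 2 != 0 by rewrite gt_eqF// ltr_wpDr ?sqr_ge0 ?exprn_gt0.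
(* The majorant is a pure exponential, written as [damped] with frequency 0, so that its
   antiderivative is of the same form; both antiderivatives vanish at infinity. *)
have [| | | | | | |i E] := @integral_ray (damped a b A B) (damped a 0 (`|A| + `|B|) 0)
  (damped a b (- A') (- B')) (damped a 0 (- ((`|A| + `|B|) / a)) 0) t 0 0.
- exact: continuous_damped.
- exact: continuous_damped.
- move=> x; apply: is_derive_eq (is_derive_damped _ _ _ _ _) _.
  by congr damped; rewrite /A' /B'; field.
- move=> x; apply: is_derive_eq (is_derive_damped _ _ _ _ _) _.
  by congr damped; field; rewrite gt_eqF.
- move=> x _; apply: le_trans (damped_le _ _ _ _ _) _.
  by rewrite /damped !mul0r cos0; nra.
- exact: cvg_damped.
- exact: cvg_damped.
by split => //; rewrite E /damped; congr EFin; ring.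
Qed.

End half_line_integrals.

Section fubini_on_rectangles.
Local Open Scope ereal_scope.
Context d1 d2 (T1 : measurableType d1) (T2 : measurableType d2) (R : realType).
Variables (m1 : {sigma_finite_measure set T1 -> \bar R})
          (m2 : {sigma_finite_measure set T2 -> \bar R}).
Variables (D1 : set T1) (D2 : set T2) (mD1 : measurable D1) (mD2 : measurable D2).
Implicit Types f : T1 * T2 -> \bar R.

Lemma integral12_patch f : \int[m1]_(x in D1) \int[m2]_(y in D2) f (x, y) =
  \int[m1]_x \int[m2]_y (f \_ (D1 `*` D2)) (x, y).
Proof.
rewrite [LHS]integral_mkcond; apply: eq_integral => x _; rewrite patchE.
case: ifPn => xD.
  rewrite integral_mkcond; apply: eq_integral => y _; rewrite !patchE.
  by rewrite in_setX xD.
by rewrite integral0_eq// => y _; rewrite patchE in_setX (negbTE xD).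
Qed.

Lemma integral21_patch f : \int[m2]_(y in D2) \int[m1]_(x in D1) f (x, y) =
  \int[m2]_y \int[m1]_x (f \_ (D1 `*` D2)) (x, y).
Proof.
rewrite [LHS]integral_mkcond; apply: eq_integral => y _; rewrite patchE.
case: ifPn => yD.
  rewrite integral_mkcond; apply: eq_integral => x _; rewrite !patchE.
  by rewrite in_setX yD andbT.
by rewrite integral0_eq// => x _; rewrite patchE in_setX (negbTE yD) andbF.
Qed.

Lemma measurable_patchX f : measurable_fun setT f ->
  measurable_fun setT (f \_ (D1 `*` D2)).
Proof.
move=> mf; apply/(measurable_restrictT _ _).1; first exact: measurableX.
exact: measurable_funTS.
Qed.

Lemma tonelli_on f : measurable_fun setT f -> (forall z, 0 <= f z) ->
  \int[m1]_(x in D1) \int[m2]_(y in D2) f (x, y) =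
  \int[m2]_(y in D2) \int[m1]_(x in D1) f (x, y).
Proof.
move=> mf f0; rewrite integral12_patch integral21_patch fubini_tonelli//.
- exact: measurable_patchX.
- by move=> z; rewrite patchE; case: ifP.
Qed.

Lemma fubini_on f : measurable_fun setT f ->
  \int[m1]_(x in D1) \int[m2]_(y in D2) `|f (x, y)| < +oo ->
  \int[m1]_(x in D1) \int[m2]_(y in D2) f (x, y) =
  \int[m2]_(y in D2) \int[m1]_(x in D1) f (x, y).
Proof.
move=> mf foo; rewrite integral12_patch integral21_patch Fubini//.
apply/integrable12ltyP; first exact: measurable_patchX.
apply: le_lt_trans foo; rewrite (integral12_patch (abse \o f)).
rewrite le_eqVlt; apply/orP; left; apply/eqP; apply: eq_integral => x _.
apply: eq_integral => y _; rewrite !patchE; case: ifP => //.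
by rewrite abse0.
Qed.

Lemma measurable_integral2 f : measurable_fun setT f -> (forall z, 0 <= f z) ->
  measurable_fun setT (fun x => \int[m2]_(y in D2) f (x, y)).
Proof.
move=> mf f0; under eq_fun do rewrite integral_mkcond.
pose g := f \_ (setT `*` D2).
rewrite (_ : (fun _ => _) = fun x => \int[m2]_y g (x, y)).
  apply: measurable_fun_fubini_tonelli_F.
    apply/(measurable_restrictT _ _).1; first exact: measurableX.
    exact: measurable_funTS.
  by move=> z; rewrite /g patchE; case: ifP.
apply/funext => x; apply: eq_integral => y _; rewrite /g !patchE.
by rewrite in_setX in_setT.
Qed.

Lemma integrable_integral2 f : measurable_fun setT f ->
  \int[m1]_(x in D1) \int[m2]_(y in D2) `|f (x, y)| < +oo ->
  m1.-integrable D1 (fun x => \int[m2]_(y in D2) f (x, y)).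
Proof.
move=> mf foo.
have mp (g : T1 * T2 -> \bar R) : measurable_fun setT g ->
    (forall z, 0 <= g z) ->
    measurable_fun D1 (fun x => \int[m2]_(y in D2) g (x, y)).
  by move=> mg g0; apply: measurable_funTS; exact: measurable_integral2.
have mF : measurable_fun D1 (fun x => \int[m2]_(y in D2) f (x, y)).
  rewrite (_ : (fun _ => _) = (fun x => \int[m2]_(y in D2) f^\+ (x, y)) \-
      (fun x => \int[m2]_(y in D2) f^\- (x, y))); last first.
    apply/funext => x; rewrite [LHS]integralE; congr (_ - _); apply: eq_integral => y _; [rewrite !funeposE|rewrite !funenegE]; by [].
  apply: emeasurable_funB; apply: mp.
  - exact: measurable_funepos.
  - by move=> z; exact: funepos_ge0.
  - exact: measurable_funeneg.
  - by move=> z; exact: funeneg_ge0.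
apply/integrableP; split=> //.
apply: le_lt_trans foo; apply: ge0_le_integral => //.
- exact: measurableT_comp.
- by apply: (mp (abse \o f)) => [|z]; [exact: measurableT_comp|exact: abse_ge0].
- move=> x Dx; apply: le_abse_integral => //.
  by apply: measurable_funTS; exact: measurable_fun_pair2.
Qed.

End fubini_on_rectangles.

Section real_integral_helpers.
Context d (T : measurableType d) (R : realType).
Variables (m : {measure set T -> \bar R}) (D : set T) (mD : measurable D).

Lemma EFin_Rintegral (f : T -> R) : m.-integrable D (EFin \o f) ->
  (\int[m]_(x in D) f x)%:E = (\int[m]_(x in D) (f x)%:E)%E.
Proof. by move=> intf; rewrite fineK//; exact: integrable_fin_num. Qed.

Lemma integrable_le (f g : T -> R) : measurable_fun D f ->
  (forall x, D x -> `|f x| <= g x) -> m.-integrable D (EFin \o g) ->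
  m.-integrable D (EFin \o f).
Proof.
move=> mf fg; apply: le_integrable => //; first exact/measurable_EFinP.
by move=> x Dx; rewrite /= lee_fin (le_trans (fg x Dx))// ler_norm.
Qed.

Lemma dominated_cvg_Rintegral (f_ : nat -> T -> R) (f g : T -> R) :
  (forall n, measurable_fun D (f_ n)) -> measurable_fun D f ->
  m.-integrable D (EFin \o g) ->
  (forall n x, D x -> `|f_ n x| <= g x) ->
  (forall x, D x -> f_ n x @[n --> \oo] --> f x) ->
  \int[m]_(x in D) f_ n x @[n --> \oo] --> \int[m]_(x in D) f x.
Proof.
move=> mf_ mf ig fg ff.
have [|||||i _ c] := @dominated_convergence _ _ _ m D mD (fun n x => (f_ n x)%:E)
  (EFin \o f) (EFin \o g).
- by move=> n; exact/measurable_EFinP.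
- exact/measurable_EFinP.
- by apply: aeW => x Dx; apply: cvg_EFin; [exact: nearW|exact: ff].
- exact: ig.
- by apply: aeW => x n Dx; rewrite lee_fin fg.
apply: fine_cvg; rewrite EFin_Rintegral//; exact: c.
Qed.

End real_integral_helpers.

Section real_fubini.
Context d1 d2 (T1 : measurableType d1) (T2 : measurableType d2) (R : realType).
Variables (m1 : {sigma_finite_measure set T1 -> \bar R})
          (m2 : {sigma_finite_measure set T2 -> \bar R}).
Variables (D1 : set T1) (D2 : set T2) (mD1 : measurable D1) (mD2 : measurable D2).

(** Every slice, not almost every one, is assumed integrable: the real inner integral then agrees
    with the extended one at each point. *)
Lemma Rfubini (f : T1 * T2 -> R) : measurable_fun setT f ->
  (forall x, D1 x -> m2.-integrable D2 (fun y => (f (x, y))%:E)) ->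
  (forall y, D2 y -> m1.-integrable D1 (fun x => (f (x, y))%:E)) ->
  (\int[m1]_(x in D1) \int[m2]_(y in D2) `|f (x, y)|%:E < +oo)%E ->
  m1.-integrable D1 (fun x => (\int[m2]_(y in D2) f (x, y))%:E) /\
  \int[m1]_(x in D1) \int[m2]_(y in D2) f (x, y) =
  \int[m2]_(y in D2) \int[m1]_(x in D1) f (x, y).
Proof.
move=> mf i2 i1 foo.
have mfE : measurable_fun setT (EFin \o f) by exact/measurable_EFinP.
split.
  apply: eq_integrable (integrable_integral2 mD1 mD2 mfE foo) => //.
  by move=> x /set_mem Dx; rewrite EFin_Rintegral//; exact: i2.
congr fine; transitivity (\int[m1]_(x in D1) \int[m2]_(y in D2) (f (x, y))%:E)%E.
  by apply: eq_integral => x /set_mem Dx; rewrite EFin_Rintegral//; exact: i2.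
rewrite (fubini_on mD1 mD2 mfE foo).
by apply: eq_integral => y /set_mem Dy; rewrite EFin_Rintegral//; exact: i1.
Qed.

(** A product majorant with integrable factors controls the slices and the absolute double integral
    at once. *)
Lemma Rfubini_le (f : T1 * T2 -> R) (g : T1 -> R) (h : T2 -> R) :
  measurable_fun setT f ->
  m1.-integrable D1 (EFin \o g) -> m2.-integrable D2 (EFin \o h) ->
  (forall x y, D1 x -> D2 y -> `|f (x, y)| <= g x * h y) ->
  m1.-integrable D1 (fun x => (\int[m2]_(y in D2) f (x, y))%:E) /\
  \int[m1]_(x in D1) \int[m2]_(y in D2) f (x, y) =
  \int[m2]_(y in D2) \int[m1]_(x in D1) f (x, y).
Proof.
move=> mf ig ih fgh; apply: Rfubini => //.
- move=> x Dx; apply: (@integrable_le _ _ _ m2 D2 mD2 _ (fun y => g x * h y)).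
  + by apply: measurable_funTS; exact: measurable_fun_pair2.
  + by move=> y Dy; exact: fgh.
  + by apply: eq_integrable (integrableZl mD2 (g x) ih).
- move=> y Dy; apply: (@integrable_le _ _ _ m1 D1 mD1 _ (fun x => g x * h y)).
  + by apply: measurable_funTS; exact: measurable_fun_pair1.
  + by move=> x Dx; exact: fgh.
  + apply: eq_integrable (integrableZl mD1 (h y) ig) => //.
    by move=> x _; rewrite /= mulrC EFinM.
have /integrableP[_ goo] := ig; have /integrableP[mh hoo] := ih.
have mga : measurable_fun D1 (fun x => `|g x|%:E).
  by apply/measurable_EFinP/measurableT_comp => //; exact/measurable_EFinP/(measurable_int m1 ig).
have mha : measurable_fun D2 (fun x => `|h x|%:E).
  by apply/measurable_EFinP/measurableT_comp => //; exact/measurable_EFinP.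
apply: (@le_lt_trans _ _ (\int[m1]_(x in D1) (`|g x|%:E * \int[m2]_(y in D2) `|h y|%:E))%E).
  apply: ge0_le_integral => //.
  - by move=> x Dx; apply: integral_ge0 => y _; rewrite lee_fin.
  - apply: measurable_funTS; apply: (@measurable_integral2 _ _ _ _ _ m2 D2 mD2 (fun z => `|f z|%:E)).
    + by apply/measurable_EFinP; exact: measurableT_comp.
    + by move=> z; rewrite lee_fin.
  - exact: emeasurable_funM.
  - move=> x Dx; rewrite -ge0_integralZl//.
    + apply: ge0_le_integral => //.
      * by apply/measurable_EFinP/measurableT_comp => //; apply: measurable_funTS; exact: measurable_fun_pair2.
      * exact: emeasurable_funM.
      * by move=> y Dy; rewrite -EFinM lee_fin -normrM (le_trans (fgh _ _ Dx Dy))// ler_norm.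
rewrite ge0_integralZr//.
- by rewrite lte_mul_pinfty// ?integral_ge0// ge0_fin_numE// integral_ge0.
- by apply: integral_ge0.
Qed.

End real_fubini.

(** * Robin eigenfunctions and their spectral identities *)

Section fourier_inversion.
Context {R : realType}.
Notation mu := (@lebesgue_measure R).
Notation ray := (`[0, +oo[%classic : set (measurableTypeR R)).
Implicit Types (x y z k e : R).

(** The Poisson kernel of the half-plane without its factor 1/pi: the cosine transform of e^(- e x),
    and an approximate identity as [e] tends to 0. *)
Definition cauchy_ker e z : R := e / (e ^+ 2 + z ^+ 2).

Lemma cauchy_den_gt0 e z : 0 < e -> 0 < e ^+ 2 + z ^+ 2.
Proof. by move=> e0; rewrite ltr_wpDr ?sqr_ge0 ?exprn_gt0. Qed.

Lemma cauchy_ker_ge0 e z : 0 < e -> 0 <= cauchy_ker e z.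
Proof. by move=> e0; rewrite divr_ge0 ?ltW ?cauchy_den_gt0. Qed.

Lemma cauchy_ker_le e z : 0 < e -> `|cauchy_ker e z| <= e^-1.
Proof.
move=> e0; rewrite ger0_norm ?cauchy_ker_ge0// /cauchy_ker.
rewrite ler_pdivrMr ?cauchy_den_gt0// mulrDr expr2 mulrA mulVf ?gt_eqF// mul1r.
by rewrite lerDl mulr_ge0 ?sqr_ge0// invr_ge0 ltW.
Qed.

Lemma continuous_cauchy_ker e y : 0 < e -> continuous (fun x => cauchy_ker e (x - y)).
Proof.
move=> e0 x; apply: cvgM; first exact: cvg_cst.
apply: cvgV; first by rewrite gt_eqF// cauchy_den_gt0.
apply: cvgD; first exact: cvg_cst.
apply: (@continuous_comp _ _ _ (fun x => x - y) (fun z : R => z ^+ 2)).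
  by apply: cvgB; [exact: cvg_id|exact: cvg_cst].
exact: exprn_continuous.
Qed.

Lemma cauchy_ker_ray e y : 0 < e ->
  mu.-integrable ray (fun x => (cauchy_ker e (x - y))%:E) /\
  \int[mu]_(x in ray) cauchy_ker e (x - y) = pi / 2 + atan (y / e).
Proof.
move=> e0.
have dF x : is_derive x 1 (fun x => atan ((x - y) / e)) (cauchy_ker e (x - y)).
  have dG : is_derive x 1 (fun x : R => (x - y) / e) (e^-1).
    by apply: is_derive_eq; rewrite /GRing.scale/=; ring.
  have dA : is_derive ((x - y) / e) 1 (@atan R) (1 + ((x - y) / e) ^+ 2)^-1.
    by split; [exact: derivable_atan|rewrite -derive1E derive1_atan].
  apply: is_derive_eq (@is_derive1_comp _ (@atan R) (fun x => (x - y) / e) _ _ _ dA dG) _.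
  rewrite /cauchy_ker /GRing.scale/=.
  by field; rewrite !gt_eqF ?cauchy_den_gt0.
have cF : atan ((x - y) / e) @[x --> +oo] --> (pi / 2 : R).
  apply: (@cvg_comp _ _ _ (fun x => (x - y) / e) (@atan R) _ (pinfty_nbhs R)).
    apply: gt0_cvgMly; first by rewrite invr_gt0.
    exact: cvg_addrr.
  exact: cvgy_atan.
have [|i E] := @integral_ray R _ _ _ _ 0 _ _ (@continuous_cauchy_ker e y e0)
   (@continuous_cauchy_ker e y e0) dF dF _ cF cF.
  by move=> x _; rewrite ger0_norm// cauchy_ker_ge0.
split => //; rewrite /Rintegral E /= sub0r mulNr atanN; ring.
Qed.

(** The limit, as the width tends to 0, of the mass that a Poisson kernel centred at [y] has on the
    half-line. *)
Definition half_mass y : R := if 0 < y then pi else if y == 0 then pi / 2 else 0.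

Lemma cvg_atan_scale y :
  pi / 2 + atan (y / n.+1%:R^-1) @[n --> \oo] --> half_mass y.
Proof.
rewrite [X in X @ _ --> _](_ : _ = (fun n : nat => pi / 2 + atan (y * n.+1%:R))); last first.
  by apply/funext => n; rewrite invrK.
have pos z : 0 < z -> atan (z * n.+1%:R) @[n --> \oo] --> (pi / 2 : R).
  move=> z0; apply: (@cvg_comp _ _ _ (fun n : nat => z * n.+1%:R) (@atan R) _ (pinfty_nbhs R)).
    apply: (@cvg_comp _ _ _ (fun n : nat => n.+1%:R : R) ( *%R z) _ (pinfty_nbhs R)).
      by rewrite (cvg_shiftS (fun n => n%:R : R)); exact: cvgr_idn.
    by apply: (gt0_cvgMry z0); exact: cvg_id.
  exact: cvgy_atan.
have [y0|y0|y0] := ltgtP y 0.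
- rewrite /half_mass ltNge (ltW y0)/= (lt_eqF y0) -[X in _ --> X](subrr (pi / 2)).
  apply: cvgD; first exact: cvg_cst.
  rewrite [X in X @ _ --> _](_ : _ = (fun n : nat => - atan ((- y) * n.+1%:R))).
    by apply: cvgN; apply: pos; rewrite oppr_gt0.
  by apply/funext => n; rewrite mulNr atanN opprK.
- rewrite /half_mass y0 [X in _ --> X](_ : pi = pi / 2 + pi / 2); last by field.
  by apply: cvgD; [exact: cvg_cst|exact: pos].
- rewrite /half_mass y0 ltxx eqxx.
  rewrite [X in X @ _ --> _](_ : _ = cst (pi / 2)); first exact: cvg_cst.
  by apply/funext => n; rewrite mul0r atan0 addr0.
Qed.

(** One majorant for all widths e <= 1. For |s| <= 1 the Lipschitz bound on [D] compensates the
    peak, through e |s| <= (e^2 + s^2) / 2; for |s| > 1 boundedness of [D] suffices. *)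
Lemma cauchy_ker_majorant (M D e s : R) : 0 <= M -> 0 < e -> e <= 1 ->
  D <= M * `|s| -> D <= 2 * M -> D * cauchy_ker e s <= 4 * M * cauchy_ker 1 s.
Proof.
move=> M0 e0 e1 D1 D2; have d1 := cauchy_den_gt0 s e0.
have d2 : 0 < 1 + s ^+ 2 by have := sqr_ge0 s; lra.
rewrite /cauchy_ker expr1n mulrA div1r ler_pdivrMr// mulrAC ler_pdivlMr//.
have s2 : s ^+ 2 = `|s| ^+ 2 by rewrite real_normK ?num_real.
rewrite s2; have := normr_ge0 s; move: `|s| D1 => S D1 S0.
have [S1|S1] := leP S 1.
  apply: (@le_trans _ _ (M * (S * e * (1 + S ^+ 2)))).
    rewrite !mulrA ler_wpM2r ?addr_ge0 ?sqr_ge0//.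
    by rewrite ler_wpM2r// ltW.
  rewrite -[_ * M * _]mulrAC mulrC ler_wpM2r//.
  have : S * e <= (e ^+ 2 + S ^+ 2) / 2 by have := sqr_ge0 (e - S); nra.
  have : S ^+ 2 <= 1 by nra.
  have : 0 <= S * e by rewrite mulr_ge0// ltW.
  by nra.
apply: (@le_trans _ _ (M * (2 * e * (1 + S ^+ 2)))).
  rewrite !mulrA ler_wpM2r ?addr_ge0 ?sqr_ge0//.
  by rewrite (mulrC M) ler_wpM2r// ltW.
rewrite -[_ * M * _]mulrAC mulrC ler_wpM2r//; nra.
Qed.

Section approximate_identity.
Variables (phi : R -> R) (M : R).
Hypotheses (mphi : measurable_fun setT phi) (M0 : 0 <= M)
  (phiM : forall x, 0 <= x -> `|phi x| <= M)
  (phiL : forall x y, 0 <= x -> 0 <= y -> `|phi x - phi y| <= M * `|x - y|).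

(** The difference from [phi |y|] tends to 0 by dominated convergence, and the constant is
    integrated by the arctangent. The absolute value keeps the reference point where [phi] is
    controlled; for y < 0 the limit is 0 in any case. *)
Lemma cvg_cauchy_ker y :
  \int[mu]_(x in ray) (phi x * cauchy_ker n.+1%:R^-1 (x - y)) @[n --> \oo]
  --> half_mass y * phi `|y|.
Proof.
pose e n : R := n.+1%:R^-1.
have e0 n : 0 < e n by rewrite invr_gt0.
have e1 n : e n <= 1 by rewrite invf_le1// ler1n.
have mC n : measurable_fun setT (fun x => cauchy_ker (e n) (x - y)).
  by apply: continuous_measurable_fun; exact: continuous_cauchy_ker.
have iC n := (cauchy_ker_ray y (e0 n)).1.
have diff x : 0 <= x -> `|phi x - phi `|y| | <= M * `|x - y|.
  move=> x0; apply: le_trans (phiL x0 (normr_ge0 y)) _; apply: ler_wpM2l => //.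
  rewrite -{1}(ger0_norm x0); exact: ler_dist_dist.
have diff2 x : 0 <= x -> `|phi x - phi `|y| | <= 2 * M.
  move=> x0; apply: le_trans (ler_normB _ _) _.
  by rewrite mulr_natl mulr2n lerD// phiM.
pose rest n x := (phi x - phi `|y|) * cauchy_ker (e n) (x - y).
have mrest n : measurable_fun ray (rest n).
  by apply: measurable_funTS; apply: measurable_funM; [exact: measurable_funB|exact: mC].
have restle n x : 0 <= x -> `|rest n x| <= 4 * M * cauchy_ker 1 (x - y).
  move=> x0; rewrite /rest normrM (ger0_norm (cauchy_ker_ge0 _ (e0 n))).
  have := diff _ x0; have := diff2 _ x0.
  by move=> D2 D1; apply: cauchy_ker_majorant.
have mray : measurable ray by [].
have cvrest : \int[mu]_(x in ray) rest n x @[n --> \oo] --> (0 : R).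
  rewrite [X in _ --> X](_ : 0 = \int[mu]_(x in ray) (cst 0 : R -> R) x); last first.
    by rewrite Rintegral_cst ?mul0r.
  apply: (@dominated_cvg_Rintegral _ _ _ mu ray mray rest (cst 0) (fun x => 4 * M * cauchy_ker 1 (x - y))) => //.
  - exact: eq_integrable (integrableZl _ (4 * M) (cauchy_ker_ray y ltr01).1).
  - by move=> n x /=; rewrite in_itv/= andbT; exact: restle.
  - move=> x /=; rewrite in_itv/= andbT => x0.
    have [xy|xy] := eqVneq x y.
      have -> : (fun n => rest n x) = cst 0; last exact: cvg_cst.
      by apply/funext => n; rewrite /rest -xy (ger0_norm x0) subrr mul0r.
    rewrite -[X in _ --> X](mulr0 (phi x - phi `|y|)); apply: cvgMr.
    have s0 : (x - y) ^+ 2 != 0 by rewrite expf_neq0// subr_eq0.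
    have e_cvg : e n @[n --> \oo] --> (0 : R) by exact: cvg_harmonic.
    rewrite -[X in _ --> X](mul0r ((0 * 0 + (x - y) ^+ 2)^-1)).
    apply: cvgM => //; apply: cvgV; first by rewrite mul0r add0r.
    by apply: cvgD; [exact: cvgM|exact: cvg_cst].
have -> : (fun n => \int[mu]_(x in ray) (phi x * cauchy_ker n.+1%:R^-1 (x - y))) =
    (fun n => \int[mu]_(x in ray) rest n x + phi `|y| * (pi / 2 + atan (y / e n))).
  apply/funext => n; have [i E] := cauchy_ker_ray y (e0 n).
  rewrite -E -RintegralZl//.
  have irest : mu.-integrable ray (EFin \o rest n).
    apply: (@integrable_le _ _ _ mu ray mray _ (fun x => 4 * M * cauchy_ker 1 (x - y))) => //.
    + by move=> x /=; rewrite in_itv/= andbT; exact: restle.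
    + exact: eq_integrable (integrableZl _ (4 * M) (cauchy_ker_ray y ltr01).1).
  rewrite -RintegralD//; last exact: eq_integrable (integrableZl _ (phi `|y|) i).
  by apply: eq_Rintegral => x _; rewrite /rest -mulrDl subrK.
rewrite -[X in _ --> X]add0r; apply: cvgD => //.
rewrite (mulrC (half_mass y)); apply: cvgMr; exact: cvg_atan_scale.
Qed.

End approximate_identity.
End fourier_inversion.

(** * Abel summation of the cosine and sine transforms *)

Section half_line_fourier.
Context {R : realType}.
Notation mu := (@lebesgue_measure R).
Notation ray := (`[0, +oo[%classic : set (measurableTypeR R)).
Implicit Types (x y z k e : R).
Variables (phi : R -> R) (M : R).
Hypotheses (M0 : 0 <= M) (phiM : forall x, 0 <= x -> `|phi x| <= M)
  (phiL : forall x y, 0 <= x -> 0 <= y -> `|phi x - phi y| <= M * `|x - y|).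
Variables (tr : R -> R) (sg : R).
Hypotheses (ctr : continuous tr) (tr1 : forall z, `|tr z| <= 1)
  (trM : forall a b, 2 * (tr a * tr b) = cos (a - b) + sg * cos (a + b))
  (cphi : continuous phi) (iphi : mu.-integrable ray (EFin \o phi)).

(** [tr] with [sg] stands for [cos] with 1 or [sin] with -1; the product formula [trM] lets one
    argument serve both transforms. *)
Let hat k : R := \int[mu]_(x in ray) (phi x * tr (k * x)).

(** The factor e^(- e k) makes the double integral absolutely convergent. After the interchange,
    [trM] turns the integral in [k] into Poisson kernels centred at y and - y. *)
Lemma fourier_regularized e y : 0 < e ->
  \int[mu]_(k in ray) (expR (- (e * k)) * (2 * tr (k * y)) * hat k) =
  \int[mu]_(x in ray) (phi x * cauchy_ker e (x - y)) +
  sg * \int[mu]_(x in ray) (phi x * cauchy_ker e (x - - y)).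
Proof.
move=> e0; have mray : measurable ray by [].
have mtr : measurable_fun setT tr by exact: continuous_measurable_fun.
have mP : measurable_fun setT phi by exact: continuous_measurable_fun.
have cexp : measurable_fun setT (fun k : R => expR (- (e * k))).
  by apply: measurableT_comp => //; apply: measurableT_comp => //; exact: measurable_funM.
pose f (z : R * R) := expR (- (e * z.1)) * (2 * tr (z.1 * y)) * (phi z.2 * tr (z.1 * z.2)).
have mf : measurable_fun setT f.
  apply: measurable_funM.
    apply: measurable_funM; first exact: measurableT_comp cexp measurable_fst.
    apply: measurable_funM => //; apply: measurableT_comp => //.
    exact: measurable_funM.
  apply: measurable_funM; first exact: measurableT_comp.
  by apply: measurableT_comp => //; exact: measurable_funM.
have idamp b : mu.-integrable ray (EFin \o damped e b 1 0) /\
    \int[mu]_(k in ray) damped e b 1 0 k = e / (e ^+ 2 + b ^+ 2).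
  have [i E] := @damped_ray R e b 1 0 0 e0; split => //.
  rewrite /Rintegral E /damped /= !mulr0 oppr0 expR0 cos0 sin0; ring.
have iexp : mu.-integrable ray (EFin \o (fun k : R => 2 * expR (- (e * k)))).
  apply: eq_integrable (integrableZl _ 2 (idamp 0).1) => // x _ /=.
  by rewrite /damped mul0r cos0 !mul0r mulr1 addr0 mulr1.
have fle k x : ray k -> ray x -> `|f (k, x)| <= 2 * expR (- (e * k)) * `|phi x|.
  move=> _ _; rewrite /f /= !normrM ger0_norm ?expR_ge0// (ger0_norm (ler0n R 2)).
  have -> : forall E a P b : R, E * (2 * a) * (P * b) = 2 * E * P * (a * b) by move=> *; ring.
  by rewrite ler_piMr ?mulr_ile1 ?tr1// !mulr_ge0 ?expR_ge0.
have [_ swap] := @Rfubini_le _ _ _ _ R mu mu ray ray mray mray f _ _ mf iexp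
  (integrable_norm iphi) fle.
transitivity (\int[mu]_(k in ray) \int[mu]_(x in ray) f (k, x)).
  apply: eq_Rintegral => k _; rewrite -RintegralZl//.
  apply: (@integrable_le _ _ _ mu ray mray _ (fun x => `|phi x|)).
  - apply: measurable_funTS; apply: measurable_funM => //.
    by apply: measurableT_comp => //; exact: measurable_funM.
  - by move=> x _; rewrite normrM ler_piMr.
  - exact: integrable_norm.
rewrite swap.
have iphiC z : mu.-integrable ray (fun x => (phi x * cauchy_ker e (x - z))%:E).
  apply: (@integrable_le _ _ _ mu ray mray _ (fun x => e^-1 * `|phi x|)).
  - apply: measurable_funTS; apply: measurable_funM => //.
    by apply: continuous_measurable_fun; exact: continuous_cauchy_ker.
  - by move=> x _; rewrite normrM mulrC; apply: ler_wpM2r (cauchy_ker_le _ e0).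
  - exact: eq_integrable (integrableZl mray e^-1 (integrable_norm iphi)).
have iphiC' : mu.-integrable ray (EFin \o (fun x => sg * (phi x * cauchy_ker e (x - - y)))).
  exact: eq_integrable (integrableZl mray sg (iphiC (- y))).
rewrite -(RintegralZl sg mray (iphiC (- y))) -(RintegralD mray (iphiC y) iphiC').
apply: eq_Rintegral => x _.
have [i1 E1] := idamp (x - y); have [i2 E2] := idamp (x - - y).
have i2' : mu.-integrable ray (EFin \o (fun k => sg * damped e (x - - y) 1 0 k)).
  exact: eq_integrable (integrableZl mray sg i2).
have i12 : mu.-integrable ray
    (EFin \o (fun k => damped e (x - y) 1 0 k + sg * damped e (x - - y) 1 0 k)).
  exact: eq_integrable (integrableD mray i1 i2').
rewrite {1}/cauchy_ker -E1 /cauchy_ker -E2 [sg * _]mulrCA -mulrDr.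
rewrite -(RintegralZl sg mray i2) -(RintegralD mray i1 i2') -(RintegralZl (phi x) mray i12).
apply: eq_Rintegral => k _; rewrite /f /= /damped !mul0r !addr0 !mul1r.
transitivity (phi x * (expR (- (e * k)) * (2 * (tr (k * x) * tr (k * y))))); first by ring.
by rewrite trM opprK -mulrBr -mulrDr ![k * _]mulrC; ring.
Qed.

(** The regularised identity is taken at e = 1/(n+1). Its left side converges by domination because
    [hat] is integrable, its right side by the approximate identity. *)
Theorem half_line_fourier_inversion y : mu.-integrable ray (EFin \o hat) ->
  \int[mu]_(k in ray) (2 * tr (k * y) * hat k) =
  (half_mass y + sg * half_mass (- y)) * phi `|y|.
Proof.
move=> ihat; have mray : measurable ray by [].
have mhat : measurable_fun ray hat by apply/measurable_EFinP; exact: (measurable_int mu ihat).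
have mtr : measurable_fun setT tr by exact: continuous_measurable_fun.
have mtry : measurable_fun ray (fun k : R => 2 * tr (k * y)).
  apply: measurable_funTS; apply: measurable_funM => //; apply: measurableT_comp => //.
  exact: measurable_funM.
have e0 n : 0 < (n.+1%:R : R)^-1 by rewrite invr_gt0.
have lim1 : \int[mu]_(k in ray) (expR (- (n.+1%:R^-1 * k)) * (2 * tr (k * y)) * hat k)
    @[n --> \oo] --> \int[mu]_(k in ray) (2 * tr (k * y) * hat k).
  apply: (@dominated_cvg_Rintegral _ _ _ mu ray mray
    (fun n k => expR (- (n.+1%:R^-1 * k)) * (2 * tr (k * y)) * hat k)
    (fun k => 2 * tr (k * y) * hat k) (fun k => 2 * `|hat k|)).
  - move=> n; apply: measurable_funM => //; apply: measurable_funM => //.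
    apply: measurable_funTS; apply: measurableT_comp => //; apply: measurableT_comp => //.
    exact: measurable_funM.
  - exact: eq_integrable (integrableZl mray 2 (integrable_norm ihat)).
  - move=> n k /=; rewrite in_itv/= andbT => k0.
    rewrite !normrM ler_wpM2r// ger0_norm ?expR_ge0// (ger0_norm (ler0n R 2)).
    rewrite mulrCA ler_piMr// mulr_ile1 ?expR_ge0 ?tr1//.
    by rewrite -expR0 ler_expR oppr_le0 mulr_ge0// ltW.
  - move=> k _; have ek : expR (- (n.+1%:R^-1 * k)) @[n --> \oo] --> (1 : R).
      rewrite [X in _ --> X](_ : 1 = expR (- (0 * k))); last by rewrite mul0r oppr0 expR0.
      apply: (@cvg_comp _ _ _ (fun n : nat => - (n.+1%:R^-1 * k)) expR _ (nbhs (- (0 * k)))).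
        by apply: cvgN; apply: cvgM; [exact: cvg_harmonic|exact: cvg_cst].
      exact: continuous_expR.
    rewrite -[X in _ --> X]mul1r.
    rewrite [X in X @ _ --> _](_ : _ = (fun n : nat =>
        expR (- (n.+1%:R^-1 * k)) * (2 * tr (k * y) * hat k))); last first.
      by apply/funext => n; rewrite -mulrA.
    by apply: cvgM => //; exact: cvg_cst.
have lim2 : \int[mu]_(k in ray) (expR (- (n.+1%:R^-1 * k)) * (2 * tr (k * y)) * hat k)
    @[n --> \oo] --> (half_mass y + sg * half_mass (- y)) * phi `|y|.
  rewrite [X in X @ _ --> _](_ : _ = (fun n : nat =>
      \int[mu]_(x in ray) (phi x * cauchy_ker n.+1%:R^-1 (x - y)) +
      sg * \int[mu]_(x in ray) (phi x * cauchy_ker n.+1%:R^-1 (x - - y)))); last first.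
    by apply/funext => n; exact: fourier_regularized.
  have mphi : measurable_fun setT phi by exact: continuous_measurable_fun.
  rewrite mulrDl -mulrA; apply: cvgD; first exact: cvg_cauchy_ker phiL _.
  by apply: cvgMr; rewrite -(normrN y); exact: cvg_cauchy_ker phiL _.
exact: (cvg_unique _ lim1 lim2).
Qed.

End half_line_fourier.

(** * Robin functions as Laplace averages of sines and cosines *)

Section spectral_identities.
Context {R : realType}.
Notation mu := (@lebesgue_measure R).
Notation ray := (`[0, +oo[%classic : set (measurableTypeR R)).
Implicit Types (x y z k q a c kap : R).

Lemma Rintegral_damped a b A B t : 0 < a ->
  \int[mu]_(x in `[t, +oo[) damped a b A B x =
  damped a b ((a * A + b * B) / (a ^+ 2 + b ^+ 2)) ((a * B - b * A) / (a ^+ 2 + b ^+ 2)) t.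
Proof. by move=> a0; rewrite /Rintegral (damped_ray b A B t a0).2. Qed.

Lemma damped_lipschitz a b A B x y : 0 < a -> 0 <= x -> 0 <= y ->
  `|damped a b A B x - damped a b A B y| <=
  (`|b * B - a * A| + `|- (a * B) - b * A|) * `|x - y|.
Proof.
move=> a0; wlog xy : x y / x < y.
  move=> H x0 y0; have [|xy|->] := ltgtP x y; first by move=> /H; apply.
    by rewrite distrC (distrC x); apply: H.
  by rewrite !subrr normr0 mulr0.
move=> x0 y0; rewrite distrC (distrC x).
have dF z : is_derive z 1 (damped a b A B) (damped a b (b * B - a * A) (- (a * B) - b * A) z).
  exact: is_derive_damped.
have [z + ->] := @MVT_segment R _ _ x y (ltW xy) (fun z _ => dF z)
   (continuous_subspaceT (@continuous_damped R a b A B)).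
rewrite in_itv/= => /andP[xz _]; rewrite normrM ler_wpM2r//.
apply: le_trans (damped_le _ _ _ _ _) _; rewrite ler_piMr ?addr_ge0//.
by rewrite -expR0 ler_expR oppr_le0 mulr_ge0 ?(ltW a0)// (le_trans x0).
Qed.

Lemma damped_bound a b A B x : 0 < a -> 0 <= x -> `|damped a b A B x| <= `|A| + `|B|.
Proof.
move=> a0 x0; apply: le_trans (damped_le _ _ _ _ _) _; rewrite ler_piMr ?addr_ge0//.
by rewrite -expR0 ler_expR oppr_le0 mulr_ge0 ?(ltW a0).
Qed.

Lemma half_massDN y : half_mass y + half_mass (- y) = pi :> R.
Proof.
rewrite /half_mass oppr_gt0 oppr_eq0.
have [y0|y0|y0] := ltgtP y 0; rewrite ?add0r ?addr0//; by field.
Qed.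

(** Cosine inversion for e^(- a x), whose transform is the Poisson kernel. *)
Lemma Rintegral_cos_cauchy a y : 0 < a ->
  \int[mu]_(k in ray) (2 * cos (k * y) * cauchy_ker a k) = pi * expR (- (a * `|y|)).
Proof.
move=> a0; have mray : measurable ray by [].
have hatE k : \int[mu]_(x in ray) (damped a 0 1 0 x * cos (k * x)) = cauchy_ker a k.
  transitivity (\int[mu]_(x in ray) damped a k 1 0 x).
    apply: eq_Rintegral => x _; rewrite /damped !mul0r cos0; ring.
  by rewrite Rintegral_damped// /damped !mulr0 oppr0 expR0 cos0 sin0 /cauchy_ker; ring.
pose M : R := (`|1 : R| + `|0 : R|) + (`|0 * 0 - a * 1| + `|- (a * 0) - 0 * 1|).
have := @half_line_fourier_inversion R (damped a 0 1 0) M _ _ _ (@cos R) 1 _ _ _ _ _ y _.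
have phiE : (half_mass y + 1 * half_mass (- y)) * damped a 0 1 0 `|y| = pi * expR (- (a * `|y|)).
  by rewrite mul1r half_massDN /damped !mul0r cos0; ring.
rewrite phiE => <-.
- by apply: eq_Rintegral => k _; rewrite hatE.
- by rewrite !addr_ge0.
- by move=> x x0; apply: le_trans (damped_bound 0 1 0 a0 x0) _; rewrite lerDl.
- move=> x z x0 z0; apply: le_trans (damped_lipschitz 0 1 0 a0 x0 z0) _.
  by rewrite ler_wpM2r// lerDr.
- exact: continuous_cos.
- by move=> z; rewrite ler_norml cos_geN1 cos_le1.
- by move=> u v; rewrite cosB cosD; ring.
- exact: continuous_damped.
- exact: (damped_ray 0 1 0 0 a0).1.
- apply: eq_integrable (cauchy_ker_ray 0 a0).1 => // k _ /=.
  by rewrite hatE subr0.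
Qed.

(** Sine inversion for e^(- c x) sin(q x), whose transform is half the difference of the kernels
    centred at q and - q. *)
Lemma Rintegral_sin_cauchy c q y : 0 < c ->
  \int[mu]_(k in ray) ((cauchy_ker c (k - q) - cauchy_ker c (k + q)) * sin (k * y)) =
  pi * (expR (- (c * `|y|)) * sin (q * y)).
Proof.
move=> c0; have mray : measurable ray by [].
pose phi := damped c q 0 1.
have hatE k : \int[mu]_(x in ray) (phi x * sin (k * x)) =
    2^-1 * (cauchy_ker c (k - q) - cauchy_ker c (k - - q)).
  have i1 := (damped_ray (k - q) 1 0 0 c0).1; have i2 := (damped_ray (k - - q) 1 0 0 c0).1.
  transitivity (\int[mu]_(x in ray) (2^-1 * (damped c (k - q) 1 0 x - damped c (k - - q) 1 0 x))).
    by apply: eq_Rintegral => x _; rewrite /phi /damped opprK mulrBl mulrDl cosB cosD; field.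
  rewrite RintegralZl//; last exact: eq_integrable (integrableB mray i1 i2).
  rewrite RintegralB// !Rintegral_damped// /damped !mulr0 oppr0 expR0 cos0 sin0 /cauchy_ker.
  by congr (_ * _); ring.
pose M : R := (`|0 : R| + `|1 : R|) + (`|q * 1 - c * 0| + `|- (c * 1) - q * 0|).
have := @half_line_fourier_inversion R phi M _ _ _ (@sin R) (-1) _ _ _ _ _ y _.
have phiE : (half_mass y + -1 * half_mass (- y)) * phi `|y| =
    pi * (expR (- (c * `|y|)) * sin (q * y)).
  rewrite /phi /damped /half_mass oppr_gt0 oppr_eq0.
  have [y0|y0|y0] := ltgtP y 0.
  - rewrite (ltr0_norm y0) (mulrN q) sinN; ring.
  - rewrite (gtr0_norm y0); ring.
  - rewrite y0 normr0 !mulr0 sin0; ring.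
rewrite phiE => <-.
- by apply: eq_Rintegral => k _; rewrite hatE opprK; field.
- by rewrite !addr_ge0.
- by move=> x x0; apply: le_trans (damped_bound q 0 1 c0 x0) _; rewrite lerDl addr_ge0.
- move=> x z x0 z0; apply: le_trans (damped_lipschitz q 0 1 c0 x0 z0) _.
  by rewrite ler_wpM2r// lerDr addr_ge0.
- exact: continuous_sin.
- by move=> z; rewrite ler_norml sin_geN1 sin_le1.
- by move=> u v; rewrite cosB cosD; ring.
- exact: continuous_damped.
- exact: (damped_ray q 0 1 0 c0).1.
- apply: eq_integrable (integrableZl mray 2^-1
    (integrableB mray (cauchy_ker_ray q c0).1 (cauchy_ker_ray (- q) c0).1)) => // k _ /=.
  by rewrite hatE.
Qed.

(* The Robin eigenfunction psi of the half-line, psi' 0 = - kap * psi 0 and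
   psi'' = - k ^ 2 psi, divided by kap ^ 2 + k ^ 2. *)
Definition robin kap k y : R := (k * cos (k * y) - kap * sin (k * y)) / (kap ^+ 2 + k ^+ 2).

(** An average of sines over the ray from - y with exponential weight of rate [kap]: Fubini then
    reduces integrals of Robin functions in [k] to sine integrals. *)
Lemma robin_sin_integral kap k y : 0 < kap ->
  \int[mu]_(x in `[- y, +oo[) (expR (- (kap * (x + y))) * sin (k * x)) = robin kap k y.
Proof.
move=> kap0; transitivity (\int[mu]_(x in `[- y, +oo[) (expR (- (kap * y)) * damped kap k 0 1 x)).
  apply: eq_Rintegral => x _; rewrite /damped mul0r add0r mul1r mulrA -expRD.
  by congr (expR _ * _); ring.
rewrite RintegralZl//; last exact: (damped_ray k 0 1 _ kap0).1.
rewrite Rintegral_damped// /damped mulrA -expRD !mulrN opprK addNr expR0 cosN sinN /robin; ring.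
Qed.

Lemma robin_cos_integral kap k y : 0 < kap ->
  \int[mu]_(x in `[- y, +oo[) (expR (- (kap * (x + y))) * cos (k * x)) =
  (kap * cos (k * y) + k * sin (k * y)) / (kap ^+ 2 + k ^+ 2).
Proof.
move=> kap0; transitivity (\int[mu]_(x in `[- y, +oo[) (expR (- (kap * y)) * damped kap k 1 0 x)).
  apply: eq_Rintegral => x _; rewrite /damped mul0r addr0 mul1r mulrA -expRD.
  by congr (expR _ * _); ring.
rewrite RintegralZl//; last exact: (damped_ray k 1 0 _ kap0).1.
rewrite Rintegral_damped// /damped mulrA -expRD !mulrN opprK addNr expR0 cosN sinN; ring.
Qed.

(** The right-hand side involves only integrals over full rays, for which closed forms are
    available. *)
Lemma Rintegral_ray_split (f1 f2 : R -> R) y : 0 <= y ->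
  mu.-integrable `[- y, +oo[ (EFin \o f1) -> mu.-integrable ray (EFin \o f2) ->
  \int[mu]_(x in `[- y, +oo[) (if x < 0 then f1 x else f2 x) =
  \int[mu]_(x in `[- y, +oo[) f1 x + (\int[mu]_(x in ray) f2 x - \int[mu]_(x in ray) f1 x).
Proof.
move=> y0 i1 i2; set D : set (measurableTypeR R) := `[- y, +oo[%classic.
have mD : measurable D by exact: measurable_itv.
have mray : measurable ray by [].
have rD : D `&` ray = ray.
  apply/seteqP; split => x; rewrite /D /= !in_itv/= !andbT; first by case.
  by move=> x0; split => //; rewrite (le_trans _ x0)// oppr_le0.
have i1r : mu.-integrable ray (EFin \o f1).
  by apply: integrableS i1 => //; rewrite -rD; exact: subIsetl.
have ig : mu.-integrable ray (EFin \o (fun x => f2 x - f1 x)).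
  exact: eq_integrable (integrableB mray i2 i1r).
have E : \int[mu]_(x in ray) (f2 x - f1 x) =
    \int[mu]_(x in D) ((fun x => f2 x - f1 x) \_ ray) x.
  by rewrite -Rintegral_mkcondr rD.
have iD : mu.-integrable D (EFin \o ((fun x => f2 x - f1 x) \_ ray)).
  have := (@integrable_mkcond _ _ _ mu _ _ mray).1 ig; rewrite restrict_EFin => ig'.
  exact: integrableS ig'.
rewrite -(RintegralB mray i2 i1r) E -(RintegralD mD i1 iD).
apply: eq_Rintegral => x; rewrite inE /D /= in_itv/= andbT => yx.
rewrite patchE; case: ltP => x0.
  by rewrite ifF ?addr0//; apply/negbTE; rewrite notin_setE/= in_itv/= andbT; apply/negP; rewrite -ltNge.
by rewrite ifT ?subrKC//; rewrite inE/= in_itv/= andbT.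
Qed.

Lemma integrable_ray_split (f1 f2 : R -> R) t : continuous f1 -> continuous f2 ->
  mu.-integrable `[t, +oo[ (EFin \o f1) -> mu.-integrable `[t, +oo[ (EFin \o f2) ->
  mu.-integrable `[t, +oo[ (EFin \o (fun x => if x < 0 then f1 x else f2 x)).
Proof.
move=> c1 c2 i1 i2; set D : set (measurableTypeR R) := `[t, +oo[%classic.
have mD : measurable D by exact: measurable_itv.
have ms : measurable_fun setT (fun x : R => if x < 0 then f1 x else f2 x).
  apply: (measurable_fun_ifT (f := fun x : R => x < 0)).
  - exact: measurable_fun_ltr.
  - exact: continuous_measurable_fun.
  - exact: continuous_measurable_fun.
have le (x : R) : `|if x < 0 then f1 x else f2 x| <= `|f1 x| + `|f2 x|.
  by case: (x < 0); rewrite ?lerDl ?lerDr.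
apply: (@integrable_le _ _ _ mu D mD _ (fun x => `|f1 x| + `|f2 x|)).
- exact: (measurable_funTS ms).
- by move=> x _; exact: le.
- exact: eq_integrable (integrableD mD (integrable_norm i1) (integrable_norm i2)).
Qed.

(** The Robin function is written as an average of sines over x >= - y; sine inversion evaluates the
    integral in [k], and what is left is elementary in x. The part x < 0 produces the Robin function
    of rate kap - c, and the mismatch of rates at x = 0 the multiple of e^(- kap y). *)
Lemma Rintegral_cauchy_robin kap c q y : 0 < c -> c < kap -> 0 <= y ->
  \int[mu]_(k in ray) ((cauchy_ker c (k - q) - cauchy_ker c (k + q)) * robin kap k y) =
  pi * (expR (- (c * y)) * robin (kap - c) q y -
        4 * kap * c * q / (((kap - c) ^+ 2 + q ^+ 2) * ((kap + c) ^+ 2 + q ^+ 2)) *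
        expR (- (kap * y))).
Proof.
move=> c0 ckap y0; have kap0 : 0 < kap by lra.
have kc0 : 0 < kap - c by lra.
have kc0' : 0 < kap + c by lra.
have n1 : (kap - c) ^+ 2 + q ^+ 2 != 0 by rewrite gt_eqF// cauchy_den_gt0.
have n2 : (kap + c) ^+ 2 + q ^+ 2 != 0 by rewrite gt_eqF// cauchy_den_gt0.
have mray : measurable ray by [].
set D : set (measurableTypeR R) := `[- y, +oo[%classic.
have mD : measurable D by exact: measurable_itv.
pose g k := cauchy_ker c (k - q) + cauchy_ker c (k - - q).
pose h x : R := expR (- (kap * (x + y))).
have ig : mu.-integrable ray (EFin \o g).
  exact: eq_integrable (integrableD mray (cauchy_ker_ray q c0).1 (cauchy_ker_ray (- q) c0).1).
have idamp := (damped_ray 0 1 0 (- y) kap0).1.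
have ih : mu.-integrable D (EFin \o h).
  apply: eq_integrable (integrableZl mD (expR (- (kap * y))) idamp) => // x _ /=.
  rewrite /h /damped !mul0r cos0 addr0 !mulr1 -EFinM -expRD; congr (expR _)%:E; ring.
pose f (z : R * R) := (cauchy_ker c (z.1 - q) - cauchy_ker c (z.1 - - q)) * (h z.2 * sin (z.1 * z.2)).
have mC z : measurable_fun setT (fun k => cauchy_ker c (k - z)).
  by apply: continuous_measurable_fun; exact: continuous_cauchy_ker.
have msin : measurable_fun setT (@sin R) by apply: continuous_measurable_fun; exact: continuous_sin.
have mh : measurable_fun setT h.
  apply: measurableT_comp => //; apply: measurableT_comp => //.
  by apply: measurable_funM => //; exact: measurable_funD.
have mf : measurable_fun setT f.
  apply: measurable_funM.
    by apply: measurable_funB; apply: (measurableT_comp (mC _) measurable_fst).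
  apply: measurable_funM; first exact: measurableT_comp mh measurable_snd.
  by apply: measurableT_comp msin _; exact: measurable_funM.
have sin1 (z : R) : `|sin z| <= 1 by rewrite ler_norml sin_geN1 sin_le1.
have h0 x : 0 <= h x by exact: expR_ge0.
have gle k : `|cauchy_ker c (k - q) - cauchy_ker c (k + q)| <= g k.
  apply: le_trans (ler_normB _ _) _; rewrite /g opprK.
  by rewrite !ger0_norm ?cauchy_ker_ge0.
have hle k x : `|h x * sin (k * x)| <= h x.
  by rewrite normrM ger0_norm// ler_piMr.
have gle' k x : `|(cauchy_ker c (k - q) - cauchy_ker c (k + q)) * sin (k * x)| <= g k.
  by rewrite normrM -[leRHS]mulr1; apply: ler_pM.
have fE k x : f (k, x) = (cauchy_ker c (k - q) - cauchy_ker c (k + q)) * (h x * sin (k * x)).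
  by rewrite /f opprK.
have fE' k x : f (k, x) = h x * ((cauchy_ker c (k - q) - cauchy_ker c (k + q)) * sin (k * x)).
  by rewrite fE; ring.
have fle k x : ray k -> D x -> `|f (k, x)| <= g k * h x.
  by move=> _ _; rewrite fE normrM; apply: ler_pM.
have [_ swap] := Rfubini_le mray mD mf ig ih fle.
have msink k : measurable_fun setT (fun x => sin (k * x)).
  by apply: measurableT_comp msin _; exact: measurable_funM.
have msinx x : measurable_fun setT (fun k => sin (k * x)).
  by apply: measurableT_comp msin _; exact: measurable_funM.
have mhsin k : measurable_fun setT (fun x => h x * sin (k * x)).
  by apply: measurable_funM => //; exact: msink.
have mdiffsin x : measurable_fun setT (fun k =>
    (cauchy_ker c (k - q) - cauchy_ker c (k + q)) * sin (k * x)).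
  apply: measurable_funM; last exact: msinx.
  apply: measurable_funB; first exact: mC.
  rewrite (_ : (fun _ => _) = (fun k => cauchy_ker c (k - - q))); first exact: mC.
  by apply/funext => k'; rewrite opprK.
have innerD k : \int[mu]_(x in D) f (k, x) =
    (cauchy_ker c (k - q) - cauchy_ker c (k + q)) * robin kap k y.
  have i : mu.-integrable D (EFin \o (fun x => h x * sin (k * x))).
    apply: (@integrable_le _ _ _ mu D mD (fun x => h x * sin (k * x)) h _ _ ih).
      exact: (measurable_funTS (mhsin k)).
    by move=> x _; exact: hle.
  rewrite -(robin_sin_integral _ _ kap0) -(RintegralZl _ mD i).
  by apply: eq_Rintegral => x _; exact: fE.
have innerray x : \int[mu]_(k in ray) f (k, x) =
    h x * (pi * (expR (- (c * `|x|)) * sin (q * x))).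
  have i : mu.-integrable ray (EFin \o (fun k =>
      (cauchy_ker c (k - q) - cauchy_ker c (k + q)) * sin (k * x))).
    apply: (@integrable_le _ _ _ mu ray mray (fun k =>
      (cauchy_ker c (k - q) - cauchy_ker c (k + q)) * sin (k * x)) g _ _ ig); last first.
      by move=> k _; exact: gle'.
    exact: (measurable_funTS (mdiffsin x)).
  rewrite -(Rintegral_sin_cauchy q x c0) -(RintegralZl _ mray i).
  by apply: eq_Rintegral => k _; exact: fE'.
transitivity (\int[mu]_(k in ray) \int[mu]_(x in D) f (k, x)).
  by apply: eq_Rintegral => k _; exact/esym/innerD.
rewrite [LHS]swap.
pose f1 := damped (kap - c) q 0 1; pose f2 := damped (kap + c) q 0 1.
have if1 t := (damped_ray q 0 1 t kc0).1; have if2 t := (damped_ray q 0 1 t kc0').1.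
(* The sign of x decides whether e^(- c |x|) turns the rate [kap] into kap - c or kap + c; both are
   positive since c < kap. *)
have hsplit x : h x * (pi * (expR (- (c * `|x|)) * sin (q * x))) =
    pi * expR (- (kap * y)) * (if x < 0 then f1 x else f2 x).
  rewrite /h /f1 /f2 /damped !mul0r !add0r !mul1r.
  case: ltP => x0; [rewrite (ltr0_norm x0)|rewrite (ger0_norm x0)];
    rewrite mulrCA -mulrA; congr (_ * _); rewrite !mulrA -!expRD;
    congr (expR _ * _); ring.
transitivity (\int[mu]_(x in D) (pi * expR (- (kap * y)) * (if x < 0 then f1 x else f2 x))).
  by apply: eq_Rintegral => x _; rewrite innerray; exact: hsplit.
have isplit : mu.-integrable D (EFin \o (fun x => if x < 0 then f1 x else f2 x)).
  by apply: integrable_ray_split; [exact: continuous_damped|exact: continuous_damped|..].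
rewrite (RintegralZl _ mD isplit) (Rintegral_ray_split y0 (if1 _) (if2 _)) !Rintegral_damped//.
rewrite /damped /robin !mulr0 !mulrN oppr0 expR0 cos0 sin0 cosN sinN opprK -mulrA; congr (_ * _).
have -> : expR (- (c * y)) = expR (- (kap * y)) * expR ((kap - c) * y).
  by rewrite -expRD; congr expR; ring.
by field; rewrite n1 n2.
Qed.
End spectral_identities.

Section spectral_identities_sqrt.
Context {R : realType}.
Notation mu := (@lebesgue_measure R).
Notation ray := (`[0, +oo[%classic : set (measurableTypeR R)).
Implicit Types (x y z k q a c kap : R).

(** The factor 2 k / (a^2 + k^2) is not integrable, so the sine average cannot be inserted directly.
    The algebraic identity [pointwise] replaces it by cosines against the integrable 2 a / (a^2 +
    k^2), with [rc] the cosine companion of the Robin function. *)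
Lemma Rintegral_robin_resolvent kap a y : 0 < a -> a < kap -> 0 <= y ->
  \int[mu]_(k in ray) (2 * k * robin kap k y / (a ^+ 2 + k ^+ 2)) =
  pi / (a - kap) * (expR (- (a * y)) - 2 * kap / (kap + a) * expR (- (kap * y))).
Proof.
move=> a0 akap y0; have kap0 : 0 < kap by lra.
have kc0 : 0 < kap - a by lra.
have kc0' : 0 < kap + a by lra.
have kc1 : a - kap != 0 by lra.
have mray : measurable ray by [].
set D : set (measurableTypeR R) := `[- y, +oo[%classic.
have mD : measurable D by exact: measurable_itv.
pose g k := 2 * cauchy_ker a k.
pose h x : R := expR (- (kap * (x + y))).
pose rc k := (kap * cos (k * y) + k * sin (k * y)) / (kap ^+ 2 + k ^+ 2).
have iC : mu.-integrable ray (EFin \o cauchy_ker a).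
  by apply: eq_integrable (cauchy_ker_ray 0 a0).1 => // k _ /=; rewrite subr0.
have ig : mu.-integrable ray (EFin \o g) by exact: eq_integrable (integrableZl mray 2 iC).
have idamp := (damped_ray 0 1 0 (- y) kap0).1.
have ih : mu.-integrable D (EFin \o h).
  apply: eq_integrable (integrableZl mD (expR (- (kap * y))) idamp) => // x _ /=.
  rewrite /h /damped !mul0r cos0 addr0 !mulr1 -EFinM -expRD; congr (expR _)%:E; ring.
have mg : measurable_fun setT g.
  apply: measurable_funM => //; apply: continuous_measurable_fun.
  rewrite (_ : cauchy_ker a = fun k => cauchy_ker a (k - 0)); last by apply/funext => k; rewrite subr0.
  exact: continuous_cauchy_ker.
have mcos : measurable_fun setT (@cos R) by apply: continuous_measurable_fun; exact: continuous_cos.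
have mh : measurable_fun setT h.
  apply: measurableT_comp => //; apply: measurableT_comp => //.
  by apply: measurable_funM => //; exact: measurable_funD.
pose f (z : R * R) := g z.1 * (h z.2 * cos (z.1 * z.2)).
have mf : measurable_fun setT f.
  apply: measurable_funM; first exact: measurableT_comp mg measurable_fst.
  apply: measurable_funM; first exact: measurableT_comp mh measurable_snd.
  by apply: measurableT_comp mcos _; exact: measurable_funM.
have cos1 (z : R) : `|cos z| <= 1 by rewrite ler_norml cos_geN1 cos_le1.
have h0 x : 0 <= h x by exact: expR_ge0.
have g0 k : 0 <= g k by rewrite mulr_ge0// cauchy_ker_ge0.
have hle k x : `|h x * cos (k * x)| <= h x by rewrite normrM ger0_norm// ler_piMr.
have gle k x : `|g k * cos (k * x)| <= g k by rewrite normrM ger0_norm// ler_piMr.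
have fE' k x : f (k, x) = h x * (g k * cos (k * x)) by rewrite /f /=; ring.
have fle k x : ray k -> D x -> `|f (k, x)| <= g k * h x.
  by move=> _ _; rewrite /f normrM (ger0_norm (g0 k)) ler_wpM2l.
have [irc swap] := Rfubini_le mray mD mf ig ih fle.
have mcosk k : measurable_fun setT (fun x => cos (k * x)).
  by apply: measurableT_comp mcos _; exact: measurable_funM.
have mcosx x : measurable_fun setT (fun k => cos (k * x)).
  by apply: measurableT_comp mcos _; exact: measurable_funM.
have mhcos k : measurable_fun setT (fun x => h x * cos (k * x)).
  by apply: measurable_funM => //; exact: mcosk.
have mgcos x : measurable_fun setT (fun k => g k * cos (k * x)).
  by apply: measurable_funM => //; exact: mcosx.
have igcos x : mu.-integrable ray (EFin \o (fun k => g k * cos (k * x))).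
  apply: (@integrable_le _ _ _ mu ray mray (fun k => g k * cos (k * x)) g _ _ ig).
    exact: (measurable_funTS (mgcos x)).
  by move=> k _; exact: gle.
have gcosE x : \int[mu]_(k in ray) (g k * cos (k * x)) = pi * expR (- (a * `|x|)).
  rewrite -(Rintegral_cos_cauchy x a0); apply: eq_Rintegral => k _.
  by rewrite /g -mulrA [cauchy_ker _ _ * _]mulrC mulrA.
have innerD k : \int[mu]_(x in D) f (k, x) = g k * rc k.
  have i : mu.-integrable D (EFin \o (fun x => h x * cos (k * x))).
    apply: (@integrable_le _ _ _ mu D mD (fun x => h x * cos (k * x)) h _ _ ih).
      exact: (measurable_funTS (mhcos k)).
    by move=> x _; exact: hle.
  rewrite /rc -(robin_cos_integral _ _ kap0) -(RintegralZl _ mD i).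
  by apply: eq_Rintegral => x _.
have innerray x : \int[mu]_(k in ray) f (k, x) = h x * (pi * expR (- (a * `|x|))).
  rewrite -gcosE -(RintegralZl _ mray (igcos x)).
  by apply: eq_Rintegral => k _; exact: fE'.
pose f1 := damped (kap - a) 0 1 0; pose f2 := damped (kap + a) 0 1 0.
have if1 t := (damped_ray 0 1 0 t kc0).1; have if2 t := (damped_ray 0 1 0 t kc0').1.
have hsplit x : h x * (pi * expR (- (a * `|x|))) =
    pi * expR (- (kap * y)) * (if x < 0 then f1 x else f2 x).
  rewrite /h /f1 /f2 /damped !mul0r cos0 addr0 !mulr1.
  case: ltP => x0; [rewrite (ltr0_norm x0)|rewrite (ger0_norm x0)];
    rewrite mulrCA -mulrA; congr (_ * _); rewrite -!expRD; congr (expR _); ring.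
have isplit : mu.-integrable D (EFin \o (fun x => if x < 0 then f1 x else f2 x)).
  by apply: integrable_ray_split; [exact: continuous_damped|exact: continuous_damped|..].
have irc' : mu.-integrable ray (EFin \o (fun k => - kap * (g k * rc k))).
  apply: eq_integrable (integrableZl mray (- kap) irc) => // k _.
  by rewrite /= innerD.
have pointwise k : 2 * k * robin kap k y / (a ^+ 2 + k ^+ 2) =
    a^-1 * (g k * cos (k * y) + - kap * (g k * rc k)).
  rewrite /robin /g /rc /cauchy_ker.
  by field; rewrite !gt_eqF ?cauchy_den_gt0.
transitivity (\int[mu]_(k in ray) (a^-1 * (g k * cos (k * y) + - kap * (g k * rc k)))).
  by apply: eq_Rintegral => k _; exact: pointwise.
have isum : mu.-integrable ray (EFin \o (fun k => g k * cos (k * y) + - kap * (g k * rc k))).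
  exact: eq_integrable (integrableD mray (igcos y) irc').
have irc0 : mu.-integrable ray (EFin \o (fun k => g k * rc k)).
  by apply: eq_integrable irc => // k _; rewrite /= innerD.
rewrite (RintegralZl _ mray isum) (RintegralD mray (igcos y) irc') (RintegralZl _ mray irc0) gcosE.
have -> : \int[mu]_(k in ray) (g k * rc k) =
    \int[mu]_(x in D) (pi * expR (- (kap * y)) * (if x < 0 then f1 x else f2 x)).
  transitivity (\int[mu]_(k in ray) \int[mu]_(x in D) f (k, x)).
    by apply: eq_Rintegral => k _; exact/esym/innerD.
  rewrite [LHS]swap.
  by apply: eq_Rintegral => x _; rewrite innerray; exact: hsplit.
rewrite (RintegralZl _ mD isplit) (Rintegral_ray_split y0 (if1 _) (if2 _)) !Rintegral_damped//.
rewrite /damped !(mulr0, mul0r, addr0, oppr0, expr0n, mulrN, opprK, expR0, cos0, mulr1).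
rewrite (ger0_norm y0) (_ : expR (- (a * y)) = expR (- (kap * y)) * expR ((kap - a) * y)); last first.
  by rewrite -expRD; congr expR; ring.
by field; rewrite kc1 !gt_eqF.
Qed.

End spectral_identities_sqrt.

(** * From the frequency k to the spectral variable u = k^2 *)

Section sqrt_substitution.
Context {R : realType}.
Notation mu := (@lebesgue_measure R).
Notation ray := (`[0, +oo[%classic : set (measurableTypeR R)).
Notation oray := (`]0, +oo[%classic : set (measurableTypeR R)).
Implicit Types (g : R -> R) (x y z k q a c kap u v : R).

(** Substitution for the increasing map k^2 on [0, n], then n tends to infinity on both sides; [|k|]
    in place of k keeps the integrand nonnegative on the whole line. *)
Lemma ge0_sqrt_substitution g : continuous g -> (forall k, 0 <= g k) ->
  (\int[mu]_(u in ray) (g (Num.sqrt u))%:E = \int[mu]_(k in ray) (2 * `|k| * g k)%:E)%E.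
Proof.
move=> cg g0.
pose G u := g (Num.sqrt u).
have cG : continuous G by move=> u; apply: continuous_comp; [exact: sqrt_continuous|exact: cg].
pose H k := 2 * `|k| * g k.
have cH : continuous H.
  move=> k; apply: cvgM; last exact: cg.
  by apply: cvgM; [exact: cvg_cst|exact: norm_continuous].
have HG k : 0 <= k -> G (k ^+ 2) * (2 * k) = H k.
  by move=> k0; rewrite /G /H sqrtr_sqr ger0_norm// mulrC.
have BA (n : nat) : (\int[mu]_(u in `[0%R, (n ^ 2)%:R]) (G u)%:E =
    \int[mu]_(k in `[0%R, n%:R]) (H k)%:E)%E.
  have dF (x : R) : is_derive x 1 (fun k : R => k ^+ 2) (2 * x).
    by apply: is_derive_eq; rewrite /GRing.scale/=; ring.
  have F'E : (fun k : R => k ^+ 2)^`()%classic = (fun x => 2 * x).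
    by apply/funext => x; rewrite derive1E; apply: derive_val.
  have c2 : continuous (fun x : R => 2 * x).
    by move=> x; apply: cvgM; [exact: cvg_cst|exact: cvg_id].
  have cF : continuous (fun k : R => k ^+ 2) by exact: exprn_continuous.
  rewrite (_ : (n ^ 2)%:R = n%:R ^+ 2 :> R); last by rewrite natrX.
  have S := @integration_by_substitution_increasing R (fun k => k ^+ 2) G 0 n%:R.
  rewrite /= expr0n /= in S; rewrite S//.
  - apply: eq_integral => k; rewrite inE/= in_itv/= => /andP[k0 _]; congr EFin.
    by rewrite F'E; exact: HG.
  - move=> x z; rewrite !in_itv/= => /andP[x0 _] /andP[z0 _] xz.
    by rewrite ltr_pXn2r.
  - by rewrite F'E => x _; exact: c2.
  - by rewrite F'E; apply/cvg_ex; eexists; apply: cvg_at_right_filter; exact: c2.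
  - by rewrite F'E; apply/cvg_ex; eexists; apply: cvg_at_left_filter; exact: c2.
  - split; first by move=> x _; exact: ex_derive.
    + by apply: cvg_at_right_filter; exact: cF.
    + by apply: cvg_at_left_filter; exact: cF.
  - exact: continuous_subspaceT.
have limA := @ge0_cvgn_integral R mu H (fun k => mulr_ge0 (mulr_ge0 (ler0n _ 2) (normr_ge0 k)) (g0 k))
  (continuous_measurable_fun cH).
have limB := @ge0_cvgn_integral R mu G (fun u => g0 _) (continuous_measurable_fun cG).
have limB2 : (\int[mu]_(u in `[0%R, (n ^ 2)%:R]) (G u)%:E)%E @[n --> \oo] -->
    (\int[mu]_(u in ray) (G u)%:E)%E.
  apply: (@cvg_comp _ _ _ (fun n => (n ^ 2)%N) (fun n : nat => (\int[mu]_(u in `[0%R, n%:R]) (G u)%:E)%E) _ \oo) => //.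
  by move=> A [N _ NA]; exists N => // m /= Nm; apply: NA; rewrite /= (leq_trans Nm)//; case: (m) => // j; rewrite expnS expn1 leq_pmulr.
apply: (cvg_unique _ limB2); first exact: ereal_hausdorff.
by rewrite (_ : (fun n => _) = (fun n : nat => (\int[mu]_(k in `[0%R, n%:R]) (H k)%:E)%E));
  [exact: limA|apply/funext => n; exact: BA].
Qed.

(** The decomposition g = (|g| + g) - |g| reduces the signed case to the nonnegative one. *)
Lemma sqrt_substitution g : continuous g ->
  mu.-integrable ray (EFin \o (fun k => 2 * k * g k)) ->
  mu.-integrable oray (EFin \o (fun u => g (Num.sqrt u))) /\
  \int[mu]_(u in oray) g (Num.sqrt u) = \int[mu]_(k in ray) (2 * k * g k).
Proof.
move=> cg ig; have mray : measurable ray by [].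
have moray : measurable oray by [].
have oray_ray : oray `<=` ray by move=> x; rewrite /= !in_itv/= !andbT => /ltW.
have key (h : R -> R) : continuous h -> (forall k, 0 <= h k) ->
    mu.-integrable ray (EFin \o (fun k => 2 * k * h k)) ->
    mu.-integrable ray (EFin \o (fun u => h (Num.sqrt u))) /\
    \int[mu]_(u in ray) h (Num.sqrt u) = \int[mu]_(k in ray) (2 * k * h k).
  move=> ch h0 ih; have E := ge0_sqrt_substitution ch h0.
  have E2 : (\int[mu]_(k in ray) (2 * `|k| * h k)%:E = \int[mu]_(k in ray) (2 * k * h k)%:E)%E.
    by apply: eq_integral => k; rewrite inE/= in_itv/= andbT => k0; rewrite ger0_norm.
  split; last by rewrite /Rintegral E E2.
  apply/integrableP; split.
    apply/measurable_EFinP; apply: measurable_funTS; apply: continuous_measurable_fun => u.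
    by apply: continuous_comp; [exact: sqrt_continuous|exact: ch].
  rewrite (_ : integral _ _ _ = (\int[mu]_(k in ray) (2 * k * h k)%:E)%E).
    exact: integrable_lty ih.
  by rewrite -E2 -E; apply: eq_integral => u _; rewrite /= ger0_norm.
have can : continuous (fun k => `|g k|).
  by move=> k; apply: continuous_comp; [exact: cg|exact: norm_continuous].
have ian : mu.-integrable ray (EFin \o (fun k => 2 * k * `|g k|)).
  apply: eq_integrable (integrable_norm ig) => // k; rewrite inE/= in_itv/= andbT => k0.
  by rewrite /= !normrM (ger0_norm k0) ger0_norm.
have [i1 E1] := key _ can (fun k => normr_ge0 _) ian.
have cs : continuous (fun k => `|g k| + g k) by move=> k; apply: cvgD; [exact: can|exact: cg].
have is_ : mu.-integrable ray (EFin \o (fun k => 2 * k * (`|g k| + g k))).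
  by apply: eq_integrable (integrableD mray ian ig) => // k _; rewrite /= -EFinD mulrDr.
have s0 k : 0 <= `|g k| + g k by rewrite addrC -lerBlDr sub0r lerNl -normrN ler_norm.
have [i2 E2] := key _ cs s0 is_.
have i3 : mu.-integrable ray (EFin \o (fun u => g (Num.sqrt u))).
  apply: eq_integrable (integrableB mray i2 i1) => // u _.
  by rewrite /= -EFinB addrAC subrr add0r.
split; first exact: integrableS i3.
rewrite Rintegral_itv_obnd_cbnd; last exact: integrableS i3.
transitivity (\int[mu]_(u in ray) ((`|g (Num.sqrt u)| + g (Num.sqrt u)) - `|g (Num.sqrt u)|)).
  by apply: eq_Rintegral => u _; rewrite addrAC subrr add0r.
rewrite (RintegralB mray i2 i1) E2 E1 -(RintegralB mray is_ ian).
by apply: eq_Rintegral => k _; rewrite -mulrBr addrAC subrr add0r.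
Qed.

Lemma continuous_robin kap y : 0 < kap -> continuous (fun k => robin kap k y).
Proof.
move=> kap0 k; have cy : {for k, continuous (fun k : R => k * y)}.
  by apply: cvgM; [exact: cvg_id|exact: cvg_cst].
apply: cvgM.
  apply: cvgB; apply: cvgM; try exact: cvg_cst; try exact: cvg_id.
    by apply: (@continuous_comp _ _ _ (fun k => k * y) (@cos R)); [exact: cy|exact: continuous_cos].
  by apply: (@continuous_comp _ _ _ (fun k => k * y) (@sin R)); [exact: cy|exact: continuous_sin].
apply: cvgV; first by rewrite gt_eqF// cauchy_den_gt0.
by apply: cvgD; [exact: cvg_cst|exact: exprn_continuous].
Qed.

(** Cauchy-Schwarz for the vectors (k, - kap) and (cos, sin). The resulting decay 1/sqrt(kap^2 +
    k^2) is what makes spectral integrals with resolvent weights converge. *)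
Lemma robin_le kap k y : 0 < kap -> robin kap k y ^+ 2 * (kap ^+ 2 + k ^+ 2) <= 1.
Proof.
move=> kap0; have d0 := cauchy_den_gt0 k kap0.
have E (N D : R) : D != 0 -> (N / D) ^+ 2 * D = N ^+ 2 / D by move=> D0; field.
rewrite /robin E ?gt_eqF//.
rewrite ler_pdivrMr// mul1r -subr_ge0.
rewrite -[X in X - _]mulr1 -(cos2Dsin2 (k * y)).
move: (cos _) (sin _) => C S.
have -> : (kap ^+ 2 + k ^+ 2) * (C ^+ 2 + S ^+ 2) - (k * C - kap * S) ^+ 2 =
  (kap * C + k * S) ^+ 2 by ring.
exact: sqr_ge0.
Qed.

Lemma robin_sqrt_le kap u y : 0 < kap -> 0 <= u ->
  `|robin kap (Num.sqrt u) y| <= (Num.sqrt (kap ^+ 2 + u))^-1.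
Proof.
move=> kap0 u0; have := robin_le (Num.sqrt u) y kap0; rewrite sqr_sqrtr//.
have d0 : 0 < kap ^+ 2 + u by rewrite ltr_wpDr// exprn_gt0.
rewrite -ler_pdivlMr// div1r -sqrtrV ?(ltW d0)// -sqrtr_sqr => h.
by rewrite ler_sqrt// invr_ge0 ltW.
Qed.

Lemma robin_sqrt_le_inv kap u y : 0 < kap -> 0 <= u ->
  `|robin kap (Num.sqrt u) y| <= kap^-1.
Proof.
move=> kap0 u0; apply: le_trans (robin_sqrt_le y kap0 u0) _.
have d0 : 0 < kap ^+ 2 + u by rewrite ltr_wpDr// exprn_gt0.
rewrite lef_pV2 ?posrE ?sqrtr_gt0// -{1}(ger0_norm (ltW kap0)) -sqrtr_sqr.
by rewrite ler_sqrt ?(ltW d0)// lerDl.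
Qed.

Lemma pkern_den_gt0 c u v : 0 < c -> 0 <= u -> 0 <= v ->
  0 < c ^+ 4 + 2 * (u + v) * c ^+ 2 + (u - v) ^+ 2.
Proof.
move=> c0 u0 v0; rewrite -addrA ltr_wpDr ?exprn_gt0// addr_ge0 ?sqr_ge0//.
by apply: mulr_ge0; rewrite ?sqr_ge0// mulr_ge0// addr_ge0.
Qed.

Lemma pkern_ge0 c u v : 0 < c -> 0 <= u -> 0 <= v -> 0 <= pkern c u v.
Proof.
move=> c0 u0 v0; rewrite /pkern divr_ge0 ?mulr_ge0 ?sqrtr_ge0 ?pi_ge0 ?(ltW c0)//.
exact/ltW/pkern_den_gt0.
Qed.

(** With q = sqrt v the quartic denominator factors as (c^2 + (k - q)^2)(c^2 + (k + q)^2), and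
    partial fractions give two Poisson kernels. *)
Lemma pkern_cauchy c k v : 0 < c -> 0 <= v -> 2 * k * pkern c (k ^+ 2) v =
  pi^-1 * (cauchy_ker c (k - Num.sqrt v) - cauchy_ker c (k + Num.sqrt v)).
Proof.
move=> c0 v0; rewrite /pkern /cauchy_ker.
have := pkern_den_gt0 c0 (sqr_ge0 k) v0.
move=> _; have := sqr_sqrtr v0; move: (Num.sqrt v) => /= q <-.
have -> : c ^+ 4 + 2 * (k ^+ 2 + q ^+ 2) * c ^+ 2 + (k ^+ 2 - q ^+ 2) ^+ 2 =
  (c ^+ 2 + (k - q) ^+ 2) * (c ^+ 2 + (k + q) ^+ 2) by ring.
have d1 := cauchy_den_gt0 (k - q) c0; have d2 := cauchy_den_gt0 (k + q) c0.
move: (@pi R) (pi_gt0 R) => p p0.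
by field; rewrite ?(gt_eqF d1) ?(gt_eqF d2) ?(gt_eqF p0).
Qed.

Lemma continuous_pkern_sqr c v : 0 < c -> 0 <= v ->
  continuous (fun k => pkern c (k ^+ 2) v).
Proof.
move=> c0 v0 k; rewrite /pkern; apply: cvgM; first exact: cvg_cst.
apply: cvgV.
  by rewrite gt_eqF// mulr_gt0 ?pi_gt0// pkern_den_gt0// sqr_ge0.
have csq : {for k, continuous (fun k : R => k ^+ 2)} by exact: exprn_continuous.
apply: cvgM; first exact: cvg_cst.
apply: cvgD; last first.
  apply: (@continuous_comp _ _ _ (fun k : R => k ^+ 2 - v) (fun z : R => z ^+ 2)).
    by apply: cvgB; [exact: csq|exact: cvg_cst].
  exact: exprn_continuous.
apply: cvgD; first exact: cvg_cst.
apply: cvgM; last exact: cvg_cst.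
by apply: cvgM; [exact: cvg_cst|apply: cvgD; [exact: csq|exact: cvg_cst]].
Qed.

Lemma integrable_pkern_ray c v : 0 < c -> 0 <= v ->
  mu.-integrable ray (EFin \o (fun k => 2 * k * pkern c (k ^+ 2) v)).
Proof.
move=> c0 v0; have mray : measurable ray by [].
apply: eq_integrable (integrableZl mray pi^-1 (integrableB mray
  (cauchy_ker_ray (Num.sqrt v) c0).1 (cauchy_ker_ray (- Num.sqrt v) c0).1)) => // k _.
by rewrite /= pkern_cauchy// opprK.
Qed.

(** The mass in the first variable is (2 / pi) atan(sqrt v / c). *)
Lemma pkern_mass c v : 0 < c -> 0 <= v ->
  mu.-integrable oray (EFin \o (fun u => pkern c u v)) /\
  \int[mu]_(u in oray) pkern c u v <= 1.
Proof.
move=> c0 v0; have mray : measurable ray by [].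
have [i E] := sqrt_substitution (continuous_pkern_sqr c0 v0) (integrable_pkern_ray c0 v0).
have sq u : u \in oray -> Num.sqrt u ^+ 2 = u.
  by rewrite inE/= in_itv/= andbT => u0; rewrite sqr_sqrtr ?ltW.
split; first by apply: eq_integrable i => // u /sq /= ->.
have -> : \int[mu]_(u in oray) pkern c u v = \int[mu]_(u in oray) pkern c (Num.sqrt u ^+ 2) v.
  by apply: eq_Rintegral => u /sq ->.
rewrite E.
have [i1 E1] := cauchy_ker_ray (Num.sqrt v) c0; have [i2 E2] := cauchy_ker_ray (- Num.sqrt v) c0.
have iB : mu.-integrable ray (EFin \o (fun k => cauchy_ker c (k - Num.sqrt v) - cauchy_ker c (k - - Num.sqrt v))).
  exact: eq_integrable (integrableB mray i1 i2).
have -> : \int[mu]_(k in ray) (2 * k * pkern c (k ^+ 2) v) =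
    pi^-1 * (\int[mu]_(k in ray) cauchy_ker c (k - Num.sqrt v) -
             \int[mu]_(k in ray) cauchy_ker c (k - - Num.sqrt v)).
  rewrite -(RintegralB mray i1 i2) -(RintegralZl _ mray iB).
  by apply: eq_Rintegral => k _; rewrite opprK; exact: pkern_cauchy.
rewrite E1 E2 mulNr atanN.
have := atan_ltpi2 (Num.sqrt v / c); move: (atan _) => A A1.
rewrite mulrC ler_pdivrMr ?pi_gt0// mul1r; lra.
Qed.

(** Read from right to left: e^(- c y) times the Robin function of rate kap - c is a mixture of
    Robin functions of rate [kap] plus a multiple of their bound state. *)
Lemma robin_pkern kap c v y : 0 < c -> c < kap -> 0 <= v -> 0 <= y ->
  mu.-integrable oray (EFin \o (fun u => pkern c u v * robin kap (Num.sqrt u) y)) /\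
  \int[mu]_(u in oray) (pkern c u v * robin kap (Num.sqrt u) y) =
  expR (- (c * y)) * robin (kap - c) (Num.sqrt v) y -
  4 * kap * c * Num.sqrt v / (((kap - c) ^+ 2 + v) * ((kap + c) ^+ 2 + v)) * expR (- (kap * y)).
Proof.
move=> c0 ckap v0 y0; have mray : measurable ray by [].
have kap0 : 0 < kap by lra.
pose g k := pkern c (k ^+ 2) v * robin kap k y.
have cg : continuous g.
  by move=> k; apply: cvgM; [exact: continuous_pkern_sqr|exact: continuous_robin].
have p0 k : 0 <= k -> 0 <= 2 * k * pkern c (k ^+ 2) v.
  by move=> k0; apply: mulr_ge0; [exact: mulr_ge0|rewrite pkern_ge0// sqr_ge0].
have r0 k : `|robin kap k y| <= kap^-1.
  have := robin_le k y kap0 => h; rewrite -[leRHS]ger0_norm ?invr_ge0 ?(ltW kap0)// -ler_sqr ?nnegrE//.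
  rewrite !real_normK ?num_real// exprVn -[leRHS]mul1r ler_pdivlMr ?exprn_gt0//.
  apply: le_trans h; rewrite ler_wpM2l ?sqr_ge0// lerDl sqr_ge0//.
have ig : mu.-integrable ray (EFin \o (fun k => 2 * k * g k)).
  apply: (@integrable_le _ _ _ mu ray mray (fun k => 2 * k * g k)
    (fun k => kap^-1 * (2 * k * pkern c (k ^+ 2) v))).
  - have mk : measurable_fun setT (fun k : R => 2 * k * g k).
      by apply: measurable_funM; [exact: measurable_funM|exact: continuous_measurable_fun].
    exact: (measurable_funTS mk).
  - move=> k; rewrite /= in_itv/= andbT => k0; rewrite /g mulrA normrM mulrC.
    by rewrite (ger0_norm (p0 _ k0)) ler_wpM2r ?p0.
  - exact: eq_integrable (integrableZl mray kap^-1 (integrable_pkern_ray c0 v0)).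
have [i E] := sqrt_substitution cg ig.
have sq u : u \in oray -> Num.sqrt u ^+ 2 = u.
  by rewrite inE/= in_itv/= andbT => u0; rewrite sqr_sqrtr ?ltW.
split; first by apply: eq_integrable i => // u /sq /= eu; rewrite /g eu.
have -> : \int[mu]_(u in oray) (pkern c u v * robin kap (Num.sqrt u) y) =
    \int[mu]_(u in oray) g (Num.sqrt u).
  by apply: eq_Rintegral => u /sq eu; rewrite /g eu.
pose d k := cauchy_ker c (k - Num.sqrt v) - cauchy_ker c (k + Num.sqrt v).
have dE k : 2 * k * g k = pi^-1 * (d k * robin kap k y) by rewrite /g [LHS]mulrA pkern_cauchy// -mulrA.
have ird : mu.-integrable ray (EFin \o (fun k => d k * robin kap k y)).
  apply: eq_integrable (integrableZl mray pi ig) => // k _.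
  by rewrite /= -EFinM dE mulrA divff ?mul1r// gt_eqF// pi_gt0.
rewrite E (_ : \int[mu]_(k in ray) (2 * k * g k) = pi^-1 * \int[mu]_(k in ray) (d k * robin kap k y)).
  by rewrite /d Rintegral_cauchy_robin// mulrA mulVf ?gt_eqF ?pi_gt0// mul1r sqr_sqrtr.
rewrite -(RintegralZl _ mray ird); apply: eq_Rintegral => k _; exact: dE.
Qed.

Lemma robin_resolvent kap a y : 0 < a -> a < kap -> 0 <= y ->
  \int[mu]_(u in oray) (robin kap (Num.sqrt u) y / (a ^+ 2 + u)) =
  pi / (a - kap) * (expR (- (a * y)) - 2 * kap / (kap + a) * expR (- (kap * y))).
Proof.
move=> a0 akap y0; have mray : measurable ray by [].
have kap0 : 0 < kap by lra.
pose g k := robin kap k y / (a ^+ 2 + k ^+ 2).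
have cg : continuous g.
  move=> k; apply: cvgM; first exact: continuous_robin.
  apply: cvgV; first by rewrite gt_eqF// cauchy_den_gt0.
  by apply: cvgD; [exact: cvg_cst|exact: exprn_continuous].
have le k : `|2 * k * g k| <= 2 / a * cauchy_ker a k.
  rewrite /g /cauchy_ker mulrA normrM normfV (gtr0_norm (cauchy_den_gt0 k a0)).
  rewrite [leRHS]mulrA divfK ?gt_eqF// ler_pM2r ?invr_gt0 ?cauchy_den_gt0//.
  rewrite -mulrA normrM ger0_norm// ler_piMr//.
  rewrite -(ler_pXn2r (n := 2))// ?nnegrE//= expr1n real_normK ?num_real// exprMn mulrC.
  apply: le_trans (robin_le k y kap0); rewrite ler_wpM2l ?sqr_ge0// lerDr sqr_ge0//.
have ig : mu.-integrable ray (EFin \o (fun k => 2 * k * g k)).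
  apply: (@integrable_le _ _ _ mu ray mray (fun k => 2 * k * g k)
    (fun k => 2 / a * cauchy_ker a k)).
  - have mk : measurable_fun setT (fun k : R => 2 * k * g k).
      by apply: measurable_funM; [exact: measurable_funM|exact: continuous_measurable_fun].
    exact: (measurable_funTS mk).
  - by move=> k _; exact: le.
  - apply: eq_integrable (integrableZl mray (2 / a) (cauchy_ker_ray 0 a0).1) => // k _.
    by rewrite /= subr0.
have [i E] := sqrt_substitution cg ig.
rewrite -Rintegral_robin_resolvent//.
transitivity (\int[mu]_(u in oray) g (Num.sqrt u)).
  apply: eq_Rintegral => u; rewrite inE/= in_itv/= andbT => u0.
  by rewrite /g sqr_sqrtr ?ltW.
by rewrite E; apply: eq_Rintegral => k _; rewrite /g mulrA.
Qed.

End sqrt_substitution.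

(** * Gaussian integrals *)

Section integral_density.
Local Open Scope ereal_scope.
Context d (T : measurableType d) (R : realType).
Variables (mu nu : {measure set T -> \bar R}) (g : T -> R).
Hypotheses (mg : measurable_fun setT g) (g0 : forall x, (0 <= g x)%R).
Hypothesis nuE : forall A, measurable A -> nu A = \int[mu]_(x in A) (g x)%:E.
Import HBNNSimple.

(** Simple functions and monotone convergence. It is used for the Gaussian density and, at the end,
    for the density of the law of eta. *)
Lemma integral_density (f : T -> \bar R) : measurable_fun setT f -> (forall x, 0 <= f x) ->
  \int[nu]_x f x = \int[mu]_x (f x * (g x)%:E).
Proof.
move=> mf f0; pose h := nnsfun_approx measurableT mf.
have mgE : measurable_fun setT (EFin \o g) by exact/measurable_EFinP.
have mh n : measurable_fun setT (fun x => (h n x)%:E).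
  by apply/measurable_EFinP; exact/measurable_funP.
have cvh x : (h n x)%:E @[n --> \oo] --> f x.
  exact: (cvg_nnsfun_approx measurableT mf (fun x _ => f0 x)).
have ndh x : {homo (fun n => (h n x)%:E) : a b / (a <= b)%N >-> a <= b}.
  by move=> a b ab; rewrite lee_fin; exact/lefP/nd_nnsfun_approx.
have -> : \int[nu]_x f x = limn (fun n => \int[nu]_x (h n x)%:E).
  rewrite -monotone_convergence//.
  - by apply: eq_integral => x _; apply/esym/cvg_lim => //; exact: cvh.
  - by move=> n x _; rewrite lee_fin.
have -> : \int[mu]_x (f x * (g x)%:E) = limn (fun n => \int[mu]_x ((h n x)%:E * (g x)%:E)).
  rewrite -monotone_convergence//.
  - by apply: eq_integral => x _; apply/esym/cvg_lim => //; apply: cvgeZr => //; exact: cvh.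
  - by move=> n; exact: emeasurable_funM.
  - by move=> n x _; rewrite -EFinM lee_fin mulr_ge0.
  - by move=> x _ a b ab; rewrite lee_wpmul2r ?lee_fin//; exact: ndh.
congr (limn _); apply/funext => n.
have indic r : (0 <= r)%R -> \int[nu]_x (r * \1_(h n @^-1` [set r]) x)%:E =
    \int[mu]_x ((r * \1_(h n @^-1` [set r]) x)%:E * (g x)%:E).
  move=> r0; set A := h n @^-1` [set r].
  have mA : measurable A by exact: measurable_sfunP.
  under eq_integral do rewrite EFinM.
  rewrite ge0_integralZl//; last by apply/measurable_EFinP.
  under [RHS]eq_integral do rewrite EFinM -muleA.
  rewrite ge0_integralZl//; last 2 first.
  - by apply: emeasurable_funM => //; exact/measurable_EFinP.
  - by move=> x _; rewrite mule_ge0// lee_fin.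
  rewrite integral_indic// setIT nuE// integral_mkcond; congr (_ * _).
  apply: eq_integral => x _; rewrite patchE indicE; case: ifP => _; by rewrite ?mul1e ?mul0e.
have mind r : measurable_fun setT (fun x => (r * \1_(h n @^-1` [set r]) x)%:E).
  by apply/measurable_EFinP; exact: measurable_funM.
have hE x : (h n x)%:E = \sum_(r \in range (h n)) (r * \1_(h n @^-1` [set r]) x)%:E.
  by rewrite /= [in LHS]fimfunE -fsumEFin.
under [LHS]eq_integral do rewrite hE.
rewrite ge0_integral_fsum//; last by move=> r x _; exact: nnfun_muleindic_ge0.
under [RHS]eq_integral => x _.
  rewrite hE ge0_mule_fsuml; last by move=> r; exact: nnfun_muleindic_ge0.
  over.
rewrite ge0_integral_fsum//; last 2 first.
- by move=> r; exact: emeasurable_funM.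
- by move=> r x _; rewrite mule_ge0// ?lee_fin// -lee_fin; exact: nnfun_muleindic_ge0.
apply: eq_fsbigr => r; rewrite inE => -[x _ <-].
by apply: indic.
Qed.

End integral_density.

Section gaussian_moments.
Context {R : realType}.
Notation mu := (@lebesgue_measure R).
Implicit Types (x y z h l k : R).

(** Indexed by the variance, so that consecutive steps add in [h]. *)
Definition gauss h : probability (measurableTypeR R) R := normal_prob 0 (Num.sqrt h).

Lemma integral_gauss h (f : R -> \bar R) : measurable_fun setT f -> (forall x, (0 <= f x)%E) ->
  (\int[gauss h]_x f x = \int[mu]_x (f x * (normal_pdf 0 (Num.sqrt h) x)%:E))%E.
Proof.
move=> mf f0; apply: (@integral_density _ _ R mu (gauss h)) => //.
- exact: measurable_normal_pdf.
- by move=> x; exact: normal_pdf_ge0.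
Qed.

Lemma gauss_mgf h l : 0 < h ->
  (\int[gauss h]_x (expR (l * x))%:E = (expR (l ^+ 2 * h / 2))%:E)%E.
Proof.
move=> h0; rewrite integral_gauss//; last first.
  by apply/measurable_EFinP; apply: measurableT_comp => //; exact: measurable_funM.
have s0 : Num.sqrt h != 0 by rewrite gt_eqF// sqrtr_gt0.
have E x : expR (l * x) * normal_pdf 0 (Num.sqrt h) x =
    expR (l ^+ 2 * h / 2) * normal_pdf (l * h) (Num.sqrt h) x.
  rewrite !normal_pdfE// mulrCA [RHS]mulrCA; congr (_ * _).
  rewrite /normal_fun -!expRD sqr_sqrtr ?(ltW h0)//; congr expR.
  by field; rewrite gt_eqF.
under eq_integral do rewrite -EFinM E EFinM.
rewrite ge0_integralZl//.
- by rewrite integral_normal_pdf mule1.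
- by apply/measurable_EFinP; exact: measurable_normal_pdf.
- by move=> x _; rewrite lee_fin normal_pdf_ge0.
Qed.

Lemma integrable_gauss_exp h l : 0 < h -> (gauss h).-integrable setT (EFin \o (fun x => expR (l * x))).
Proof.
move=> h0; apply/integrableP; split.
  apply/measurable_EFinP; apply: measurableT_comp => //; exact: measurable_funM.
under eq_integral do rewrite /= ger0_norm ?expR_ge0//.
by rewrite gauss_mgf// ltry.
Qed.

Lemma gauss_mgfR h l : 0 < h -> \int[gauss h]_x expR (l * x) = expR (l ^+ 2 * h / 2).
Proof. by move=> h0; rewrite /Rintegral gauss_mgf. Qed.

Lemma gauss_integrable_le h (f g : R -> R) : measurable_fun setT f ->
  (forall x, `|f x| <= g x) -> (gauss h).-integrable setT (EFin \o g) ->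
  (gauss h).-integrable setT (EFin \o f).
Proof.
move=> mf fg; apply: (@integrable_le _ (measurableTypeR R) R (gauss h) setT measurableT f g mf).
by move=> x _; exact: fg.
Qed.

Lemma gauss_exp_norm h l : 0 < h ->
  (gauss h).-integrable setT (EFin \o (fun x => expR (l * `|x|))) /\
  \int[gauss h]_x expR (l * `|x|) <= 2 * expR (l ^+ 2 * h / 2).
Proof.
move=> h0; have i1 := integrable_gauss_exp l h0; have i2 := integrable_gauss_exp (- l) h0.
have i12 : (gauss h).-integrable setT (EFin \o (fun x => expR (l * x) + expR (- l * x))).
  by apply: eq_integrable (integrableD _ i1 i2).
have le x : expR (l * `|x|) <= expR (l * x) + expR (- l * x).
  have [x0|x0] := leP 0 x.
    by rewrite (ger0_norm x0) lerDl expR_ge0.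
  by rewrite (ltr0_norm x0) mulrN mulNr lerDr expR_ge0.
have mabs : measurable_fun setT (fun x : R => expR (l * `|x|)).
  apply: measurableT_comp => //; apply: measurable_funM => //; exact: measurableT_comp.
have i : (gauss h).-integrable setT (EFin \o (fun x => expR (l * `|x|))).
  by apply: (gauss_integrable_le mabs _ i12) => x; rewrite ger0_norm ?expR_ge0// le.
split => //; apply: le_trans (le_Rintegral measurableT i i12 (fun x _ => le x)) _.
by rewrite RintegralD// !gauss_mgfR// sqrrN mulr_natl mulr2n.
Qed.

Lemma ge0_integralT_opp (f : R -> \bar R) :
  measurable_fun [set: R] f -> (forall r, (0 <= f r)%E) ->
  (\int[mu]_r f r = \int[mu]_r f (- r)%R)%E.
Proof.
move=> mf f0.
rewrite [in RHS](_ : setT = (-%R : _ -> measurableTypeR R) @^-1` setT); last by rewrite preimage_setT.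
rewrite -ge0_integral_pushforward//=.
by apply: eq_measure_integral => //= A mA AS; exact/esym/lebesgue_measureN.
Qed.

(** Oddness, expressed through the nonnegative functions 1 + sin and 1 - sin, which the reflection x
    -> - x exchanges. *)
Lemma gauss_sin h k : 0 < h -> \int[gauss h]_x sin (k * x) = 0.
Proof.
move=> h0.
have msin : measurable_fun setT (fun x : R => sin (k * x)).
  apply: measurableT_comp; last exact: measurable_funM.
  by apply: continuous_measurable_fun; exact: continuous_sin.
have i : (gauss h).-integrable setT (EFin \o (fun x : R => sin (k * x))).
  apply: (@gauss_integrable_le h _ (cst 1) msin).
    by move=> x; rewrite ler_norml sin_geN1 sin_le1.
  exact: finite_measure_integrable_cst.
have i1 : (gauss h).-integrable setT (EFin \o cst (1 : R)) by exact: finite_measure_integrable_cst.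
have key (s : R) : s \in [:: 1; -1] -> (\int[gauss h]_x (1 + s * sin (k * x))%:E =
     \int[mu]_x ((1 + s * sin (k * x))%:E * (normal_pdf 0 (Num.sqrt h) x)%:E))%E.
  move=> s1; rewrite integral_gauss//.
  - by apply/measurable_EFinP; apply: measurable_funD => //; exact: measurable_funM.
  - move=> x; rewrite lee_fin; have := sin_geN1 (k * x); have := sin_le1 (k * x).
    by move: s1; rewrite !inE => /orP[/eqP ->|/eqP ->]; lra.
have refl : (\int[gauss h]_x (1 + 1 * sin (k * x))%:E = \int[gauss h]_x (1 + -1 * sin (k * x))%:E)%E.
  pose G (x : measurableTypeR R) := ((1 + 1 * sin (k * x))%:E * (normal_pdf 0 (Num.sqrt h) x)%:E)%E.
  have mG : measurable_fun setT G.
    apply/measurable_EFinP; apply: measurable_funM; last exact: measurable_normal_pdf.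
    by apply: measurable_funD => //; exact: measurable_funM.
  have G0 : {in setT, forall x, (0 <= G x)%E}.
    move=> x _; rewrite /G -EFinM lee_fin; apply: mulr_ge0; last exact: normal_pdf_ge0.
    by rewrite mul1r; have := sin_geN1 (k * x); move: (sin _) => ss; lra.
  have GN (x : R) : G (- x) = ((1 + -1 * sin (k * x))%:E * (normal_pdf 0 (Num.sqrt h) x)%:E)%E.
    rewrite /G mulrN sinN mul1r mulN1r; congr (_ * _%:E)%E.
    have s0 : Num.sqrt h != 0 by rewrite gt_eqF// sqrtr_gt0.
    by rewrite !normal_pdfE// /normal_fun !subr0 sqrrN.
  rewrite !key ?inE ?eqxx ?orbT//.
  rewrite [LHS](@ge0_integralT_opp G mG (fun x => G0 x (in_setT x))).
  by apply: eq_integral => x _; exact: GN.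
have /(congr1 fine) : (\int[gauss h]_x (1 + 1 * sin (k * x))%:E = \int[gauss h]_x (1 + -1 * sin (k * x))%:E)%E by [].
rewrite -/(Rintegral _ _ _) -/(Rintegral _ _ _).
have iz s : (gauss h).-integrable setT (EFin \o (fun x => s * sin (k * x))).
  by apply: eq_integrable (integrableZl measurableT s i).
have E s : \int[gauss h]_x (1 + s * sin (k * x)) =
    \int[gauss h]_x (cst 1 x) + s * \int[gauss h]_x sin (k * x).
  by rewrite -(RintegralZl s measurableT i) -(RintegralD measurableT i1 (iz s)).
by rewrite !E; lra.
Qed.

End gaussian_moments.

(** * Comparison of cosines with exponentials to fourth order *)

Section taylor_bounds.
Context {R : realType}.
Implicit Types (x y z s k kap a C S : R).

(** One order of Taylor expansion. The bound is uniform on |x| <= S, so that it can serve as the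
    hypothesis for the next antiderivative. *)
Lemma mvt_bound (f f' : R -> R) C S : f 0 = 0 ->
  (forall x, is_derive x 1 f (f' x)) -> (forall x, `|x| <= S -> `|f' x| <= C) ->
  forall x, `|x| <= S -> `|f x| <= C * S.
Proof.
move=> f0 df f'C x xS.
have cf : continuous f.
  by move=> z; apply/differentiable_continuous/derivable1_diffP; have [] := df z.
have [z zx E] : exists2 z, `|z| <= S & f x = f' z * x.
  have [x0|x0] := leP 0 x.
    have [z + E] := @MVT_segment R f f' 0 x x0 (fun z _ => df z) (continuous_subspaceT cf).
    rewrite in_itv/= => /andP[z0 zx]; exists z.
      by rewrite (le_trans _ xS)// !ger0_norm.
    by rewrite f0 !subr0 in E.
  have [z + E] := @MVT_segment R f f' x 0 (ltW x0) (fun z _ => df z) (continuous_subspaceT cf).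
  rewrite in_itv/= => /andP[zx z0]; exists z.
    by rewrite (le_trans _ xS)// ler0_norm// ltr0_norm// lerN2.
  by rewrite f0 !sub0r mulrN in E; rewrite -[LHS]opprK E opprK.
by rewrite E normrM ler_pM// f'C.
Qed.

(** The quadratic terms of cos and cosh cancel. This lets the Gaussian mean of a cosine be read off
    from the exponential moments. *)
Lemma cos_cosh_bound s :
  `|cos s + (expR s + expR (- s)) / 2 - 2| <= 2 * expR `|s| * `|s| ^+ 4.
Proof.
have e1 : 1 <= expR `|s| by rewrite -expR0 ler_expR.
have d3 x : is_derive x 1 (fun x => sin x + (expR x - expR (- x)) / 2) (cos x + (expR x + expR (- x)) / 2).
  by apply: is_derive_eq; rewrite /GRing.scale/=; ring.
have d2 x : is_derive x 1 (fun x => - cos x + (expR x + expR (- x)) / 2) (sin x + (expR x - expR (- x)) / 2).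
  by apply: is_derive_eq; rewrite /GRing.scale/=; ring.
have d1 x : is_derive x 1 (fun x => - sin x + (expR x - expR (- x)) / 2) (- cos x + (expR x + expR (- x)) / 2).
  by apply: is_derive_eq; rewrite /GRing.scale/=; ring.
have d0 x : is_derive x 1 (fun x => cos x + (expR x + expR (- x)) / 2 - 2) (- sin x + (expR x - expR (- x)) / 2).
  by apply: is_derive_eq; rewrite /GRing.scale/=; ring.
have b4 x : `|x| <= `|s| -> `|cos x + (expR x + expR (- x)) / 2| <= 2 * expR `|s|.
  move=> xs; have /andP[xs1 xs2] : - `|s| <= x <= `|s| by rewrite -ler_norml.
  have : expR x <= expR `|s| by rewrite ler_expR.
  have : expR (- x) <= expR `|s| by rewrite ler_expR lerNl.
  have := expR_gt0 x; have := expR_gt0 (- x); have := cos_geN1 x; have := cos_le1 x.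
  rewrite ler_norml; lra.
have b3 := mvt_bound _ d3 b4; have b2 := mvt_bound _ d2 (b3 _).
have b1 := mvt_bound _ d1 (b2 _ _); have b0 := mvt_bound _ d0 (b1 _ _ _).
have -> : 2 * expR `|s| * `|s| ^+ 4 = 2 * expR `|s| * `|s| * `|s| * `|s| * `|s| by ring.
by apply: b0; rewrite // ?sin0 ?cos0 ?oppr0 ?expR0; field.
Qed.

Lemma exp_cosh_bound a : `|expR a + expR (- a) - 2| <= 2 * expR `|a| * `|a| ^+ 2.
Proof.
have d1 x : is_derive x 1 (fun x => expR x - expR (- x)) (expR x + expR (- x)).
  by apply: is_derive_eq; rewrite /GRing.scale/=; ring.
have d0 x : is_derive x 1 (fun x => expR x + expR (- x) - 2) (expR x - expR (- x)).
  by apply: is_derive_eq; rewrite /GRing.scale/=; ring.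
have b2 x : `|x| <= `|a| -> `|expR x + expR (- x)| <= 2 * expR `|a|.
  move=> xs; have /andP[xs1 xs2] : - `|a| <= x <= `|a| by rewrite -ler_norml.
  have : expR x <= expR `|a| by rewrite ler_expR.
  have : expR (- x) <= expR `|a| by rewrite ler_expR lerNl.
  have := expR_gt0 x; have := expR_gt0 (- x).
  rewrite ler_norml; lra.
have b1 := mvt_bound _ d1 b2; have b0 := mvt_bound _ d0 (b1 _).
have -> : 2 * expR `|a| * `|a| ^+ 2 = 2 * expR `|a| * `|a| * `|a| by ring.
by apply: b0; rewrite // ?oppr0 ?expR0; ring.
Qed.

Lemma robin_abs_le kap k y : 0 < kap -> `|robin kap k y| <= kap^-1.
Proof.
move=> kap0; have := robin_le k y kap0 => h.
rewrite -[leRHS]ger0_norm ?invr_ge0 ?(ltW kap0)// -ler_sqr ?nnegrE//.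
rewrite !real_normK ?num_real// exprVn -[leRHS]mul1r ler_pdivlMr ?exprn_gt0//.
by apply: le_trans h; rewrite ler_wpM2l ?sqr_ge0// lerDl sqr_ge0.
Qed.

(* The Robin condition makes the C^1 extension of the eigenfunction by an
   exponential agree with its analytic extension up to second order. *)
Lemma robin_defect kap k z : 0 < kap ->
  `|expR (- (kap * z)) * robin kap k 0 - robin kap k z| <=
  (kap + k ^+ 2 / kap) * expR (kap * `|z|) * `|z| ^+ 2.
Proof.
move=> kap0; set N := (kap ^+ 2 + k ^+ 2)^-1.
have n0 : kap ^+ 2 + k ^+ 2 != 0 by rewrite gt_eqF// cauchy_den_gt0.
have d1 x : is_derive x 1 (fun x => - kap * expR (- (kap * x)) * robin kap k 0 +
     (k ^+ 2 * sin (k * x) + kap * k * cos (k * x)) * N)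
   (kap ^+ 2 * expR (- (kap * x)) * robin kap k 0 + k ^+ 2 * robin kap k x).
  by apply: is_derive_eq; rewrite {3}/robin -/N /GRing.scale/=; ring.
have d0 x : is_derive x 1 (fun x => expR (- (kap * x)) * robin kap k 0 - robin kap k x)
   (- kap * expR (- (kap * x)) * robin kap k 0 + (k ^+ 2 * sin (k * x) + kap * k * cos (k * x)) * N).
  rewrite [X in is_derive _ _ X](_ : _ = fun x => expR (- (kap * x)) * robin kap k 0 -
     (k * cos (k * x) - kap * sin (k * x)) * N)//.
  by apply: is_derive_eq; rewrite /GRing.scale/=; ring.
have b2 x : `|x| <= `|z| -> `|kap ^+ 2 * expR (- (kap * x)) * robin kap k 0 + k ^+ 2 * robin kap k x|
    <= (kap + k ^+ 2 / kap) * expR (kap * `|z|).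
  move=> xz; apply: le_trans (ler_normD _ _) _.
  rewrite (normrM (_ * expR _)) (normrM (k ^+ 2)) (ger0_norm (sqr_ge0 k)).
  rewrite (ger0_norm (mulr_ge0 (sqr_ge0 kap) (expR_ge0 _))) mulrDl; apply: lerD.
    have -> : kap * expR (kap * `|z|) = kap ^+ 2 * expR (kap * `|z|) * kap^-1 by field; rewrite gt_eqF.
    apply: ler_pM; [by apply: mulr_ge0; [exact: sqr_ge0|exact: expR_ge0]|exact: normr_ge0| |exact: robin_abs_le].
    rewrite ler_wpM2l ?sqr_ge0// ler_expR -mulrN ler_wpM2l ?(ltW kap0)//.
    by apply: le_trans xz; rewrite -normrN ler_norm.
  apply: (@le_trans _ _ (k ^+ 2 / kap)); first by rewrite ler_wpM2l ?sqr_ge0 ?robin_abs_le.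
  rewrite ler_peMr ?divr_ge0 ?sqr_ge0 ?(ltW kap0)//.
  by rewrite -expR0 ler_expR mulr_ge0 ?(ltW kap0).
have b1 := mvt_bound _ d1 b2; have b0 := mvt_bound _ d0 (b1 _).
have -> : (kap + k ^+ 2 / kap) * expR (kap * `|z|) * `|z| ^+ 2 =
  (kap + k ^+ 2 / kap) * expR (kap * `|z|) * `|z| * `|z| by ring.
by apply: b0; rewrite // ?mulr0 ?oppr0 ?expR0 ?mul1r ?subrr// /robin ?mulr0 ?cos0 ?sin0 -/N; ring.
Qed.

Lemma pow4_le_exp s : 0 <= s -> s ^+ 4 <= 256 * expR s.
Proof.
move=> s0; have E : expR s = expR (s / 4) ^+ 4 by rewrite -expRM_natl; congr expR; field.
have -> : s ^+ 4 = 256 * (s / 4) ^+ 4 by field.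
rewrite ler_wpM2l// E lerXn2r// ?nnegrE ?expR_ge0 ?divr_ge0//.
by apply: le_trans (expR_ge1Dx _); rewrite lerDr.
Qed.

End taylor_bounds.

Section gaussian_bounds.
Context {R : realType}.
Implicit Types (x y z h l k M : R).

(** With s = |x| / sqrt h one has x^4 = h^2 s^4 <= 256 h^2 e^s. The exponential moment of order l +
    1/sqrt h is at most 2 e^((l sqrt h + 1)^2 / 2), uniformly for h <= 1. *)
Lemma gauss_pow4 h l : 0 < h -> h <= 1 -> 0 <= l ->
  (gauss h).-integrable setT (EFin \o (fun x => x ^+ 4 * expR (l * `|x|))) /\
  \int[gauss h]_x (x ^+ 4 * expR (l * `|x|)) <= 512 * expR ((l + 1) ^+ 2 / 2) * h ^+ 2.
Proof.
move=> h0 h1 l0; set r := Num.sqrt h.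
have r0 : 0 < r by rewrite sqrtr_gt0.
have rh : r ^+ 2 = h by rewrite sqr_sqrtr ?ltW.
have r1 : r <= 1 by rewrite -(sqrtr1 R) ler_sqrt.
have [i E] := gauss_exp_norm (l + r^-1) h0.
have le x : x ^+ 4 * expR (l * `|x|) <= 256 * h ^+ 2 * expR ((l + r^-1) * `|x|).
  have p : (r^-1 * `|x|) ^+ 4 <= 256 * expR (r^-1 * `|x|).
    by apply: pow4_le_exp; rewrite mulr_ge0 ?invr_ge0 ?(ltW r0).
  have x4 : x ^+ 4 = h ^+ 2 * (r^-1 * `|x|) ^+ 4.
    have -> : x ^+ 4 = `|x| ^+ 4 by rewrite -normrX ger0_norm// -[4%N]/(2 * 2)%N exprM sqr_ge0.
    by rewrite -rh; field; rewrite gt_eqF.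
  rewrite x4 (mulrDl l) expRD; have := expR_ge0 (l * `|x|); have := sqr_ge0 h.
  move: p; move: (_ ^+ 4) (expR _) (expR _) (h ^+ 2) => A B C H p H0 B0.
  have -> : 256 * H * (B * C) = H * (256 * C) * B by ring.
  rewrite ler_wpM2r// ler_wpM2l//.
have mx : measurable_fun setT (fun x : R => x ^+ 4 * expR (l * `|x|)).
  apply: measurable_funM; first exact: measurable_funX.
  by apply: measurableT_comp => //; apply: measurable_funM => //; exact: measurableT_comp.
have ig : (gauss h).-integrable setT (EFin \o (fun x => 256 * h ^+ 2 * expR ((l + r^-1) * `|x|))).
  exact: eq_integrable (integrableZl measurableT (256 * h ^+ 2) i).
have ix : (gauss h).-integrable setT (EFin \o (fun x => x ^+ 4 * expR (l * `|x|))).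
  apply: (gauss_integrable_le mx _ ig) => x; rewrite ger0_norm//.
  by rewrite mulr_ge0 ?expR_ge0// -[4%N]/(2 * 2)%N exprM sqr_ge0.
split => //.
apply: le_trans (le_Rintegral measurableT ix ig (fun x _ => le x)) _.
rewrite (RintegralZl _ measurableT i).
apply: (@le_trans _ _ (256 * h ^+ 2 * (2 * expR ((l + 1) ^+ 2 / 2)))); last first.
  by rewrite le_eqVlt; apply/orP; left; apply/eqP; ring.
apply: ler_wpM2l; first exact: mulr_ge0 (ler0n R 256) (sqr_ge0 h).
apply: le_trans E _.
rewrite ler_wpM2l// ler_expR ler_wpM2r ?invr_ge0//.
have -> : (l + r^-1) ^+ 2 * h = (l * r + 1) ^+ 2 by rewrite -rh; field; rewrite gt_eqF.
by rewrite lerXn2r ?nnegrE ?addr_ge0 ?mulr_ge0 ?(ltW r0)// lerD2r ler_piMr.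
Qed.

(** The first summand is twice the fourth-moment bound, from [cos_cosh_bound]; the second comes from
    [exp_cosh_bound]. *)
Definition cos_const M : R := 1024 * M ^+ 4 * expR ((M + 1) ^+ 2 / 2) +
  2 * expR (M ^+ 2 / 2) * (M ^+ 2 / 2) ^+ 2.

(** Put a = k^2 h / 2. Up to the fourth-order remainder the mean of cos(k x) is 2 - e^a, and this
    differs from e^(- a) by e^a + e^(- a) - 2, of order a^2. *)
Lemma gauss_cos h k M : 0 < h -> h <= 1 -> 0 <= k -> k <= M ->
  `|\int[gauss h]_x cos (k * x) - expR (- (k ^+ 2 * h / 2))| <= cos_const M * h ^+ 2.
Proof.
move=> h0 h1 k0 kM; have [i4 E4] := gauss_pow4 h0 h1 k0.
have M0 : 0 <= M by exact: le_trans kM.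
have ie l := integrable_gauss_exp l h0.
have mcos : measurable_fun setT (fun x : R => cos (k * x)).
  apply: measurableT_comp; last exact: measurable_funM.
  by apply: continuous_measurable_fun; exact: continuous_cos.
have icos : (gauss h).-integrable setT (EFin \o (fun x : R => cos (k * x))).
  apply: (@gauss_integrable_le _ h _ (cst 1) mcos).
    by move=> x; rewrite ler_norml cos_geN1 cos_le1.
  exact: finite_measure_integrable_cst.
pose f x := cos (k * x) + (expR (k * x) + expR (- k * x)) / 2 - 2.
have if1 : (gauss h).-integrable setT (EFin \o (fun x => expR (k * x) + expR (- k * x))).
  by apply: eq_integrable (integrableD _ (ie k) (ie (- k))).
have if2 : (gauss h).-integrable setT (EFin \o (fun x => 2^-1 * (expR (k * x) + expR (- k * x)))).
  exact: eq_integrable (integrableZl measurableT 2^-1 if1).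
have if3 : (gauss h).-integrable setT (EFin \o (fun x => cos (k * x) + 2^-1 * (expR (k * x) + expR (- k * x)))).
  by apply: eq_integrable (integrableD _ icos if2).
have i2 : (gauss h).-integrable setT (EFin \o cst (2 : R)) by exact: finite_measure_integrable_cst.
have fE : f = (fun x => (cos (k * x) + 2^-1 * (expR (k * x) + expR (- k * x))) - cst 2 x).
  by apply/funext => x; rewrite /f [_ / 2]mulrC.
have if_ : (gauss h).-integrable setT (EFin \o f).
  by rewrite fE; apply: eq_integrable (integrableB _ if3 i2).
have Ef : \int[gauss h]_x f x = \int[gauss h]_x cos (k * x) + expR (k ^+ 2 * h / 2) - 2.
  rewrite fE (RintegralB measurableT if3 i2) (RintegralD measurableT icos if2).
  rewrite (RintegralZl _ measurableT if1) (RintegralD measurableT (ie k) (ie (- k))).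
  rewrite !gauss_mgfR// sqrrN Rintegral_cst// [fine _](_ : _ = 1).
    by field.
  exact: (congr1 fine (@probability_setT _ _ _ (gauss h))).
have bf : `|\int[gauss h]_x f x| <= 1024 * k ^+ 4 * expR ((k + 1) ^+ 2 / 2) * h ^+ 2.
  apply: le_trans (le_normr_Rintegral measurableT if_) _.
  have ig : (gauss h).-integrable setT (EFin \o (fun x => 2 * k ^+ 4 * (x ^+ 4 * expR (k * `|x|)))).
    exact: eq_integrable (integrableZl measurableT (2 * k ^+ 4) i4).
  have le x : `|f x| <= 2 * k ^+ 4 * (x ^+ 4 * expR (k * `|x|)).
    rewrite /f mulNr; apply: le_trans (cos_cosh_bound (k * x)) _.
    rewrite normrM (ger0_norm k0) exprMn.
    have -> : `|x| ^+ 4 = x ^+ 4 by rewrite -normrX ger0_norm// -[4%N]/(2 * 2)%N exprM sqr_ge0.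
    by rewrite le_eqVlt; apply/orP; left; apply/eqP; ring.
  apply: le_trans (le_Rintegral measurableT (integrable_norm if_) ig (fun x _ => le x)) _.
  rewrite (RintegralZl _ measurableT i4).
  apply: (@le_trans _ _ (2 * k ^+ 4 * (512 * expR ((k + 1) ^+ 2 / 2) * h ^+ 2))).
    by rewrite ler_wpM2l// mulr_ge0// exprn_ge0.
  by rewrite le_eqVlt; apply/orP; left; apply/eqP; ring.
set a := k ^+ 2 * h / 2 in Ef *.
have a0 : 0 <= a by rewrite /a divr_ge0// mulr_ge0 ?sqr_ge0 ?(ltW h0).
have bc := exp_cosh_bound a; rewrite (ger0_norm a0) in bc.
have aM : a <= M ^+ 2 / 2 * h.
  rewrite /a mulrAC ler_wpM2r ?(ltW h0)// ler_wpM2r ?invr_ge0// lerXn2r ?nnegrE//.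
have aM1 : a <= M ^+ 2 / 2.
  by apply: le_trans aM _; rewrite ler_piMr ?divr_ge0 ?sqr_ge0.
have bc2 : 2 * expR a * a ^+ 2 <= 2 * expR (M ^+ 2 / 2) * (M ^+ 2 / 2) ^+ 2 * h ^+ 2.
  rewrite -[leRHS]mulrA -exprMn; apply: ler_pM; [by apply: mulr_ge0 => //; exact: expR_ge0|exact: sqr_ge0| |].
    by rewrite ler_wpM2l// ler_expR.
  by rewrite lerXn2r ?nnegrE// (le_trans a0).
have bf2 : 1024 * k ^+ 4 * expR ((k + 1) ^+ 2 / 2) * h ^+ 2 <=
    1024 * M ^+ 4 * expR ((M + 1) ^+ 2 / 2) * h ^+ 2.
  have n0 := ler0n R 1024; move: (1024%:R) n0 => N n0.
  apply: ler_wpM2r; first exact: sqr_ge0.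
  apply: ler_pM; [by apply: mulr_ge0 => //; exact: exprn_ge0|exact: expR_ge0| |].
    by apply: ler_wpM2l => //; rewrite lerXn2r ?nnegrE.
  by rewrite ler_expR ler_wpM2r ?invr_ge0// lerXn2r ?nnegrE ?addr_ge0// lerD2r.
have -> : \int[gauss h]_x cos (k * x) - expR (- a) =
    \int[gauss h]_x f x - (expR a + expR (- a) - 2) by rewrite Ef; ring.
apply: le_trans (ler_normB _ _) _; rewrite /cos_const mulrDl; apply: lerD.
  exact: le_trans bf bf2.
exact: le_trans bc bc2.
Qed.

End gaussian_bounds.

Section measurable_Rintegral.
Context d1 d2 (T1 : measurableType d1) (T2 : measurableType d2) (R : realType).
Variables (m2 : {sigma_finite_measure set T2 -> \bar R}) (D2 : set T2) (mD2 : measurable D2).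

Lemma measurable_Rintegral2 (f : T1 * T2 -> R) : measurable_fun setT f ->
  measurable_fun setT (fun x => \int[m2]_(y in D2) f (x, y)).
Proof.
move=> mf; have mfE : measurable_fun setT (EFin \o f) by exact/measurable_EFinP.
rewrite (_ : (fun _ => _) = fine \o (fun x => (\int[m2]_(y in D2) (EFin \o f) (x, y))%E)); last exact/funext.
apply: measurableT_comp => //.
rewrite (_ : (fun _ => _) = (fun x => \int[m2]_(y in D2) (EFin \o f)^\+ (x, y)) \-
    (fun x => \int[m2]_(y in D2) (EFin \o f)^\- (x, y)))%E; last first.
  apply/funext => x; rewrite [LHS]integralE.
  by congr (_ - _)%E; apply: eq_integral => y _; rewrite ?funeposE ?funenegE.
apply: emeasurable_funB; apply: measurable_integral2 => //.
- exact: measurable_funepos.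
- exact: measurable_funeneg.
Qed.

End measurable_Rintegral.

(** * The reflection operator and its iterates *)

Section reflection_operator.
Context {R : realType}.
Implicit Types (x y z h k kap B : R) (f g : R -> R).
Local Notation r := ((Num.sqrt 2)^-1 : R).

(* Between grid times the path minus its running minimum moves freely above 0;
   when it reaches a new minimum -z it is reset to 0, and the minimum enters the
   exponential weight with rate kap. *)
Definition refl kap f z : R := if z < 0 then expR (- (kap * z)) * f 0 else f z.

(** The factor 1/sqrt 2 makes the variance of a step h / 2, hence the exponents kap^2 h / 4 and k^2
    h / 4 below. *)
Definition refl_step kap h f y : R := \int[gauss h]_x refl kap f (y + r * x).

(** Boundedness is asked only for y >= 0: [refl] sees nothing else of [f], and the bound state is
    unbounded on the negative side. *)
Definition half_bounded f := measurable_fun setT f /\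
  exists2 B, 0 <= B & forall y, 0 <= y -> `|f y| <= B.

Lemma sqrt2V_ge0 : 0 <= r. Proof. by rewrite invr_ge0 sqrtr_ge0. Qed.
Lemma sqrt2V_le1 : r <= 1.
Proof.
rewrite invf_le1 ?sqrtr_gt0//; have := sqrtr1 R => {1}<-.
by rewrite ler_sqrt// ler1n.
Qed.
Lemma sqrt2V_sqr : r ^+ 2 = 2^-1. Proof. by rewrite exprVn sqr_sqrtr. Qed.

Lemma normr_shift x y : `|y + r * x| <= `|y| + `|x|.
Proof.
apply: le_trans (ler_normD _ _) _; rewrite lerD2l normrM (ger0_norm sqrt2V_ge0).
by rewrite ler_piMl// sqrt2V_le1.
Qed.

Lemma expR_shift kap x y : 0 <= kap ->
  expR (kap * `|y + r * x|) <= expR (kap * `|y|) * expR (kap * `|x|).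
Proof.
by move=> k0; rewrite -expRD ler_expR -mulrDr ler_wpM2l// normr_shift.
Qed.

Lemma measurable_shift y : measurable_fun setT (fun x : R => y + r * x).
Proof. by apply: measurable_funD => //; exact: measurable_funM. Qed.

Lemma measurable_shift2 : measurable_fun setT (fun z : measurableTypeR R * measurableTypeR R => z.1 + r * z.2).
Proof. by apply: measurable_funD => //; apply: measurable_funM => //. Qed.

Lemma measurable_refl kap f : measurable_fun setT f -> measurable_fun setT (refl kap f).
Proof.
move=> mf; apply: measurable_fun_ifT => //; first exact: measurable_fun_ltr.
apply: measurable_funM => //; apply: measurableT_comp => //; exact: measurableT_comp.
Qed.

Lemma measurable_step kap h f : measurable_fun setT f -> measurable_fun setT (refl_step kap h f).
Proof.
move=> mf; pose F (z : measurableTypeR R * measurableTypeR R) := refl kap f (z.1 + r * z.2).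
suff mF : measurable_fun setT F by exact: (measurable_Rintegral2 (gauss h) measurableT mF).
apply: measurableT_comp; [exact: measurable_refl|exact: measurable_shift2].
Qed.

Lemma refl_le kap f B z : 0 <= kap -> 0 <= B -> (forall y, 0 <= y -> `|f y| <= B) ->
  `|refl kap f z| <= B * expR (kap * `|z|).
Proof.
move=> k0 B0 fB; rewrite /refl; case: ltP => z0.
  rewrite normrM ger0_norm ?expR_ge0// mulrC ler_pM ?expR_ge0 ?fB//.
  by rewrite ltr0_norm// mulrN.
apply: le_trans (fB _ z0) _; rewrite ler_peMr// -expR0 ler_expR mulr_ge0//.
Qed.

Lemma integrable_shift_le kap h y f : 0 < h -> 0 <= kap -> measurable_fun setT f ->
  forall B, 0 <= B -> (forall z, `|f z| <= B * expR (kap * `|z|)) ->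
  (gauss h).-integrable setT (EFin \o (fun x => f (y + r * x))).
Proof.
move=> h0 k0 mf B B0 fB; have [i _] := gauss_exp_norm kap h0.
have i2 : (gauss h).-integrable setT (EFin \o (fun x => B * expR (kap * `|y|) * expR (kap * `|x|))).
  exact: eq_integrable (integrableZl measurableT (B * expR (kap * `|y|)) i).
apply: (gauss_integrable_le _ _ i2).
  by apply: measurableT_comp => //; exact: measurable_shift.
move=> x; apply: le_trans (fB _) _; rewrite -mulrA; apply: ler_wpM2l => //; exact: expR_shift.
Qed.

Lemma integrable_refl kap h f y : 0 < h -> 0 <= kap -> half_bounded f ->
  (gauss h).-integrable setT (EFin \o (fun x => refl kap f (y + r * x))).
Proof.
move=> h0 k0 [mf [B B0 fB]].
by apply: (integrable_shift_le y h0 k0 (measurable_refl kap mf) B0) => z; exact: refl_le.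
Qed.

Lemma refl_mono kap f g z : (forall y, 0 <= y -> f y <= g y) -> refl kap f z <= refl kap g z.
Proof.
move=> fg; rewrite /refl; case: ltP => z0; last exact: fg.
by rewrite ler_wpM2l ?expR_ge0// fg.
Qed.

Lemma refl_step_mono kap h f g y : 0 < h -> 0 <= kap -> half_bounded f -> half_bounded g ->
  (forall y, 0 <= y -> f y <= g y) -> refl_step kap h f y <= refl_step kap h g y.
Proof.
move=> h0 k0 gf gg fg; apply: le_Rintegral => //; [exact: integrable_refl|exact: integrable_refl|].
by move=> x _; exact: refl_mono.
Qed.

Lemma reflB kap f g z : refl kap (f \- g) z = refl kap f z - refl kap g z.
Proof. by rewrite /refl; case: ifP => //= _; rewrite mulrBr. Qed.

Lemma reflZ kap a f z : refl kap (a \*o f) z = a * refl kap f z.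
Proof. by rewrite /refl; case: ifP => //= _; ring. Qed.

Lemma half_boundedB f g : half_bounded f -> half_bounded g -> half_bounded (f \- g).
Proof.
move=> [mf [B B0 fB]] [mg [C C0 gC]]; split; first exact: measurable_funB.
exists (B + C); first exact: addr_ge0.
by move=> y y0; apply: le_trans (ler_normB _ _) _; rewrite lerD ?fB ?gC.
Qed.

Lemma half_boundedZ a f : half_bounded f -> half_bounded (a \*o f).
Proof.
move=> [mf [B B0 fB]]; split; first exact: measurable_funM.
exists (`|a| * B); first exact: mulr_ge0.
by move=> y y0 /=; rewrite normrM ler_wpM2l// fB.
Qed.

Lemma half_bounded_norm f : half_bounded f -> half_bounded (fun y => `|f y|).
Proof.
move=> [mf [B B0 fB]]; split; first exact: measurableT_comp.
by exists B => // y y0; rewrite normr_id fB.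
Qed.

Lemma refl_stepB kap h f g y : 0 < h -> 0 <= kap -> half_bounded f -> half_bounded g ->
  refl_step kap h (f \- g) y = refl_step kap h f y - refl_step kap h g y.
Proof.
move=> h0 k0 gf gg; have i1 := integrable_refl y h0 k0 gf; have i2 := integrable_refl y h0 k0 gg.
by rewrite /refl_step -(RintegralB measurableT i1 i2); apply: eq_Rintegral => x _; rewrite reflB.
Qed.

Lemma refl_stepZ kap h a f y : 0 < h -> 0 <= kap -> half_bounded f ->
  refl_step kap h (a \*o f) y = a * refl_step kap h f y.
Proof.
move=> h0 k0 gf; have i1 := integrable_refl y h0 k0 gf.
by rewrite /refl_step -(RintegralZl a measurableT i1); apply: eq_Rintegral => x _; rewrite reflZ.
Qed.

Lemma refl_step_norm kap h f y : 0 < h -> 0 <= kap -> half_bounded f ->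
  `|refl_step kap h f y| <= refl_step kap h (fun y => `|f y|) y.
Proof.
move=> h0 k0 gf; have i1 := integrable_refl y h0 k0 gf.
apply: le_trans (le_normr_Rintegral measurableT i1) _.
apply: le_Rintegral => //; [exact: integrable_norm|by apply: integrable_refl => //; exact: half_bounded_norm|].
move=> x _; rewrite /refl; case: ifP => // _.
by rewrite normrM ger0_norm ?expR_ge0.
Qed.

End reflection_operator.

(** * A Lyapunov function for the reflected walk *)

Section reflected_iteration.
Context {R : realType}.
Implicit Types (x y z h k kap B C b M eps : R) (f g : R -> R).
Local Notation r := ((Num.sqrt 2)^-1 : R).

(** It stays between 1 and 2 on the half-line. At 0 its value is 2 and its slope - 3 kap, whereas
    the Robin condition would ask for - 2 kap; the surplus [kap] is the gain per unit of
    undershoot. *)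
Definition lyapunov kap y : R := 1 + expR (- (3 * kap * y)).

(** The factor e^((3 kap)^2 h / 4) by which a free step multiplies e^(- 3 kap y). *)
Definition growth kap h : R := expR (9 * kap ^+ 2 * h / 4).

(** Summed along the walk, this is a discrete local time at 0. *)
Definition undershoot h y : R := \int[gauss h]_x Num.max 0 (- (y + r * x)).

Lemma lyapunov_ge1 kap y : 1 <= lyapunov kap y.
Proof. by rewrite lerDl expR_ge0. Qed.

Lemma lyapunov_le2 kap y : 0 <= kap -> 0 <= y -> lyapunov kap y <= 2.
Proof.
move=> k0 y0; rewrite /lyapunov (_ : 2 = 1 + 1 :> R)// lerD2l -[leRHS]expR0 ler_expR oppr_le0.
by rewrite !mulr_ge0.
Qed.

Lemma half_bounded_lyapunov kap : 0 <= kap -> half_bounded (lyapunov kap).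
Proof.
move=> k0; split.
  apply: measurable_funD => //; apply: measurableT_comp => //; exact: measurableT_comp.
exists 2 => // y y0; rewrite ger0_norm ?lyapunov_le2//.
exact: le_trans ler01 (lyapunov_ge1 _ _).
Qed.

Lemma growth_ge1 kap h : 0 < h -> 1 <= growth kap h.
Proof.
move=> h0; rewrite -expR0 ler_expR divr_ge0// mulr_ge0 ?(ltW h0)//.
by rewrite mulr_ge0// sqr_ge0.
Qed.

Lemma refl_step_exp l h y : 0 < h ->
  \int[gauss h]_x expR (- (l * (y + r * x))) = expR (l ^+ 2 * h / 4) * expR (- (l * y)).
Proof.
move=> h0; have E x : expR (- (l * (y + r * x))) = expR (- (l * y)) * expR (- (l * r) * x).
  by rewrite -expRD; congr expR; ring.
rewrite (_ : (fun x => _) = fun x => expR (- (l * y)) * expR (- (l * r) * x)); last exact/funext.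
rewrite (RintegralZl _ measurableT (integrable_gauss_exp (- (l * r)) h0)) gauss_mgfR// mulrC.
by congr (expR _ * _); rewrite sqrrN exprMn sqrt2V_sqr; field.
Qed.

(** The weight given to a crossing is the continuation of the bound state itself, so this function
    undergoes a free Gaussian step, exactly and for every [h]. *)
Lemma refl_step_bound_state kap h y : 0 < h ->
  refl_step kap h (fun y => expR (- (kap * y))) y = expR (kap ^+ 2 * h / 4) * expR (- (kap * y)).
Proof.
move=> h0; rewrite -(refl_step_exp kap y h0)//; apply: eq_Rintegral => x _.
by rewrite /refl; case: ifP => // _; rewrite mulr0 oppr0 expR0 mulr1.
Qed.

Lemma undershoot_ge0 h y : 0 <= undershoot h y.
Proof. by apply: Rintegral_ge0 => x _; rewrite le_max lexx. Qed.

Lemma integrable_undershoot h y : 0 < h ->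
  (gauss h).-integrable setT (EFin \o (fun x => Num.max 0 (- (y + r * x)))).
Proof.
move=> h0; apply: (@integrable_shift_le _ 1 h y (fun z => Num.max 0 (- z)) h0 ler01 _ 1 ler01).
  by apply: measurable_maxr => //; exact: measurableT_comp.
move=> z; rewrite !mul1r ger0_norm ?le_max ?lexx//.
apply: (@le_trans _ _ `|z|); first by rewrite ge_max normr_ge0/= -normrN ler_norm.
by apply: le_trans (expR_ge1Dx _); rewrite lerDr.
Qed.

(* With q = e^(kap|z|): q^3 - 3q + 2 = (q-1)^2 (q+2) >= 0 and q - 1 >= kap|z|. *)
Lemma refl_lyapunov kap z : 0 < kap ->
  refl kap (lyapunov kap) z <= lyapunov kap z - kap * Num.max 0 (- z).
Proof.
move=> k0; rewrite /refl; case: ltP => z0; last first.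
  by rewrite (_ : Num.max 0 (- z) = 0) ?mulr0 ?subr0// max_l// oppr_le0.
rewrite max_r ?oppr_ge0 ?(ltW z0)// /lyapunov mulr0 oppr0 expR0.
have -> : expR (- (3 * kap * z)) = expR (- (kap * z)) ^+ 3.
  by rewrite -expRM_natl; congr expR; ring.
have := expR_ge1Dx (- (kap * z)).
have : 0 < - (kap * z) by rewrite oppr_gt0 pmulr_rlt0.
rewrite mulrN; move: (kap * z) => w w0; move: (expR _) => q h1.
rewrite -subr_ge0 (_ : _ - _ = (q - 1) ^+ 2 * (q + 2) + (q - 1 + w)); last by ring.
rewrite addr_ge0//; last by lra.
by rewrite mulr_ge0 ?sqr_ge0//; lra.
Qed.

Lemma refl_step_lyapunov kap h y : 0 < kap -> 0 < h ->
  refl_step kap h (lyapunov kap) y <= growth kap h * lyapunov kap y - kap * undershoot h y.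
Proof.
move=> k0 h0; have k0' := ltW k0.
have ie : (gauss h).-integrable setT (EFin \o (fun x => expR (- (3 * kap * (y + r * x))))).
  apply: (@integrable_shift_le _ (3 * kap) h y (fun z => expR (- (3 * kap * z))) h0 _ _ 1 ler01).
  - exact: mulr_ge0.
  - by apply: measurableT_comp => //; exact: measurableT_comp.
  move=> z; rewrite mul1r ger0_norm ?expR_ge0// ler_expR -mulrN ler_wpM2l ?mulr_ge0//.
  by rewrite -normrN ler_norm.
have i1 : (gauss h).-integrable setT (EFin \o (fun _ => 1 : R)).
  exact: finite_measure_integrable_cst.
have iW : (gauss h).-integrable setT (EFin \o (fun x => lyapunov kap (y + r * x))).
  exact: eq_integrable (integrableD measurableT i1 ie).
have iu := integrable_undershoot y h0.
have iu2 : (gauss h).-integrable setT (EFin \o (fun x => kap * Num.max 0 (- (y + r * x)))).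
  exact: eq_integrable (integrableZl measurableT kap iu).
have iB : (gauss h).-integrable setT
    (EFin \o (fun x => lyapunov kap (y + r * x) - kap * Num.max 0 (- (y + r * x)))).
  exact: eq_integrable (integrableB measurableT iW iu2).
apply: le_trans (le_Rintegral measurableT (integrable_refl y h0 k0' (half_bounded_lyapunov k0')) iB _) _.
  by move=> x _; exact: refl_lyapunov.
rewrite (RintegralB measurableT iW iu2) (RintegralZl kap measurableT iu) lerD2r.
rewrite (RintegralD measurableT i1 ie) refl_step_exp//.
have -> : \int[gauss h]_x 1 = 1 :> R.
  by rewrite Rintegral_cst// mul1r; exact: (congr1 fine (@probability_setT _ _ _ (gauss h))).
rewrite /lyapunov mulrDr mulr1 /growth; have -> : (3 * kap) ^+ 2 = 9 * kap ^+ 2 by ring.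
by rewrite lerD2r; exact: growth_ge1.
Qed.

(** The operator is positive, so domination by the Lyapunov function passes through a step together
    with its undershoot gain. *)
Lemma refl_step_le_lyapunov kap h f B y : 0 < kap -> 0 < h -> half_bounded f -> 0 <= B ->
  (forall y, 0 <= y -> `|f y| <= B * lyapunov kap y) ->
  `|refl_step kap h f y| <= B * (growth kap h * lyapunov kap y - kap * undershoot h y).
Proof.
move=> k0 h0 gf B0 fB; have k0' := ltW k0; apply: le_trans (refl_step_norm _ h0 k0' gf) _.
have gl := half_bounded_lyapunov k0'.
apply: le_trans (refl_step_mono _ h0 k0' (half_bounded_norm gf) (half_boundedZ B gl) fB) _.
by rewrite refl_stepZ// ler_wpM2l// refl_step_lyapunov.
Qed.

Lemma half_bounded_step kap h f : 0 < kap -> 0 < h -> half_bounded f -> half_bounded (refl_step kap h f).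
Proof.
move=> k0 h0 gf; have [mf [B B0 fB]] := gf; split; first exact: measurable_step.
exists (B * (growth kap h * 2)).
  by rewrite !mulr_ge0// (le_trans ler01)// growth_ge1.
move=> y y0; apply: le_trans (@refl_step_le_lyapunov kap h f B y k0 h0 gf B0 _) _.
  move=> x x0; apply: le_trans (fB x x0) _; rewrite ler_peMr// lyapunov_ge1//.
rewrite ler_wpM2l//; apply: (@le_trans _ _ (growth kap h * lyapunov kap y)).
  by rewrite gerDl oppr_le0 mulr_ge0 ?undershoot_ge0 ?(ltW k0).
rewrite ler_wpM2l ?lyapunov_le2 ?(ltW k0)//.
exact: le_trans ler01 (growth_ge1 _ h0).
Qed.

Lemma half_bounded_iter_step kap h f n : 0 < kap -> 0 < h -> half_bounded f -> half_bounded (iter n (refl_step kap h) f).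
Proof. by move=> k0 h0 gf; elim: n => //= n ih; exact: half_bounded_step. Qed.

(* The one-step error b * undershoot is absorbed by the undershoot term gained
   by the Lyapunov function, so it does not accumulate over the steps. *)
Lemma iter_step_error kap h G (F : nat -> R -> R) b e delta n : 0 < kap -> 0 < h ->
  0 <= b -> 0 <= e -> 0 <= delta -> half_bounded G -> (forall i, half_bounded (F i)) ->
  (forall i y, 0 <= y -> `|refl_step kap h (F i) y - F i.+1 y| <= b * undershoot h y + e) ->
  (forall y, 0 <= y -> `|G y - F 0%N y| <= delta) ->
  forall y, 0 <= y -> `|iter n (refl_step kap h) G y - F n y| <=
    growth kap h ^+ n * (delta + b / kap + n%:R * e) * lyapunov kap y.
Proof.
move=> k0 h0 b0 e0 d0 gG gF FF GF; have g1 := growth_ge1 kap h0.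
have bk0 : 0 <= b / kap by rewrite divr_ge0// ltW.
elim: n => [|n IH] y y0.
  rewrite expr0 mul0r addr0 mul1r; apply: le_trans (GF y y0) _.
  apply: (@le_trans _ _ (delta + b / kap)); first by rewrite lerDl.
  by rewrite ler_peMr ?lyapunov_ge1// addr_ge0.
have gI := half_bounded_iter_step n k0 h0 gG.
set D := growth kap h ^+ n * (delta + b / kap + n%:R * e) in IH.
have X1 : 1 <= growth kap h ^+ n by exact: exprn_ege1.
(* The summand b / kap in the claim is a reserve: it keeps D kap >= b, so that the gain at the next
   step pays for the boundary error. *)
have Db : b / kap <= D.
  rewrite -[leLHS]mul1r ler_pM// addrAC lerDr addr_ge0//; exact: mulr_ge0.
have D0 : 0 <= D by exact: le_trans Db.
have := @refl_step_le_lyapunov kap h (iter n (refl_step kap h) G \- F n) D y k0 h0 (half_boundedB gI (gF n)) D0 IH.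
rewrite refl_stepB ?(ltW k0)// iterS => s1.
have s2 := FF n y y0.
have -> : refl_step kap h (iter n (refl_step kap h) G) y - F n.+1 y =
   (refl_step kap h (iter n (refl_step kap h) G) y - refl_step kap h (F n) y) + (refl_step kap h (F n) y - F n.+1 y).
  by rewrite addrA subrK.
apply: le_trans (ler_normD _ _) _; apply: le_trans (lerD s1 s2) _.
have u0 := undershoot_ge0 h y; have W1 := lyapunov_ge1 kap y.
have Dk : b <= D * kap by rewrite -ler_pdivrMr.
have -> : growth kap h ^+ n.+1 * (delta + b / kap + n.+1%:R * e) =
   growth kap h * D + growth kap h ^+ n.+1 * e.
  by rewrite /D exprS -natr1; ring.
have Y1 : e <= growth kap h ^+ n.+1 * e by rewrite ler_peMl// exprn_ege1.
have Y2 : e <= growth kap h ^+ n.+1 * e * lyapunov kap y.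
  by apply: (le_trans Y1); rewrite ler_peMr//; exact: (le_trans e0 Y1).
rewrite mulrDl -subr_ge0.
rewrite (_ : _ - _ = (D * kap - b) * undershoot h y +
  (growth kap h ^+ n.+1 * e * lyapunov kap y - e)); last by ring.
by rewrite addr_ge0 ?subr_ge0// mulr_ge0 ?subr_ge0.
Qed.

End reflected_iteration.

Section step_on_eigenfunctions.
Context {R : realType}.
Implicit Types (x y z h k kap B C b M eps : R) (f g : R -> R).
Local Notation r := ((Num.sqrt 2)^-1 : R).

Lemma integrable_gauss_bounded h f B : measurable_fun setT f -> (forall x, `|f x| <= B) ->
  (gauss h).-integrable setT (EFin \o f).
Proof.
move=> mf fB; apply: (@gauss_integrable_le _ h f (cst B) mf fB).
exact: finite_measure_integrable_cst.
Qed.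

Lemma measurable_robin d (T : measurableType d) (kap : R) (u v : T -> R) : 0 < kap ->
  measurable_fun setT u -> measurable_fun setT v -> measurable_fun setT (fun t => robin kap (u t) (v t)).
Proof.
move=> k0 mu mv.
have muv : measurable_fun setT (fun t => u t * v t) by exact: measurable_funM.
have mcos : measurable_fun setT (cos : R -> R) by apply: continuous_measurable_fun; exact: continuous_cos.
have msin : measurable_fun setT (sin : R -> R) by apply: continuous_measurable_fun; exact: continuous_sin.
apply: measurable_funM.
  apply: measurable_funB; apply: measurable_funM => //; exact: measurableT_comp.
apply: (@measurableT_comp _ _ _ _ _ _ (fun k => (kap ^+ 2 + k ^+ 2)^-1) _ u) => //.
apply: continuous_measurable_fun => k; apply: cvgV; first by rewrite gt_eqF// cauchy_den_gt0.
by apply: cvgD; [exact: cvg_cst|exact: exprn_continuous].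
Qed.

Lemma half_bounded_robin kap k : 0 < kap -> half_bounded (robin kap k).
Proof.
move=> k0; split; first exact: (measurable_robin k0 (measurable_cst k)).
by exists kap^-1; [rewrite invr_ge0 ltW|move=> y _; exact: robin_abs_le].
Qed.

(** By the addition formulas the sine part averages to 0: off the boundary a Robin function is an
    exact eigenfunction of the free step. *)
Lemma gauss_robin kap k h y : 0 < h ->
  \int[gauss h]_x robin kap k (y + r * x) = robin kap k y * \int[gauss h]_x cos (k * r * x).
Proof.
move=> h0; pose s := (k * sin (k * y) + kap * cos (k * y)) / (kap ^+ 2 + k ^+ 2).
have E x : robin kap k (y + r * x) = robin kap k y * cos (k * r * x) - s * sin (k * r * x).
  by rewrite /robin /s (mulrDr k y) (mulrA k r) sinD cosD; ring.
rewrite (_ : (fun x => _) = fun x => robin kap k y * cos (k * r * x) - s * sin (k * r * x)); last exact/funext.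
have mx : measurable_fun setT (fun x : R => k * r * x) by exact: measurable_funM.
have ic : (gauss h).-integrable setT (EFin \o (fun x : R => cos (k * r * x))).
  apply: (@integrable_gauss_bounded h _ 1).
    by apply: measurableT_comp => //; apply: continuous_measurable_fun; exact: continuous_cos.
  by move=> x; rewrite ler_norml cos_geN1 cos_le1.
have is_ : (gauss h).-integrable setT (EFin \o (fun x : R => sin (k * r * x))).
  apply: (@integrable_gauss_bounded h _ 1).
    by apply: measurableT_comp => //; apply: continuous_measurable_fun; exact: continuous_sin.
  by move=> x; rewrite ler_norml sin_geN1 sin_le1.
have ic2 : (gauss h).-integrable setT (EFin \o (fun x : R => robin kap k y * cos (k * r * x))).
  exact: eq_integrable (integrableZl measurableT (robin kap k y) ic).
have is2 : (gauss h).-integrable setT (EFin \o (fun x : R => s * sin (k * r * x))).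
  exact: eq_integrable (integrableZl measurableT s is_).
rewrite (RintegralB measurableT ic2 is2) (RintegralZl _ measurableT ic) (RintegralZl _ measurableT is_).
by rewrite gauss_sin// mulr0 subr0.
Qed.

Definition robin_scale kap M : R := kap + M ^+ 2 / kap.

(** The first summand bounds the boundary defect through a fourth moment, whence eps^(-2); the
    second is the error in the mean of the cosine times the bound 1 / kap on Robin functions. *)
Definition robin_error kap M eps : R :=
  robin_scale kap M * (512 * expR ((3 * kap + 1) ^+ 2 / 2) / eps ^+ 2) + cos_const M / kap.

(** With w = |z| e^(kap |z|) the second-order defect is |z| w, and w <= eps + eps^(-2) w^3,
    according to whether w <= eps. This separates a term proportional to the undershoot from one of
    fourth order. *)
Lemma refl_robin_defect kap k M eps y x : 0 < kap -> 0 <= k -> k <= M -> 0 < eps -> 0 <= y ->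
  `|refl kap (robin kap k) (y + r * x) - robin kap k (y + r * x)| <=
  robin_scale kap M * (eps * Num.max 0 (- (y + r * x)) + eps ^- 2 * (x ^+ 4 * expR (3 * kap * `|x|))).
Proof.
move=> k0 kk kM e0 y0; set z := y + r * x; have M0 : 0 <= M by exact: le_trans kM.
have x4 : 0 <= x ^+ 4 by rewrite -[4%N]/(2 * 2)%N exprM sqr_ge0.
have s0 : 0 <= robin_scale kap M by rewrite addr_ge0 ?divr_ge0 ?sqr_ge0 ?(ltW k0).
rewrite /refl; case: ltP => z0; last first.
  rewrite subrr normr0; apply: mulr_ge0 => //; apply: addr_ge0.
    by apply: mulr_ge0; rewrite ?(ltW e0)// le_max lexx.
  by apply: mulr_ge0; [rewrite invr_ge0 sqr_ge0|apply: mulr_ge0 => //; exact: expR_ge0].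
apply: le_trans (robin_defect k z k0) _; rewrite -mulrA.
(* Since y >= 0, ending at depth |z| takes a jump at least that large. *)
have zx : `|z| <= `|x|.
  rewrite ltr0_norm//; apply: (@le_trans _ _ (- (r * x))).
    by rewrite lerN2 lerDr.
  apply: le_trans (ler_norm _) _; rewrite normrN normrM (ger0_norm sqrt2V_ge0).
  by rewrite ler_piMl// sqrt2V_le1.
apply: ler_pM.
- by rewrite addr_ge0 ?divr_ge0 ?sqr_ge0 ?(ltW k0).
- by rewrite mulr_ge0 ?expR_ge0 ?sqr_ge0.
- by rewrite lerD2l ler_wpM2r ?invr_ge0 ?(ltW k0)// lerXn2r ?nnegrE.
rewrite max_r ?oppr_ge0 ?(ltW z0)// -ltr0_norm//.
set q := expR (kap * `|z|); have q0 : 0 < q by exact: expR_gt0.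
have -> : x ^+ 4 = `|x| ^+ 4 by rewrite -normrX ger0_norm.
apply: (@le_trans _ _ (eps * `|z| + eps ^- 2 * (`|z| ^+ 4 * q ^+ 3))); last first.
  rewrite lerD2l ler_wpM2l ?invr_ge0 ?sqr_ge0//; apply: ler_pM.
  - exact: exprn_ge0.
  - by rewrite exprn_ge0 ?ltW.
  - by rewrite lerXn2r ?nnegrE.
  by rewrite -expRM_natl ler_expR -mulrA ler_wpM2l// ler_wpM2l// ltW.
have w0 : 0 <= `|z| * q by rewrite mulr_ge0// ltW.
have -> : q * `|z| ^+ 2 = `|z| * (`|z| * q) by ring.
have -> : eps * `|z| + eps ^- 2 * (`|z| ^+ 4 * q ^+ 3) = `|z| * (eps + eps ^- 2 * (`|z| * q) ^+ 3) by ring.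
apply: ler_wpM2l => //; move: (`|z| * q) w0 => w w0.
have [we|we] := leP w eps.
  apply: le_trans we _; rewrite lerDl mulr_ge0 ?exprn_ge0//.
  by rewrite invr_ge0 exprn_ge0// ltW.
rewrite -[leLHS]add0r lerD ?(ltW e0)// mulrC ler_pdivlMr ?exprn_gt0// exprS ler_wpM2l//.
by rewrite ler_pM ?(ltW e0)// ltW.
Qed.

Lemma gauss_robin_error kap k h M y : 0 < kap -> 0 < h -> h <= 1 -> 0 <= k -> k <= M ->
  `|(\int[gauss h]_x robin kap k (y + r * x)) - expR (- (k ^+ 2 * h / 4)) * robin kap k y| <=
  cos_const M / kap * h ^+ 2.
Proof.
move=> k0 h0 h1 kk kM.
have kr0 : 0 <= k * r by rewrite mulr_ge0// sqrt2V_ge0.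
have krM : k * r <= M by apply: le_trans kM; rewrite ler_piMr// sqrt2V_le1.
have b2 := gauss_cos h0 h1 kr0 krM.
have kE : (k * r) ^+ 2 * h / 2 = k ^+ 2 * h / 4 by rewrite exprMn sqrt2V_sqr; lra.
rewrite kE in b2.
rewrite (gauss_robin kap k y h0) [expR _ * _]mulrC -mulrBr normrM.
have -> : cos_const M / kap * h ^+ 2 = kap^-1 * (cos_const M * h ^+ 2) by rewrite mulrAC mulrC.
by apply: ler_pM => //; exact: robin_abs_le.
Qed.

Lemma refl_step_robin kap k h M eps y : 0 < kap -> 0 < h -> h <= 1 -> 0 <= k -> k <= M -> 0 < eps ->
  0 <= y ->
  `|refl_step kap h (robin kap k) y - expR (- (k ^+ 2 * h / 4)) * robin kap k y| <=
  robin_scale kap M * eps * undershoot h y + robin_error kap M eps * h ^+ 2.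
Proof.
move=> k0 h0 h1 kk kM e0 y0; have gr := half_bounded_robin k k0; have k0' := ltW k0.
have M0 : 0 <= M by exact: le_trans kM.
have s0 : 0 <= robin_scale kap M by rewrite addr_ge0 ?divr_ge0 ?sqr_ge0.
have i1 := integrable_refl y h0 k0' gr.
have i2 : (gauss h).-integrable setT (EFin \o (fun x => robin kap k (y + r * x))).
  apply: (@integrable_gauss_bounded h _ kap^-1); last by move=> x; exact: robin_abs_le.
  by apply: measurableT_comp; [exact: gr.1|exact: measurable_shift].
have iB : (gauss h).-integrable setT (EFin \o (fun x =>
    refl kap (robin kap k) (y + r * x) - robin kap k (y + r * x))).
  exact: eq_integrable (integrableB measurableT i1 i2).
have iu := integrable_undershoot y h0.
have [i4 E4] := @gauss_pow4 _ h (3 * kap) h0 h1 (mulr_ge0 (ler0n R 3) k0').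
have iu' : (gauss h).-integrable setT (EFin \o (fun x => eps * Num.max 0 (- (y + r * x)))).
  exact: eq_integrable (integrableZl measurableT eps iu).
have i4' : (gauss h).-integrable setT (EFin \o (fun x => eps ^- 2 * (x ^+ 4 * expR (3 * kap * `|x|)))).
  exact: eq_integrable (integrableZl measurableT (eps ^- 2) i4).
have iD : (gauss h).-integrable setT (EFin \o (fun x =>
    eps * Num.max 0 (- (y + r * x)) + eps ^- 2 * (x ^+ 4 * expR (3 * kap * `|x|)))).
  exact: eq_integrable (integrableD measurableT iu' i4').
have iC : (gauss h).-integrable setT (EFin \o (fun x => robin_scale kap M *
    (eps * Num.max 0 (- (y + r * x)) + eps ^- 2 * (x ^+ 4 * expR (3 * kap * `|x|))))).
  exact: eq_integrable (integrableZl measurableT (robin_scale kap M) iD).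
have b1 : `|refl_step kap h (robin kap k) y - \int[gauss h]_x robin kap k (y + r * x)| <=
    robin_scale kap M * eps * undershoot h y +
    robin_scale kap M * (512 * expR ((3 * kap + 1) ^+ 2 / 2) / eps ^+ 2) * h ^+ 2.
  rewrite /refl_step -(RintegralB measurableT i1 i2); apply: le_trans (le_normr_Rintegral measurableT iB) _.
  apply: le_trans (le_Rintegral measurableT (integrable_norm iB) iC _) _.
    by move=> x _; exact: refl_robin_defect.
  rewrite (RintegralZl _ measurableT iD) (RintegralD measurableT iu' i4').
  rewrite (RintegralZl _ measurableT iu) (RintegralZl _ measurableT i4) mulrDr mulrA lerD2l.
  by rewrite -[leRHS]mulrA ler_wpM2l// [leLHS]mulrC mulrAC ler_wpM2r// invr_ge0 sqr_ge0.
have b3 := gauss_robin_error y k0 h0 h1 kk kM.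
have -> : refl_step kap h (robin kap k) y - expR (- (k ^+ 2 * h / 4)) * robin kap k y =
   (refl_step kap h (robin kap k) y - \int[gauss h]_x robin kap k (y + r * x)) +
   (\int[gauss h]_x robin kap k (y + r * x) - expR (- (k ^+ 2 * h / 4)) * robin kap k y).
  by rewrite addrA subrK.
apply: le_trans (ler_normD _ _) _; apply: le_trans (lerD b1 b3) _.
by rewrite /robin_error -addrA -mulrDl.
Qed.

End step_on_eigenfunctions.

(** * Superpositions of the bound state and of the Robin continuum *)

Section spectral_representation.
Context {R : realType}.
Notation mu := (@lebesgue_measure R).
Notation oray := (`]0, +oo[%classic : set (measurableTypeR R)).
Implicit Types (x y z h k kap a B C M t V : R) (w : R -> R).
Local Notation r := ((Num.sqrt 2)^-1 : R).

Let moray : measurable oray. Proof. by []. Qed.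

Definition robin_weight kap v : R := (Num.sqrt (kap ^+ 2 + v))^-1.

(** Weaker than integrability: the initial weight b / (alpha^2 + v) decays only like 1 / v and
    becomes integrable after multiplication by the decay of the Robin functions. *)
Definition admissible kap w := measurable_fun setT w /\
  mu.-integrable oray (EFin \o (fun v => w v * robin_weight kap v)).

(** The Robin heat semigroup at time [t] applied to the function with bound-state coefficient [B]
    and spectral weight [w], in the variable v = k^2. *)
Definition spectral_fun kap B w t y : R :=
  B * expR (kap ^+ 2 * t / 4) * expR (- (kap * y)) +
  \int[mu]_(v in oray) (w v * expR (- (v * t / 4)) * robin kap (Num.sqrt v) y).

Lemma robin_weight_ge0 kap v : 0 <= robin_weight kap v.
Proof. by rewrite invr_ge0 sqrtr_ge0. Qed.

Lemma orayP v : v \in oray -> 0 < v.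
Proof. by rewrite inE/= in_itv/= andbT. Qed.

Lemma expR_decay v t : 0 <= t -> 0 < v -> expR (- (v * t / 4)) <= 1.
Proof. by move=> t0 v0; rewrite -expR0 ler_expR oppr_le0 divr_ge0// mulr_ge0// ltW. Qed.

Lemma measurable_decay t : measurable_fun setT (fun v : R => expR (- (v * t / 4))).
Proof. by apply: measurableT_comp => //; apply: measurableT_comp => //; apply: measurable_funM => //; exact: measurable_funM. Qed.

Lemma measurable_sqrt : measurable_fun setT (@Num.sqrt R).
Proof. by apply: continuous_measurable_fun; exact: sqrt_continuous. Qed.

Lemma spectral_term_le kap w t y v : 0 < kap -> 0 <= t -> 0 < v ->
  `|w v * expR (- (v * t / 4)) * robin kap (Num.sqrt v) y| <= `|w v * robin_weight kap v|.
Proof.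
move=> k0 t0 v0; rewrite (normrM (_ * _)) !(normrM (w v)).
rewrite (ger0_norm (robin_weight_ge0 _ _)) (ger0_norm (expR_ge0 _)) -mulrA ler_wpM2l//.
apply: le_trans (robin_sqrt_le y k0 (ltW v0)).
by rewrite ler_piMl// expR_decay.
Qed.

Lemma measurable_spectral_term kap w t y : 0 < kap -> measurable_fun setT w ->
  measurable_fun setT (fun v => w v * expR (- (v * t / 4)) * robin kap (Num.sqrt v) y).
Proof.
move=> k0 mw; apply: measurable_funM.
  by apply: measurable_funM => //; exact: measurable_decay.
by apply: measurable_robin => //; exact: measurable_sqrt.
Qed.

Lemma integrable_spectral_term kap w t y : 0 < kap -> 0 <= t -> admissible kap w ->
  mu.-integrable oray (EFin \o (fun v => w v * expR (- (v * t / 4)) * robin kap (Num.sqrt v) y)).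
Proof.
move=> k0 t0 [mw iw].
have mt := measurable_spectral_term t y k0 mw.
apply: (@integrable_le _ (measurableTypeR R) R mu oray moray _
  (fun v => `|w v * robin_weight kap v|) (measurable_funTS mt)).
  by move=> v /mem_set /orayP v0; exact: spectral_term_le.
exact: eq_integrable (integrable_norm iw).
Qed.

Lemma admissibleB kap w w' : admissible kap w -> admissible kap w' -> admissible kap (w \- w').
Proof.
move=> [mw iw] [mw' iw']; split; first exact: measurable_funB.
by apply: eq_integrable (integrableB moray iw iw') => // v _; rewrite /= mulrBl.
Qed.

(** The bound depends neither on [t] nor on [y], so that one cutoff serves all grid times. *)
Lemma spectral_fun_le kap w w' B t y : 0 < kap -> 0 <= t -> admissible kap w -> admissible kap w' ->
  `|spectral_fun kap B w t y - spectral_fun kap B w' t y| <=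
  \int[mu]_(v in oray) `|(w \- w') v * robin_weight kap v|.
Proof.
move=> k0 t0 aw aw'; have i1 := integrable_spectral_term y k0 t0 aw.
have i2 := integrable_spectral_term y k0 t0 aw'.
have aB := admissibleB aw aw'; have i3 := integrable_spectral_term y k0 t0 aB.
rewrite /spectral_fun opprD addrACA subrr add0r -(RintegralB moray i1 i2).
rewrite (_ : (fun x => _) = (fun v => (w \- w') v * expR (- (v * t / 4)) * robin kap (Num.sqrt v) y)); last first.
  by apply/funext => v /=; rewrite !mulrBl.
apply: le_trans (le_normr_Rintegral moray i3) _.
apply: (le_Rintegral moray (integrable_norm i3) (integrable_norm aB.2)).
by move=> v /mem_set /orayP v0; exact: spectral_term_le.
Qed.

Lemma half_bounded_spectral_fun kap B w t : 0 < kap -> 0 <= t -> admissible kap w ->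
  half_bounded (spectral_fun kap B w t).
Proof.
move=> k0 t0 aw; have [mw iw] := aw; split.
  apply: measurable_funD.
    apply: measurable_funM => //; apply: measurableT_comp => //; exact: measurableT_comp.
  pose F (z : measurableTypeR R * measurableTypeR R) :=
    w z.2 * expR (- (z.2 * t / 4)) * robin kap (Num.sqrt z.2) z.1.
  suff mF : measurable_fun setT F by exact: (measurable_Rintegral2 mu moray mF).
  apply: measurable_funM.
    apply: measurable_funM; first exact: measurableT_comp.
    by apply: (measurableT_comp (measurable_decay t)); exact: measurable_snd.
  apply: measurable_robin => //.
  by apply: (measurableT_comp measurable_sqrt); exact: measurable_snd.
exists (`|B * expR (kap ^+ 2 * t / 4)| + \int[mu]_(v in oray) `|w v * robin_weight kap v|).
  by rewrite addr_ge0//; apply: Rintegral_ge0.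
move=> y y0; apply: le_trans (ler_normD _ _) _; apply: lerD.
  rewrite normrM ler_piMr// ger0_norm ?expR_ge0// -expR0 ler_expR oppr_le0 mulr_ge0//.
  exact: ltW.
have i1 := integrable_spectral_term y k0 t0 aw.
apply: le_trans (le_normr_Rintegral moray i1) _.
apply: (le_Rintegral moray (integrable_norm i1) (integrable_norm iw)).
by move=> v /mem_set /orayP v0; exact: spectral_term_le.
Qed.

End spectral_representation.

Section step_on_spectral_functions.
Context {R : realType}.
Notation mu := (@lebesgue_measure R).
Notation oray := (`]0, +oo[%classic : set (measurableTypeR R)).
Implicit Types (x y z h k kap a B C M t V eps : R) (w : R -> R).
Local Notation r := ((Num.sqrt 2)^-1 : R).

Let moray : measurable oray. Proof. by []. Qed.

Lemma half_bounded_bound_state kap : 0 < kap -> half_bounded (fun y => expR (- (kap * y))).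
Proof.
move=> k0; split.
  by apply: measurableT_comp => //; apply: measurableT_comp => //; exact: measurable_funM.
exists 1 => // y y0; rewrite ger0_norm ?expR_ge0// -expR0 ler_expR oppr_le0 mulr_ge0//.
exact: ltW.
Qed.

Lemma refl_spectral_fun kap B w t z : 0 < kap -> 0 <= t -> admissible kap w ->
  refl kap (spectral_fun kap B w t) z =
  B * expR (kap ^+ 2 * t / 4) * refl kap (fun y => expR (- (kap * y))) z +
  \int[mu]_(v in oray) (w v * expR (- (v * t / 4)) * refl kap (robin kap (Num.sqrt v)) z).
Proof.
move=> k0 t0 aw; rewrite /refl; case: ifP => // _.
rewrite /spectral_fun mulrDr; congr (_ + _); first by rewrite mulrCA mulrA.
rewrite -(RintegralZl _ moray (integrable_spectral_term 0 k0 t0 aw)).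
by apply: eq_Rintegral => v _; rewrite mulrCA.
Qed.

(** Interchange of the Gaussian and the spectral integral under the majorant kap^(-1) e^(kap |z|) |w
    v|; integrability of [w] is what the cutoff provides. *)
Lemma refl_step_spectral_fun kap h B w t y : 0 < kap -> 0 < h -> 0 <= t -> admissible kap w ->
  mu.-integrable oray (EFin \o w) ->
  refl_step kap h (spectral_fun kap B w t) y =
  B * expR (kap ^+ 2 * t / 4) * refl_step kap h (fun y => expR (- (kap * y))) y +
  \int[mu]_(v in oray) (w v * expR (- (v * t / 4)) * refl_step kap h (robin kap (Num.sqrt v)) y).
Proof.
move=> k0 h0 t0 aw iw; have k0' := ltW k0; have [mw _] := aw.
have ib := integrable_refl y h0 k0' (half_bounded_bound_state k0).
pose c1 := B * expR (kap ^+ 2 * t / 4).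
have ib' : (gauss h).-integrable setT (EFin \o (fun x => c1 * refl kap (fun y => expR (- (kap * y))) (y + r * x))).
  exact: eq_integrable (integrableZl measurableT c1 ib).
pose F (z : measurableTypeR R * measurableTypeR R) :=
  w z.2 * expR (- (z.2 * t / 4)) * refl kap (robin kap (Num.sqrt z.2)) (y + r * z.1).
have mz : measurable_fun setT (fun z : measurableTypeR R * measurableTypeR R => y + r * z.1).
  by apply: (measurableT_comp (measurable_shift y)); exact: measurable_fst.
have ms : measurable_fun setT (fun z : measurableTypeR R * measurableTypeR R => Num.sqrt z.2).
  by apply: (measurableT_comp measurable_sqrt); exact: measurable_snd.
have mF : measurable_fun setT F.
  apply: measurable_funM.
    apply: measurable_funM; first exact: measurableT_comp.
    by apply: (measurableT_comp (measurable_decay t)); exact: measurable_snd.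
  apply: measurable_fun_ifT; [exact: measurable_fun_ltr| |exact: measurable_robin].
  apply: measurable_funM; last exact: measurable_robin.
  by apply: measurableT_comp => //; apply: measurableT_comp => //; exact: measurable_funM.
pose g x := kap^-1 * expR (kap * `|y|) * expR (kap * `|x|).
have ig : (gauss h).-integrable setT (EFin \o g).
  by have [i _] := gauss_exp_norm kap h0; exact: eq_integrable (integrableZl measurableT _ i).
have ih : mu.-integrable oray (EFin \o (fun v => `|w v|)).
  exact: eq_integrable (integrable_norm iw).
have Fgh x v : setT x -> oray v -> `|F (x, v)| <= g x * `|w v|.
  move=> _ /mem_set /orayP v0; rewrite /F /g /= (normrM (_ * _)) (normrM (w v)) -mulrA mulrC.
  rewrite ler_wpM2r//; apply: (@le_trans _ _ (1 * (kap^-1 * expR (kap * `|y + r * x|)))).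
    apply: ler_pM => //; first by rewrite ger0_norm ?expR_ge0// expR_decay.
    apply: refl_le => //; first by rewrite invr_ge0.
    by move=> u _; apply: robin_sqrt_le_inv => //; exact: ltW.
  by rewrite mul1r -mulrA ler_wpM2l ?invr_ge0// expR_shift.
have [iFx EF] := @Rfubini_le _ _ (measurableTypeR R) (measurableTypeR R) R (gauss h) mu setT oray
   measurableT moray F g (fun v => `|w v|) mF ig ih Fgh.
transitivity (\int[gauss h]_x (c1 * refl kap (fun y => expR (- (kap * y))) (y + r * x) +
    \int[mu]_(v in oray) F (x, v))).
  by apply: eq_Rintegral => x _; exact: refl_spectral_fun.
rewrite (RintegralD measurableT ib' iFx) (RintegralZl c1 measurableT ib) EF; congr (_ + _).
apply: eq_Rintegral => v /orayP v0.
by rewrite /F /= (RintegralZl _ measurableT (integrable_refl y h0 k0' (half_bounded_robin _ k0))).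
Qed.

(** The bound state cancels exactly. A weight supported in v <= M^2 involves only frequencies up to
    [M], for which the error of a single Robin function is uniform. *)
Lemma refl_step_spectral_error kap h B w t M eps y : 0 < kap -> 0 < h -> h <= 1 -> 0 <= t -> 0 <= M ->
  0 < eps -> admissible kap w -> mu.-integrable oray (EFin \o w) ->
  (forall v, M ^+ 2 < v -> w v = 0) -> 0 <= y ->
  `|refl_step kap h (spectral_fun kap B w t) y - spectral_fun kap B w (t + h) y| <=
  \int[mu]_(v in oray) `|w v| *
    (robin_scale kap M * eps * undershoot h y + robin_error kap M eps * h ^+ 2).
Proof.
move=> k0 h0 h1 t0 M0 e0 aw iw wM y0; have k0' := ltW k0; have [mw _] := aw.
rewrite refl_step_spectral_fun// refl_step_bound_state//.
set K := robin_scale _ _ * _ * _ + _.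
have E1 : B * expR (kap ^+ 2 * t / 4) * (expR (kap ^+ 2 * h / 4) * expR (- (kap * y))) =
    B * expR (kap ^+ 2 * (t + h) / 4) * expR (- (kap * y)).
  by rewrite mulrA -(mulrA B) -expRD; congr (_ * expR _ * _); ring.
rewrite /spectral_fun E1 opprD addrACA subrr add0r.
have th0 : 0 <= t + h by rewrite addr_ge0// ltW.
have i2 := integrable_spectral_term y k0 th0 aw.
have sB v : 0 < v -> `|refl_step kap h (robin kap (Num.sqrt v)) y| <= kap^-1 * (growth kap h * 2).
  move=> v0; apply: (@le_trans _ _ (kap^-1 * (growth kap h * lyapunov kap y - kap * undershoot h y))).
    apply: refl_step_le_lyapunov => //; [exact: half_bounded_robin|by rewrite invr_ge0|].
    move=> u u0; apply: le_trans (robin_sqrt_le_inv _ k0 (ltW v0)) _.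
    by rewrite ler_peMr ?invr_ge0// lyapunov_ge1.
  rewrite ler_wpM2l ?invr_ge0//; apply: (@le_trans _ _ (growth kap h * lyapunov kap y)).
    by rewrite gerDl oppr_le0 mulr_ge0 ?undershoot_ge0.
  by rewrite ler_wpM2l ?lyapunov_le2//; exact: le_trans ler01 (growth_ge1 _ h0).
have ms : measurable_fun setT (fun v : R => refl_step kap h (robin kap (Num.sqrt v)) y).
  pose F (z : measurableTypeR R * measurableTypeR R) := refl kap (robin kap (Num.sqrt z.1)) (y + r * z.2).
  suff mF : measurable_fun setT F by exact: (measurable_Rintegral2 (gauss h) measurableT mF).
  have mz : measurable_fun setT (fun z : measurableTypeR R * measurableTypeR R => y + r * z.2).
    by apply: (measurableT_comp (measurable_shift y)); exact: measurable_snd.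
  have ms : measurable_fun setT (fun z : measurableTypeR R * measurableTypeR R => Num.sqrt z.1).
    by apply: (measurableT_comp measurable_sqrt); exact: measurable_fst.
  apply: measurable_fun_ifT; [exact: measurable_fun_ltr| |exact: measurable_robin].
  apply: measurable_funM; last exact: measurable_robin.
  by apply: measurableT_comp => //; apply: measurableT_comp => //; exact: measurable_funM.
have nw : mu.-integrable oray (EFin \o (fun v => `|w v|)).
  exact: eq_integrable (integrable_norm iw).
have i1 : mu.-integrable oray (EFin \o (fun v => w v * expR (- (v * t / 4)) * refl_step kap h (robin kap (Num.sqrt v)) y)).
  have i3 : mu.-integrable oray (EFin \o (fun v => kap^-1 * (growth kap h * 2) * `|w v|)).
    exact: eq_integrable (integrableZl moray (kap^-1 * (growth kap h * 2)) nw).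
  have m3 : measurable_fun setT (fun v => w v * expR (- (v * t / 4)) * refl_step kap h (robin kap (Num.sqrt v)) y).
    by apply: measurable_funM => //; apply: measurable_funM => //; exact: measurable_decay.
  apply: (@integrable_le _ (measurableTypeR R) R mu oray moray _ _ (measurable_funTS m3) _ i3).
  move=> v /mem_set /orayP v0; rewrite (normrM (_ * _)) (normrM (w v)) mulrC.
  apply: ler_pM; [exact: normr_ge0|by rewrite mulr_ge0|exact: sB|].
  by rewrite ler_piMr// ger0_norm ?expR_ge0// expR_decay.
rewrite -(RintegralB moray i1 i2).
have iB : mu.-integrable oray (EFin \o (fun v => w v * expR (- (v * t / 4)) * refl_step kap h (robin kap (Num.sqrt v)) y -
    w v * expR (- (v * (t + h) / 4)) * robin kap (Num.sqrt v) y)).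
  exact: eq_integrable (integrableB moray i1 i2).
apply: le_trans (le_normr_Rintegral moray iB) _.
have iK : mu.-integrable oray (EFin \o (fun v => `|w v| * K)).
  exact: eq_integrable (integrableZr moray K nw).
rewrite -(RintegralZr K moray nw); apply: (le_Rintegral moray (integrable_norm iB) iK).
move=> v /mem_set /orayP v0 /=.
have [vM|vM] := leP v (M ^+ 2); last by rewrite (wM v vM) !mul0r subrr normr0 mul0r.
have -> : w v * expR (- (v * t / 4)) * refl_step kap h (robin kap (Num.sqrt v)) y -
    w v * expR (- (v * (t + h) / 4)) * robin kap (Num.sqrt v) y =
  w v * (expR (- (v * t / 4)) * (refl_step kap h (robin kap (Num.sqrt v)) y -
    expR (- (v * h / 4)) * robin kap (Num.sqrt v) y)).
  have -> : - (v * (t + h) / 4) = - (v * t / 4) + - (v * h / 4) by ring.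
  by rewrite expRD; ring.
rewrite normrM ler_wpM2l// normrM (ger0_norm (expR_ge0 _)).
have sM : Num.sqrt v <= M by rewrite -(ger0_norm M0) -sqrtr_sqr ler_sqrt// sqr_ge0.
have := refl_step_robin k0 h0 h1 (sqrtr_ge0 v) sM e0 y0; rewrite sqr_sqrtr ?(ltW v0)// -/K => le.
apply: le_trans le; rewrite ler_piMl// expR_decay//.
Qed.

End step_on_spectral_functions.

(** * Mesh limit over one interval *)

Section convergence.
Context {R : realType}.
Notation mu := (@lebesgue_measure R).
Notation oray := (`]0, +oo[%classic : set (measurableTypeR R)).
Implicit Types (x y z h k kap a B C M t V eps e : R) (w : R -> R).

Let moray : measurable oray. Proof. by []. Qed.

Definition truncate V w v : R := if v <= V then w v else 0.

Lemma measurable_truncate V w : measurable_fun setT w -> measurable_fun setT (truncate V w).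
Proof. by move=> mw; apply: measurable_fun_ifT => //; exact: measurable_fun_ler. Qed.

Lemma measurable_robin_weight kap : 0 < kap -> measurable_fun oray (robin_weight kap).
Proof.
move=> k0; apply: (@eq_measurable_fun _ _ _ _ oray (fun v => Num.sqrt ((kap ^+ 2 + Num.max 0 v)^-1))).
  move=> v /orayP v0; rewrite /robin_weight max_r ?(ltW v0)// sqrtrV//.
  by rewrite addr_ge0 ?sqr_ge0// ltW.
apply: measurable_funTS; apply: (measurableT_comp measurable_sqrt).
apply: (@measurableT_comp _ _ _ _ _ _ (fun k => (kap ^+ 2 + Num.max 0 k)^-1) _ id) => //.
apply: continuous_measurable_fun => k; apply: cvgV.
  by rewrite gt_eqF// ltr_pwDl ?exprn_gt0// le_max lexx.
by apply: cvgD; [exact: cvg_cst|apply: continuous_max; [exact: cvg_cst|exact: cvg_id]].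
Qed.

Lemma admissible_truncate kap V w : 0 < kap -> admissible kap w -> admissible kap (truncate V w).
Proof.
move=> k0 [mw iw]; have mt := measurable_truncate V mw; split => //.
have m1 : measurable_fun oray (fun v => truncate V w v * robin_weight kap v).
  by apply: measurable_funM; [exact: measurable_funTS|exact: measurable_robin_weight].
apply: (@integrable_le _ (measurableTypeR R) R mu oray moray _ (fun v => `|w v * robin_weight kap v|) m1).
  by move=> v _; rewrite /truncate; case: ifP => // _; rewrite mul0r normr0.
exact: eq_integrable (integrable_norm iw).
Qed.

Lemma integrable_truncate kap V w : 0 < kap -> 0 <= V -> admissible kap w ->
  mu.-integrable oray (EFin \o truncate V w).
Proof.
move=> k0 V0 [mw iw]; have mt := measurable_truncate V mw.
have in1 : mu.-integrable oray (EFin \o (fun v => `|w v * robin_weight kap v|)).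
  exact: eq_integrable (integrable_norm iw).
have in2 : mu.-integrable oray (EFin \o (fun v => Num.sqrt (kap ^+ 2 + V) * `|w v * robin_weight kap v|)).
  exact: eq_integrable (integrableZl moray _ in1).
apply: (@integrable_le _ (measurableTypeR R) R mu oray moray _ _ (measurable_funTS mt) _ in2).
move=> v /mem_set /orayP v0; rewrite /truncate; case: ifP => vV; last first.
  by rewrite normr0 mulr_ge0// sqrtr_ge0.
rewrite normrM (ger0_norm (robin_weight_ge0 _ _)) mulrCA ler_peMr//.
have d0 : 0 < kap ^+ 2 + v by rewrite addr_gt0// exprn_gt0.
have dV : 0 <= kap ^+ 2 + V by rewrite addr_ge0// sqr_ge0.
by rewrite ler_pdivlMr ?sqrtr_gt0// mul1r ler_sqrt// lerD2l.
Qed.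

Lemma truncate_error_cvg kap w : 0 < kap -> admissible kap w ->
  \int[mu]_(v in oray) `|(w \- truncate (n%:R ^+ 2) w) v * robin_weight kap v| @[n --> \oo] --> (0 : R).
Proof.
move=> k0 aw; have [mw iw] := aw.
rewrite [X in _ --> X](_ : 0 = \int[mu]_(v in oray) (cst 0 : measurableTypeR R -> R) v); last first.
  by rewrite Rintegral_cst// mul0r.
apply: (@dominated_cvg_Rintegral _ (measurableTypeR R) R mu oray moray _ _ (fun v => `|w v * robin_weight kap v|)).
- move=> n; apply: measurableT_comp => //; apply: measurable_funM; last exact: measurable_robin_weight.
  by apply: measurable_funTS; apply: measurable_funB => //; exact: measurable_truncate.
- exact: measurable_cst.
- exact: eq_integrable (integrable_norm iw).
- move=> n v _; rewrite normr_id /= /truncate; case: ifP => _; last by rewrite subr0.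
  by rewrite subrr mul0r normr0.
have nn (n : nat) : n%:R <= n%:R ^+ 2 :> R.
  by rewrite -natrX ler_nat; case: n => // n; rewrite -[leqLHS]expn1 leq_pexp2l.
move=> v _; apply/cvg_ballP => e e0; near=> n.
rewrite /ball/= /truncate ifT; first by rewrite subrr mul0r normr0 subr0 normr0.
have nv : v <= n%:R by near: n; exact: nbhs_infty_ger.
exact: le_trans nv (nn n).
Unshelve. all: by end_near. Qed.

(** The total growth over an interval does not depend on the number of steps. *)
Lemma growth_exp kap t n : growth kap (t / n.+1%:R) ^+ n.+1 = expR (9 * kap ^+ 2 * t / 4).
Proof.
have : n.+1%:R != 0 :> R by rewrite pnatr_eq0.
by rewrite -expRM_natl => n0; congr expR; move: n0; move: (n.+1%:R) => N n0; field.
Qed.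

Lemma robin_error_ge0 kap M eps : 0 < kap -> 0 <= M -> 0 <= robin_error kap M eps.
Proof.
move=> k0 M0; rewrite /robin_error /cos_const /robin_scale.
have := ler0n R 1024; have := ler0n R 512; move: (1024%:R) (512%:R) => N1 N2 N20 N10.
apply: addr_ge0.
  apply: mulr_ge0; first by rewrite addr_ge0 ?divr_ge0 ?sqr_ge0 ?(ltW k0).
  by rewrite divr_ge0 ?sqr_ge0// mulr_ge0// expR_ge0.
rewrite divr_ge0 ?(ltW k0)//; apply: addr_ge0.
  by rewrite !mulr_ge0 ?expR_ge0 ?exprn_ge0.
by apply: mulr_ge0; [rewrite mulr_ge0 ?expR_ge0|exact: sqr_ge0].
Qed.

(** Four errors of size [d], amplified by the growth [g] and a Lyapunov value at most 2, and one
    more [d] for undoing the cutoff. *)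
Lemma error_budget (g d b c L : R) : 0 <= g -> 0 <= d -> 0 <= b -> b <= d -> 0 <= c -> c <= d ->
  0 <= L -> L <= 2 -> g * (d + d + b + c) * L + d <= (1 + 8 * g) * d.
Proof.
move=> g0 d0 b0 bd c0 cd L0 L2.
have -> : (1 + 8 * g) * d = g * (d + d + d + d) * 2 + d by ring.
have D : d + d + b + c <= d + d + d + d by lra.
rewrite lerD2r; apply: ler_pM => //; last exact: ler_wpM2l.
by apply: mulr_ge0 => //; rewrite !addr_ge0.
Qed.

(** The initial function may vary with the mesh and need only converge uniformly, because on all
    intervals but the last it is itself the outcome of an iteration. *)
Lemma iter_step_cvg kap t B w (G : nat -> R -> R) : 0 < kap -> 0 < t -> admissible kap w ->
  (forall n, half_bounded (G n)) ->
  (forall e, 0 < e -> \forall n \near \oo,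
     forall y, 0 <= y -> `|G n y - spectral_fun kap B w 0 y| <= e) ->
  forall e, 0 < e -> \forall n \near \oo, forall y, 0 <= y ->
    `|iter n.+1 (refl_step kap (t / n.+1%:R)) (G n) y - spectral_fun kap B w t y| <= e.
Proof.
move=> k0 t0 aw gG GF e e0; set g := expR (9 * kap ^+ 2 * t / 4).
have g0 : 0 < g by exact: expR_gt0.
have g8 : 0 < 1 + 8 * g by rewrite addr_gt0// mulr_gt0.
pose d := e / (1 + 8 * g); have d0 : 0 < d by rewrite divr_gt0.
(* The cutoff sqrt v <= m is fixed before [eps] and [n], whose choices depend on it. *)
have /cvgr0Pnorm_le/(_ _ d0)[m _ /(_ m (leqnn m)) tm] := truncate_error_cvg k0 aw.
set w' := truncate (m%:R ^+ 2) w in tm.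
have aw' := admissible_truncate (m%:R ^+ 2) k0 aw : admissible kap w'.
have iw' := integrable_truncate k0 (sqr_ge0 m%:R) aw : mu.-integrable oray (EFin \o w').
have {}tm s y : 0 <= s -> `|spectral_fun kap B w s y - spectral_fun kap B w' s y| <= d.
  move=> s0; apply: le_trans (spectral_fun_le B y k0 s0 aw aw') _.
  by apply: le_trans tm; exact: ler_norm.
pose A := \int[mu]_(v in oray) `|w' v|; have A0 : 0 <= A by exact: Rintegral_ge0.
pose S := robin_scale kap m%:R; have S0 : 0 <= S.
  by rewrite addr_ge0 ?divr_ge0 ?sqr_ge0 ?(ltW k0).
have AS1 : 0 < A * S + 1 by rewrite ltr_wpDl// mulr_ge0.
(* Chosen so that b / kap = A S eps / kap is at most [d]; the summand 1 keeps the denominator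
   positive when A vanishes. *)
pose eps := d * kap / (A * S + 1); have eps0 : 0 < eps by rewrite divr_gt0// mulr_gt0.
pose b := A * (S * eps); have b0 : 0 <= b := mulr_ge0 A0 (mulr_ge0 S0 (ltW eps0)).
have bd : b / kap <= d.
  rewrite ler_pdivrMr// /b mulrA /eps mulrCA ler_piMr//; first by rewrite mulr_ge0 ?(ltW d0) ?(ltW k0).
  by rewrite ler_pdivrMr// mul1r lerDl.
pose E := robin_error kap m%:R eps.
have E0 : 0 <= E by exact: robin_error_ge0.
near=> n => y y0.
have n0 : 0 < n.+1%:R :> R by rewrite ltr0n.
set h := t / n.+1%:R; have h0 : 0 < h by rewrite divr_gt0.
have h1 : h <= 1.
  rewrite ler_pdivrMr// mul1r; apply: (@le_trans _ _ n%:R); last by rewrite ler_nat.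
  by near: n; exact: nbhs_infty_ger.
have GFn : forall y, 0 <= y -> `|G n y - spectral_fun kap B w 0 y| <= d.
  by near: n; exact: GF.
have nE : n.+1%:R * (A * E * h ^+ 2) <= d.
  have -> : n.+1%:R * (A * E * h ^+ 2) = A * E * t ^+ 2 / n.+1%:R.
    have nz : n.+1%:R != 0 :> R by rewrite pnatr_eq0.
    by rewrite /h; move: (n.+1%:R) nz (A * E) => N nz X; field.
  rewrite ler_pdivrMr// -ler_pdivrMl//; apply: (@le_trans _ _ n%:R); last by rewrite ler_nat.
  by near: n; exact: nbhs_infty_ger.
pose F (i : nat) := spectral_fun kap B w' (i%:R * h).
have ih0 i : 0 <= i%:R * h by rewrite mulr_ge0// ltW.
have gF i : half_bounded (F i) by exact: half_bounded_spectral_fun.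
have FF i z : 0 <= z -> `|refl_step kap h (F i) z - F i.+1 z| <= b * undershoot h z + A * E * h ^+ 2.
  move=> z0; rewrite /F (_ : i.+1%:R * h = i%:R * h + h); last by rewrite -natr1 mulrDl mul1r.
  apply: le_trans (refl_step_spectral_error (M := m%:R) B k0 h0 h1 (ih0 i) _ eps0 aw' iw' _ z0) _ => //.
    by move=> v vm; rewrite /w' /truncate leNgt vm.
  by rewrite -/A -/S -/E /b mulrDr !mulrA.
have G0 z : 0 <= z -> `|G n z - F 0%N z| <= d + d.
  move=> z0; rewrite /F mul0r.
  rewrite (_ : _ - _ = (G n z - spectral_fun kap B w 0 z) + (spectral_fun kap B w 0 z - spectral_fun kap B w' 0 z)); last by rewrite addrA subrK.
  by apply: le_trans (ler_normD _ _) _; apply: lerD; [exact: GFn|exact: tm].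
have AE0 : 0 <= A * E * h ^+ 2 by rewrite !mulr_ge0// ?sqr_ge0 ?ltW.
have dd0 : 0 <= d + d by rewrite addr_ge0// ltW.
have := @iter_step_error _ kap h (G n) F b (A * E * h ^+ 2) (d + d) n.+1 k0 h0 b0 AE0 dd0 (gG n) gF FF G0 y y0.
have htE : n.+1%:R * h = t by rewrite /h mulrCA divff ?mulr1// gt_eqF.
have FnE : F n.+1 y = spectral_fun kap B w' t y by rewrite /F htE.
rewrite growth_exp -/g FnE.
set I := iter _ _ _ _ => bI.
rewrite (_ : I - _ = (I - spectral_fun kap B w' t y) - (spectral_fun kap B w t y - spectral_fun kap B w' t y)); last first.
  by rewrite opprB addrA subrK.
apply: le_trans (ler_normB _ _) _; apply: le_trans (lerD bI (tm _ y (ltW t0))) _.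
have eE : e = (1 + 8 * g) * d by rewrite /d mulrCA divff ?mulr1// gt_eqF.
have bk0 : 0 <= b / kap := divr_ge0 b0 (ltW k0).
have nE0 : 0 <= n.+1%:R * (A * E * h ^+ 2) := mulr_ge0 (ltW n0) AE0.
have L0 : 0 <= lyapunov kap y := le_trans ler01 (lyapunov_ge1 _ _).
rewrite [leRHS]eE.
exact: error_budget (ltW g0) (ltW d0) bk0 bd nE0 nE L0 (lyapunov_le2 (ltW k0) y0).
Unshelve. all: by end_near. Qed.

End convergence.

(** * Recursion over the intervals *)

Section spectral_shift.
Context {R : realType}.
Notation mu := (@lebesgue_measure R).
Notation oray := (`]0, +oo[%classic : set (measurableTypeR R)).
Notation ray := (`[0, +oo[%classic : set (measurableTypeR R)).
Implicit Types (x y z h k kap a al c B C M t V eps e u v : R) (w : R -> R).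

Let moray : measurable oray. Proof. by []. Qed.

Lemma measurable_inv : measurable_fun setT (@GRing.inv R).
Proof.
rewrite -(setvU [set 0]); apply/measurable_funU => //; first exact: measurableC.
split; last exact: measurable_fun_set1.
apply: open_continuous_measurable_fun; first by apply: closed_openC; exact: (accessible_closed_set1 (hausdorff_accessible (@norm_hausdorff _ _))).
by move=> x; rewrite inE/= => /eqP x0; exact: inv_continuous.
Qed.

Definition damped_weight t w v : R := w v * expR (- (v * t / 4)).

Definition shift_weight c t w u : R :=
  \int[mu]_(v in oray) (pkern c u v * damped_weight t w v).

(** The bound-state coefficient in [robin_pkern]: the share of the Robin function of rate kap - c
    and frequency sqrt v that multiplication by e^(- c y) sends into the bound state of rate
    [kap]. *)
Definition capture kap c v : R :=
  4 * kap * c * Num.sqrt v / (((kap - c) ^+ 2 + v) * ((kap + c) ^+ 2 + v)).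

Lemma measurable_pkern c : measurable_fun setT
  (fun z : measurableTypeR R * measurableTypeR R => pkern c z.1 z.2).
Proof.
have m1 : measurable_fun setT (fun z : measurableTypeR R * measurableTypeR R => z.1) by exact: measurable_fst.
have m2 : measurable_fun setT (fun z : measurableTypeR R * measurableTypeR R => z.2) by exact: measurable_snd.
apply: measurable_funM.
  by apply: measurable_funM => //; exact: (measurableT_comp measurable_sqrt m2).
apply: (measurableT_comp measurable_inv); apply: measurable_funM => //.
apply: measurable_funD; last by apply: measurable_funX; exact: measurable_funB.
apply: measurable_funD => //; apply: measurable_funM => //; apply: measurable_funM => //.
exact: measurable_funD.
Qed.

Lemma measurable_capture kap c : measurable_fun setT (capture kap c).
Proof.
apply: measurable_funM; first by apply: measurable_funM => //; exact: measurable_sqrt.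
apply: (measurableT_comp measurable_inv); apply: measurable_funM; exact: measurable_funD.
Qed.

(** For t > 0 the exponential makes up for the missing sqrt(kap^2 + v): the constant [K] comes from
    sqrt s <= s + 1 and v e^(- v t / 4) <= 4 / t. *)
Lemma integrable_damped_weight kap t w : 0 < kap -> 0 < t -> admissible kap w ->
  mu.-integrable oray (EFin \o damped_weight t w).
Proof.
move=> k0 t0 [mw iw].
have mt : measurable_fun setT (damped_weight t w).
  by apply: measurable_funM => //; exact: measurable_decay.
pose K := kap ^+ 2 + 1 + 4 / t.
have in1 : mu.-integrable oray (EFin \o (fun v => K * `|w v * robin_weight kap v|)).
  exact: eq_integrable (integrableZl moray K (integrable_norm iw)).
apply: (@integrable_le _ (measurableTypeR R) R mu oray moray _ _ (measurable_funTS mt) _ in1).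
move=> v /mem_set /orayP v0; rewrite /damped_weight !normrM (ger0_norm (robin_weight_ge0 _ _)).
rewrite mulrCA ler_wpM2l// ger0_norm ?expR_ge0//.
have d0 : 0 < kap ^+ 2 + v by rewrite addr_gt0// exprn_gt0.
rewrite ler_pdivlMr ?sqrtr_gt0//.
have s1 : Num.sqrt (kap ^+ 2 + v) <= kap ^+ 2 + v + 1.
  rewrite -(ler_sqr (x := Num.sqrt _)) ?nnegrE ?sqrtr_ge0//; last by rewrite addr_ge0// ltW.
  rewrite sqr_sqrtr ?(ltW d0)//; move: (kap ^+ 2 + v) d0 => s s0.
  by rewrite -subr_ge0 (_ : _ - _ = s ^+ 2 + s + 1); [rewrite !addr_ge0 ?sqr_ge0 ?ltW|ring].
have e1 : expR (- (v * t / 4)) <= 1 by rewrite expR_decay// ltW.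
have ve : v * expR (- (v * t / 4)) <= 4 / t.
  have p := expR_ge1Dx (v * t / 4).
  rewrite expRN ler_pdivrMr ?expR_gt0//; apply: (@le_trans _ _ (4 / t * (v * t / 4))).
    by rewrite le_eqVlt; apply/orP; left; apply/eqP; field; rewrite gt_eqF.
  by rewrite ler_wpM2l ?divr_ge0 ?(ltW t0)//; apply: le_trans p; rewrite lerDr.
apply: (@le_trans _ _ (expR (- (v * t / 4)) * (kap ^+ 2 + v + 1))).
  by rewrite ler_wpM2l ?expR_ge0.
rewrite /K; have -> : expR (- (v * t / 4)) * (kap ^+ 2 + v + 1) =
  (kap ^+ 2 + 1) * expR (- (v * t / 4)) + v * expR (- (v * t / 4)) by ring.
by apply: lerD => //; rewrite ler_piMr// addr_ge0// sqr_ge0.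
Qed.

Lemma admissible_of_integrable kap w : 0 < kap -> measurable_fun setT w ->
  mu.-integrable oray (EFin \o w) -> admissible kap w.
Proof.
move=> k0 mw iw; split => //.
have in1 : mu.-integrable oray (EFin \o (fun v => kap^-1 * `|w v|)).
  exact: eq_integrable (integrableZl moray kap^-1 (integrable_norm iw)).
have m1 : measurable_fun oray (fun v => w v * robin_weight kap v).
  by apply: measurable_funM; [exact: measurable_funTS|exact: measurable_robin_weight].
apply: (@integrable_le _ (measurableTypeR R) R mu oray moray _ _ m1 _ in1).
move=> v /mem_set /orayP v0; rewrite normrM mulrC (ger0_norm (robin_weight_ge0 _ _)) ler_wpM2r//.
have d0 : 0 < kap ^+ 2 + v by rewrite addr_gt0// exprn_gt0.
rewrite lef_pV2 ?posrE ?sqrtr_gt0// -{1}(ger0_norm (ltW k0)) -sqrtr_sqr.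
by rewrite ler_sqrt ?(ltW d0)// lerDl ltW.
Qed.

(** The denominator exceeds c^4 + c^2 v >= 2 c^3 sqrt v, and 1 / pi <= 1. *)
Lemma pkern_le c u v : 0 < c -> 0 < u -> 0 < v -> pkern c u v <= c ^- 2.
Proof.
move=> c0 u0 v0; have d0 := pkern_den_gt0 c0 (ltW u0) (ltW v0).
rewrite /pkern ler_pdivrMr ?mulr_gt0 ?pi_gt0//.
have q0 := sqrtr_ge0 v; have vE : v = Num.sqrt v ^+ 2 by rewrite sqr_sqrtr// ltW.
set D := c ^+ 4 + _ + _ in d0 *.
have DD : 2 * c ^+ 3 * Num.sqrt v <= D.
  rewrite /D; move: (Num.sqrt v) q0 vE => q q0 ->.
  rewrite -subr_ge0 (_ : _ - _ = c ^+ 2 * (c - q) ^+ 2 + (2 * u + q ^+ 2) * c ^+ 2 + (u - q ^+ 2) ^+ 2); last by ring.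
  rewrite addr_ge0 ?sqr_ge0// addr_ge0//; first by apply: mulr_ge0; exact: sqr_ge0.
  by apply: mulr_ge0; [rewrite addr_ge0 ?sqr_ge0// mulr_ge0// ltW|exact: sqr_ge0].
have D1 : 2 * c * Num.sqrt v <= c ^- 2 * D.
  rewrite [leRHS]mulrC ler_pdivlMr ?exprn_gt0//; apply: le_trans DD.
  by rewrite le_eqVlt; apply/orP; left; apply/eqP; ring.
apply: (le_trans D1); rewrite mulrCA; apply: ler_peMl.
  by rewrite mulr_ge0 ?(ltW d0)// invr_ge0 sqr_ge0.
by apply: le_trans (pi_ge2 R); rewrite ler1n.
Qed.

(** The kernel concentrates near u = v, so absolute convergence is obtained by integrating in [u]
    first, where it has mass at most 1; the pointwise bound on the kernel serves the slices in
    [v]. *)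
Lemma Rfubini_pkern c w (g : R -> R) C : 0 < c -> measurable_fun setT w -> measurable_fun setT g ->
  mu.-integrable oray (EFin \o w) -> 0 <= C -> (forall u, 0 < u -> `|g u| <= C) ->
  mu.-integrable oray (EFin \o (fun u => \int[mu]_(v in oray) (g u * (pkern c u v * w v)))) /\
  \int[mu]_(u in oray) \int[mu]_(v in oray) (g u * (pkern c u v * w v)) =
  \int[mu]_(v in oray) \int[mu]_(u in oray) (g u * (pkern c u v * w v)).
Proof.
move=> c0 mw mg iw C0 gC.
pose F (z : measurableTypeR R * measurableTypeR R) := g z.1 * (pkern c z.1 z.2 * w z.2).
have m1 : measurable_fun setT (fun z : measurableTypeR R * measurableTypeR R => z.1) by exact: measurable_fst.
have m2 : measurable_fun setT (fun z : measurableTypeR R * measurableTypeR R => z.2) by exact: measurable_snd.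
have mF : measurable_fun setT F.
  apply: measurable_funM; first exact: measurableT_comp.
  by apply: measurable_funM; [exact: measurable_pkern|exact: measurableT_comp].
have nw : mu.-integrable oray (EFin \o (fun v => `|w v|)) by exact: eq_integrable (integrable_norm iw).
have p0 u v : oray u -> oray v -> 0 <= pkern c u v.
  by move=> /mem_set/orayP u0 /mem_set/orayP v0; apply: pkern_ge0 => //; exact: ltW.
have FC u v : oray u -> oray v -> `|F (u, v)| <= C * `|w v| * pkern c u v.
  move=> u0 v0; rewrite /F/= (normrM (g u)) (normrM (pkern c u v)) (ger0_norm (p0 _ _ u0 v0)).
  rewrite (mulrC (pkern c u v)) mulrA; apply: ler_wpM2r; first exact: p0.
  by apply: ler_wpM2r => //; apply: gC; apply: orayP; exact: mem_set.
apply: (@Rfubini _ _ (measurableTypeR R) (measurableTypeR R) R mu mu oray oray moray moray F mF).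
- move=> u u0.
  have i2 : mu.-integrable oray (EFin \o (fun v => C * c ^- 2 * `|w v|)).
    exact: eq_integrable (integrableZl moray (C * c ^- 2) nw).
  apply: (@integrable_le _ (measurableTypeR R) R mu oray moray _ _ _ _ i2).
    by apply: measurable_funTS; exact: measurable_fun_pair2.
  move=> v v0; apply: le_trans (FC u v u0 v0) _; rewrite mulrAC ler_wpM2r// ler_wpM2l//.
  by apply: pkern_le => //; apply: orayP; exact: mem_set.
- move=> v v0; have [i _] := pkern_mass c0 (ltW (orayP (mem_set v0))).
  have i2 : mu.-integrable oray (EFin \o (fun u => C * `|w v| * pkern c u v)).
    exact: eq_integrable (integrableZl moray (C * `|w v|) i).
  apply: (@integrable_le _ (measurableTypeR R) R mu oray moray _ _ _ _ i2).
    by apply: measurable_funTS; exact: measurable_fun_pair1.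
  by move=> u u0; exact: FC.
have mnF : measurable_fun setT (fun z : measurableTypeR R * measurableTypeR R => `|F z|%:E).
  by apply/measurable_EFinP; exact: measurableT_comp.
rewrite (tonelli_on mu mu moray moray mnF)//.
have /integrableP[_ woo] : mu.-integrable oray (EFin \o (fun v => C * `|w v|)).
  exact: eq_integrable (integrableZl moray C nw).
apply: le_lt_trans woo; apply: ge0_le_integral => //.
- by move=> v _; apply: integral_ge0 => u _; rewrite lee_fin.
- pose F' (z : measurableTypeR R * measurableTypeR R) := `|F (z.2, z.1)|%:E.
  have mF' : measurable_fun setT F' by apply: (measurableT_comp mnF); exact: measurable_swap.
  by apply: measurable_funTS; apply: (@measurable_integral2 _ _ _ _ _ mu oray moray F' mF') => z; rewrite lee_fin.
- apply: measurable_funTS; apply: measurableT_comp => //; apply/measurable_EFinP.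
  by apply: measurable_funM => //; exact: measurableT_comp.
move=> v v0; have [i b] := pkern_mass c0 (ltW (orayP (mem_set v0))).
have i2 : mu.-integrable oray (EFin \o (fun u => C * `|w v| * pkern c u v)).
  exact: eq_integrable (integrableZl moray (C * `|w v|) i).
apply: (@le_trans _ _ (\int[mu]_(u in oray) (C * `|w v| * pkern c u v)%:E)%E).
  apply: ge0_le_integral => //.
  - by apply: measurable_funTS; exact: (@measurable_fun_pair1 _ _ _ _ _ _ _ _ mnF).
  - exact: measurable_int i2.
  - by move=> u u0; rewrite lee_fin; exact: FC.
rewrite -(EFin_Rintegral moray i2) lee_fin (RintegralZl _ moray i) ger0_norm ?mulr_ge0//.
by rewrite ler_piMr// mulr_ge0.
Qed.

End spectral_shift.

Section spectral_recursion.
Context {R : realType}.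
Notation mu := (@lebesgue_measure R).
Notation oray := (`]0, +oo[%classic : set (measurableTypeR R)).
Notation ray := (`[0, +oo[%classic : set (measurableTypeR R)).
Implicit Types (x y z h k kap a al c B C M t V eps e u v : R) (w : R -> R).

Let moray : measurable oray. Proof. by []. Qed.

Lemma integrable_pkern_weight c u w : 0 < c -> 0 < u -> measurable_fun setT w ->
  mu.-integrable oray (EFin \o w) -> mu.-integrable oray (EFin \o (fun v => pkern c u v * w v)).
Proof.
move=> c0 u0 mw iw.
have i2 : mu.-integrable oray (EFin \o (fun v => c ^- 2 * `|w v|)).
  exact: eq_integrable (integrableZl moray (c ^- 2) (integrable_norm iw)).
have m1 : measurable_fun setT (fun v : R => pkern c u v * w v).
  apply: measurable_funM => //.
  by apply: (measurable_fun_pair2 _ (measurable_pkern c)).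
apply: (@integrable_le _ (measurableTypeR R) R mu oray moray _ _ (measurable_funTS m1) _ i2).
move=> v /mem_set/orayP v0; rewrite normrM ler_wpM2r// ger0_norm; first exact: pkern_le.
by apply: pkern_ge0 => //; exact: ltW.
Qed.

Lemma integrable_capture kap c w : 0 < kap -> 0 < c -> measurable_fun setT w ->
  mu.-integrable oray (EFin \o w) -> mu.-integrable oray (EFin \o (fun v => capture (kap + c) c v * w v)).
Proof.
move=> k0 c0 mw iw.
have K0 : 0 <= 4 * (kap + c) * c by rewrite !mulr_ge0 ?addr_ge0 ?ltW.
have i2 : mu.-integrable oray (EFin \o (fun v => 4 * (kap + c) * c / kap ^+ 3 * `|w v|)).
  exact: eq_integrable (integrableZl moray (4 * (kap + c) * c / kap ^+ 3) (integrable_norm iw)).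
have m1 : measurable_fun setT (fun v => capture (kap + c) c v * w v).
  by apply: measurable_funM => //; exact: measurable_capture.
apply: (@integrable_le _ (measurableTypeR R) R mu oray moray _ _ (measurable_funTS m1) _ i2).
move=> v /mem_set/orayP v0; rewrite normrM ler_wpM2r// /capture addrK.
have s0 : 0 <= Num.sqrt v by exact: sqrtr_ge0.
have vE : v = Num.sqrt v ^+ 2 by rewrite sqr_sqrtr ?ltW.
have d1 : 0 < kap ^+ 2 + v by rewrite addr_gt0// exprn_gt0.
have d2 : 0 < (kap + c + c) ^+ 2 + v by rewrite addr_gt0// exprn_gt0// !addr_gt0.
rewrite ger0_norm; last by apply: divr_ge0; [exact: mulr_ge0|apply: mulr_ge0; exact: ltW].
rewrite -mulrA; apply: ler_wpM2l => //.
rewrite ler_pdivrMr ?mulr_gt0// ler_pdivlMl ?exprn_gt0//.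
have sd1 : kap * Num.sqrt v <= kap ^+ 2 + v.
  move: (Num.sqrt v) s0 vE => s s0 ->.
  have := sqr_ge0 (kap - s); have := mulr_ge0 (ltW k0) s0; rewrite sqrrB; lra.
have kd2 : kap ^+ 2 <= (kap + c + c) ^+ 2 + v.
  apply: (@le_trans _ _ ((kap + c + c) ^+ 2)); last by rewrite lerDl ltW.
  rewrite lerXn2r ?nnegrE ?(ltW k0) ?addr_ge0 ?ltW//.
  by rewrite -addrA ltrDl addr_gt0.
have -> : kap ^+ 3 * Num.sqrt v = (kap * Num.sqrt v) * kap ^+ 2 by ring.
by apply: ler_pM => //; rewrite ?sqr_ge0// mulr_ge0// ltW.
Qed.

(** The coupling is triangular: the old bound state grows for time [t] and stays a bound state, and
    the continuum feeds into it but receives nothing. *)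
Definition shift_bound kap c t B w : R :=
  B * expR (kap ^+ 2 * t / 4) + \int[mu]_(v in oray) (capture (kap + c) c v * damped_weight t w v).

Lemma admissible_shift kap c t w : 0 < kap -> 0 < c -> 0 < t -> admissible kap w ->
  mu.-integrable oray (EFin \o shift_weight c t w) /\ admissible (kap + c) (shift_weight c t w).
Proof.
move=> k0 c0 t0 aw; have iw := integrable_damped_weight k0 t0 aw.
have mw : measurable_fun setT (damped_weight t w).
  by apply: measurable_funM; [exact: aw.1|exact: measurable_decay].
have ms : measurable_fun setT (shift_weight c t w).
  pose F (z : measurableTypeR R * measurableTypeR R) := pkern c z.1 z.2 * damped_weight t w z.2.
  suff mF : measurable_fun setT F by exact: (measurable_Rintegral2 mu moray mF).
  apply: measurable_funM; first exact: measurable_pkern.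
  by apply: (measurableT_comp mw); exact: measurable_snd.
have kc0 : 0 < kap + c by exact: addr_gt0.
have g1 (u : R) : 0 < u -> `|(cst 1 : R -> R) u| <= 1 by rewrite normr1.
have [i _] := Rfubini_pkern c0 mw (measurable_cst (1 : R)) iw ler01 g1.
have is_ : mu.-integrable oray (EFin \o shift_weight c t w).
  apply: eq_integrable i => // u _; rewrite /= /shift_weight; congr (_%:E).
  by apply: eq_Rintegral => v _; rewrite mul1r.
by split => //; exact: admissible_of_integrable.
Qed.

(** [robin_pkern] at rate kap + c is integrated against the damped weight. Since the result is again
    a spectral function, taken at time 0 and with rate kap + c, the recursion can continue on the
    preceding interval. *)
Lemma spectral_fun_shift kap c t B w y : 0 < kap -> 0 < c -> 0 < t -> admissible kap w -> 0 <= y ->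
  expR (- (c * y)) * spectral_fun kap B w t y =
  spectral_fun (kap + c) (shift_bound kap c t B w) (shift_weight c t w) 0 y.
Proof.
move=> k0 c0 t0 aw y0; have iw := integrable_damped_weight k0 t0 aw.
have mw : measurable_fun setT (damped_weight t w).
  by apply: measurable_funM; [exact: aw.1|exact: measurable_decay].
have kc0 : 0 < kap + c by exact: addr_gt0.
have ckc : c < kap + c by rewrite ltrDr.
pose g u := robin (kap + c) (Num.sqrt u) y.
have mg : measurable_fun setT g by apply: measurable_robin => //; exact: measurable_sqrt.
have gC u : 0 < u -> `|g u| <= (kap + c)^-1 by move=> u0; apply: robin_sqrt_le_inv => //; exact: ltW.
have C0 : 0 <= (kap + c)^-1 by rewrite invr_ge0 ltW.
have [ig E] := Rfubini_pkern c0 mw mg iw C0 gC.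
rewrite /spectral_fun mulr0 mul0r expR0 mulr1.
have -> : \int[mu]_(v in oray) (shift_weight c t w v * expR (- (v * 0 / 4)) * robin (kap + c) (Num.sqrt v) y) =
    \int[mu]_(u in oray) \int[mu]_(v in oray) (g u * (pkern c u v * damped_weight t w v)).
  apply: eq_Rintegral => u /orayP u0.
  rewrite mulr0 mul0r oppr0 expR0 mulr1 mulrC (RintegralZl _ moray (integrable_pkern_weight c0 u0 mw iw))//.
rewrite {}E.
have ic := integrable_capture k0 c0 mw iw.
have ie : mu.-integrable oray (EFin \o (fun v => capture (kap + c) c v * damped_weight t w v * expR (- ((kap + c) * y)))).
  exact: eq_integrable (integrableZr moray (expR (- ((kap + c) * y))) ic).
have it := integrable_spectral_term y k0 (ltW t0) aw.
have ict : mu.-integrable oray (EFin \o (fun v => expR (- (c * y)) * (w v * expR (- (v * t / 4)) * robin kap (Num.sqrt v) y))).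
  exact: eq_integrable (integrableZl moray (expR (- (c * y))) it).
have -> : \int[mu]_(v in oray) \int[mu]_(u in oray) (g u * (pkern c u v * damped_weight t w v)) =
    \int[mu]_(v in oray) (expR (- (c * y)) * (w v * expR (- (v * t / 4)) * robin kap (Num.sqrt v) y) -
      capture (kap + c) c v * damped_weight t w v * expR (- ((kap + c) * y))).
  apply: eq_Rintegral => v /orayP v0.
  have [ip Ep] := robin_pkern c0 ckc (ltW v0) y0.
  transitivity (\int[mu]_(u in oray) (damped_weight t w v * (pkern c u v * robin (kap + c) (Num.sqrt u) y))).
    by apply: eq_Rintegral => u _; rewrite /g; ring.
  by rewrite (RintegralZl _ moray ip) Ep addrK /damped_weight /capture addrK; ring.
rewrite (RintegralB moray ict ie) (RintegralZr _ moray ic) (RintegralZl _ moray it) /shift_bound.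
set I := \int[mu]_(v in oray) (capture _ _ _ * _).
set J := \int[mu]_(v in oray) (w v * _ * _).
have -> : expR (- ((kap + c) * y)) = expR (- (c * y)) * expR (- (kap * y)).
  by rewrite -expRD; congr expR; ring.
by ring.
Qed.

Lemma measurable_cauchy_weight b al : measurable_fun setT (fun v : R => b / (al ^+ 2 + v)).
Proof.
by apply: measurable_funM => //; apply: (measurableT_comp measurable_inv); exact: measurable_funD.
Qed.

(** After v = k^2 the integrand 2 k / ((al^2 + k^2) sqrt(kap^2 + k^2)) is at most 2 / (al^2 +
    k^2). *)
Lemma admissible_cauchy_weight kap b al : 0 < al -> al < kap ->
  admissible kap (fun v => b / (al ^+ 2 + v)).
Proof.
move=> al0 ak; have k0 : 0 < kap by exact: lt_trans ak.
have mb := measurable_cauchy_weight b al; split => //.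
pose g k := al / (al ^+ 2 + k ^+ 2) * robin_weight kap (k ^+ 2).
have d0 k : 0 < al ^+ 2 + k ^+ 2 by exact: cauchy_den_gt0.
have dk k : 0 < kap ^+ 2 + k ^+ 2 by exact: cauchy_den_gt0.
have cg : continuous g.
  move=> k; apply: cvgM.
    apply: cvgM; first exact: cvg_cst.
    apply: cvgV; first by rewrite gt_eqF.
    by apply: cvgD; [exact: cvg_cst|exact: exprn_continuous].
  apply: cvgV; first by rewrite gt_eqF// sqrtr_gt0.
  apply: (@continuous_comp _ _ _ (fun k => kap ^+ 2 + k ^+ 2) Num.sqrt); last exact: sqrt_continuous.
  by apply: cvgD; [exact: cvg_cst|exact: exprn_continuous].
have mray : measurable ray by [].
have [ic _] := cauchy_ker_ray 0 al0.
have ig : mu.-integrable ray (EFin \o (fun k => 2 * k * g k)).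
  have i2 : mu.-integrable ray (EFin \o (fun x => 2 * cauchy_ker al (x - 0))).
    exact: eq_integrable (integrableZl mray 2 ic).
  have mg : measurable_fun setT (fun k => 2 * k * g k).
    apply: continuous_measurable_fun => k; apply: cvgM; last exact: cg.
    by apply: cvgM; [exact: cvg_cst|exact: cvg_id].
  apply: (@integrable_le _ (measurableTypeR R) R mu ray mray _ _ (measurable_funTS mg) _ i2).
  move=> k /=; rewrite in_itv/= andbT => k0'; rewrite subr0 /cauchy_ker.
  have w0 := robin_weight_ge0 kap (k ^+ 2).
  have q0 : 0 <= al / (al ^+ 2 + k ^+ 2) by rewrite divr_ge0 ?(ltW al0) ?(ltW (d0 k)).
  have g0 : 0 <= g k by exact: mulr_ge0.
  rewrite ger0_norm; last by apply: mulr_ge0 => //; exact: mulr_ge0.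
  rewrite /g -mulrA ler_wpM2l// mulrCA ler_piMr//.
  rewrite ler_pdivrMr ?sqrtr_gt0// mul1r -{1}(ger0_norm k0') -sqrtr_sqr ler_sqrt ?(ltW (dk k))//.
  by rewrite lerDr sqr_ge0.
have [i _] := sqrt_substitution cg ig.
have i3 : mu.-integrable oray (EFin \o (fun u => b / al * g (Num.sqrt u))).
  exact: eq_integrable (integrableZl moray (b / al) i).
apply: eq_integrable i3 => // v /orayP v0; rewrite /= /g sqr_sqrtr ?ltW//; congr (_%:E).
have a0 : al != 0 by rewrite gt_eqF.
by rewrite mulrA; congr (_ * _); rewrite mulrA divfK.
Qed.

(** [robin_resolvent] solved for the exponential: the starting point of the backward recursion, with
    rate [al] strictly below [kap]. *)
Lemma spectral_fun_exp kap al y : 0 < al -> al < kap -> 0 <= y ->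
  expR (- (al * y)) =
  spectral_fun kap (2 * kap / (kap + al)) (fun v => (al - kap) / pi / (al ^+ 2 + v)) 0 y.
Proof.
move=> al0 ak y0; rewrite /spectral_fun mulr0 mul0r expR0 mulr1.
have E := robin_resolvent al0 ak y0.
have k0 : 0 < kap by exact: lt_trans ak.
have -> : \int[mu]_(v in oray) ((al - kap) / pi / (al ^+ 2 + v) * expR (- (v * 0 / 4)) * robin kap (Num.sqrt v) y) =
   (al - kap) / pi * \int[mu]_(u in oray) (robin kap (Num.sqrt u) y / (al ^+ 2 + u)).
  have i : mu.-integrable oray (EFin \o (fun u => robin kap (Num.sqrt u) y / (al ^+ 2 + u))).
    have i1 := integrable_spectral_term y k0 (lexx 0) (admissible_cauchy_weight 1 al0 ak).
    apply: eq_integrable i1 => // v _; rewrite /= mulr0 mul0r oppr0 expR0 mulr1 mul1r.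
    by rewrite mulrC.
  rewrite -(RintegralZl _ moray i); apply: eq_Rintegral => v _.
  by rewrite mulr0 mul0r oppr0 expR0 mulr1; ring.
rewrite E; move: (pi_gt0 R); move: (@pi R) => p p0.
have p1 : p != 0 by rewrite gt_eqF.
have ak1 : al - kap != 0 by rewrite subr_eq0 lt_eqF.
have P1 : (al - kap) / p * (p / (al - kap)) = 1 by rewrite mulrA divfK// divff.
by rewrite (mulrA ((al - kap) / p)) P1 mul1r addrC subrK.
Qed.

End spectral_recursion.

(** * Evolution and multiplication alternating along the intervals *)

Section interval_chain.
Context {R : realType}.
Notation mu := (@lebesgue_measure R).
Notation oray := (`]0, +oo[%classic : set (measurableTypeR R)).
Variables (d : nat) (kap_ c_ D_ : nat -> R).
Hypothesis c_gt0 : forall j, (j < d)%N -> 0 < c_ j.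
Hypothesis D_gt0 : forall j, (j < d)%N -> 0 < D_ j.
Hypothesis kap_0 : c_ 0%N < kap_ 0%N.
Hypothesis kap_S : forall j, (j.+1 < d)%N -> kap_ j.+1 = kap_ j + c_ j.+1.

(* Intervals are indexed backwards in time: j = 0 is the last one. *)
Fixpoint chain_weight b j : R -> R :=
  if j is i.+1 then shift_weight (c_ j) (D_ i) (chain_weight b i)
  else fun v => b / (c_ 0%N ^+ 2 + v).

(** The amplitude that [spectral_fun_exp] gives to the expansion of e^(- c_0 y) at rate kap_0. *)
Definition chain_scale : R := (c_ 0%N - kap_ 0%N) / pi.

Fixpoint chain_bound j : R :=
  if j is i.+1 then shift_bound (kap_ i) (c_ j) (D_ i) (chain_bound i) (chain_weight chain_scale i)
  else 2 * kap_ 0%N / (kap_ 0%N + c_ 0%N).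

(** The discrete function at the right end of interval [j]: the weight at that end is included, the
    evolution over interval [j] itself is still to come. *)
Fixpoint chain_grid n j : R -> R := fun y => expR (- (c_ j * y)) *
  (if j is i.+1 then iter n.+1 (refl_step (kap_ i) (D_ i / n.+1%:R)) (chain_grid n i) y else 1).

Lemma chain_kap_gt0 j : (j < d)%N -> 0 < kap_ j.
Proof.
elim: j => [|j IH] jd; first by apply: lt_trans kap_0; exact: c_gt0.
by rewrite kap_S// addr_gt0 ?c_gt0// IH// ltnW.
Qed.

Lemma admissible_chain b j : (j < d)%N -> admissible (kap_ j) (chain_weight b j).
Proof.
elim: j => [|j IH] jd; first by apply: admissible_cauchy_weight; [exact: c_gt0|exact: kap_0].
have jd' := ltnW jd; rewrite kap_S//.
by have [] := admissible_shift (chain_kap_gt0 jd') (c_gt0 jd) (D_gt0 jd') (IH jd').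
Qed.

Lemma integrable_chain b j : (j < d)%N ->
  mu.-integrable oray (EFin \o damped_weight (D_ j) (chain_weight b j)).
Proof.
by move=> jd; exact: integrable_damped_weight (chain_kap_gt0 jd) (D_gt0 jd) (admissible_chain b jd).
Qed.

(** The amplitude is a parameter because the integrals Phi carry it in front, with an integrand of
    amplitude 1. *)
Lemma chain_weightZ b j v : (j < d)%N -> 0 < v -> chain_weight b j v = b * chain_weight 1 j v.
Proof.
elim: j v => [|j IH] v jd v0; first by rewrite /= mul1r.
have jd' := ltnW jd.
have mw : measurable_fun setT (damped_weight (D_ j) (chain_weight 1 j)).
  by apply: measurable_funM; [exact: (admissible_chain 1 jd').1|exact: measurable_decay].
have i := integrable_pkern_weight (c_gt0 jd) v0 mw (integrable_chain 1 jd').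
have moray : measurable oray by [].
rewrite /= /shift_weight -(RintegralZl b moray i); apply: eq_Rintegral => x /orayP x0.
by rewrite /damped_weight (IH _ jd' x0); ring.
Qed.

Lemma half_bounded_damp (c : R) (f : R -> R) : 0 <= c -> half_bounded f -> half_bounded (fun y => expR (- (c * y)) * f y).
Proof.
move=> c0 [mf [B B0 fB]]; split.
  by apply: measurable_funM => //; apply: measurableT_comp => //; apply: measurableT_comp => //; exact: measurable_funM.
exists B => // y y0; rewrite normrM ger0_norm ?expR_ge0//.
by apply: le_trans (fB y y0); rewrite ler_piMl// -expR0 ler_expR oppr_le0 mulr_ge0.
Qed.

Lemma half_bounded_chain_grid n j : (j < d)%N -> half_bounded (chain_grid n j).
Proof.
elim: j => [|j IH] jd.
  apply: (@half_bounded_damp (c_ 0%N) (cst 1) (ltW (c_gt0 jd))); split; first exact: measurable_cst.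
  by exists 1 => // y y0; rewrite normr1.
have jd' := ltnW jd.
apply: (@half_bounded_damp (c_ j.+1) _ (ltW (c_gt0 jd))); apply: half_bounded_iter_step; [exact: chain_kap_gt0| |exact: IH].
by rewrite divr_gt0// D_gt0.
Qed.

(** At j = 0 the two functions coincide. Each further interval is one use of [iter_step_cvg]
    followed by [spectral_fun_shift]; the factor e^(- c y) <= 1 preserves uniform errors on the
    half-line. *)
Lemma chain_grid_cvg j : (j < d)%N -> forall e : R, 0 < e -> \forall n \near \oo, forall y : R, 0 <= y ->
  `|chain_grid n j y - spectral_fun (kap_ j) (chain_bound j) (chain_weight chain_scale j) 0 y| <= e.
Proof.
elim: j => [|j IH] jd e e0.
  near=> n => y y0; rewrite /= mulr1 -spectral_fun_exp ?c_gt0//.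
  by rewrite subrr normr0 ltW.
have jd' := ltnW jd; have k0 := chain_kap_gt0 jd'; have c0 := c_gt0 jd.
have := iter_step_cvg (B := chain_bound j) k0 (D_gt0 jd') (admissible_chain chain_scale jd')
  (fun n => half_bounded_chain_grid n jd') (IH jd') e0.
apply: filterS => n H y y0; rewrite kap_S//.
rewrite -spectral_fun_shift ?D_gt0//; last exact: admissible_chain.
rewrite [chain_grid _ _]/chain_grid -/chain_grid -mulrBr normrM ger0_norm ?expR_ge0//.
apply: le_trans (H y y0); rewrite ler_piMl// -expR0 ler_expR oppr_le0 mulr_ge0//.
exact: ltW.
Unshelve. all: by end_near. Qed.

(** Taken at height 0, where a path starts relative to its own running minimum. *)
Definition chain_value n j : R := iter n.+1 (refl_step (kap_ j) (D_ j / n.+1%:R)) (chain_grid n j) 0.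

Lemma chain_value_cvg j : (j < d)%N ->
  chain_value n j @[n --> \oo] --> spectral_fun (kap_ j) (chain_bound j) (chain_weight chain_scale j) (D_ j) 0.
Proof.
move=> jd; apply/cvgrPdist_le => e e0.
have := iter_step_cvg (B := chain_bound j) (chain_kap_gt0 jd) (D_gt0 jd) (admissible_chain chain_scale jd)
  (fun n => half_bounded_chain_grid n jd) (chain_grid_cvg jd) e0.
by apply: filterS => n H; rewrite distrC; exact: H.
Qed.

End interval_chain.

(** * Markov recursion for functionals of independent increments *)

Section product_uniqueness.
Local Open Scope ereal_scope.
Context d1 d2 (T1 : measurableType d1) (T2 : measurableType d2) (R : realType).

Lemma finite_measure_prod_unique (m1 m2 : {measure set (T1 * T2) -> \bar R}) : m1 setT < +oo ->
  (forall A B, measurable A -> measurable B -> m1 (A `*` B) = m2 (A `*` B)) ->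
  forall X, measurable X -> m1 X = m2 X.
Proof.
move=> m1oo m12.
pose C : set (set (T1 * T2)) :=
  [set C | exists A, measurable A /\ exists B, measurable B /\ C = A `*` B].
have CI : setI_closed C.
  move=> /= _ _ [X1 [mX1 [X2 [mX2 ->]]]] [Y1 [mY1 [Y2 [mY2 ->]]]].
  rewrite -setXI; exists (X1 `&` Y1); split; first exact: measurableI.
  by exists (X2 `&` Y2); split => //; exact: measurableI.
move=> X mX; apply: (measure_unique C (fun=> setT)) => //.
- rewrite measurable_prod_measurableType //; congr (<<s _ >>).
  rewrite predeqE; split => [[A mA [B mB <-]]|[A [mA [B [mB ->]]]]].
    by exists A; split => //; exists B.
  by exists A => //; exists B.
- by move=> _; exists setT; split => //; exists setT; split => //; rewrite setXTT.
- by rewrite bigcup_const//; exists 0%N.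
- by move=> _ [A [mA [B [mB ->]]]]; exact: m12.
Qed.

End product_uniqueness.

Section markov_recursion.
Local Open Scope ereal_scope.
Context d (T : measurableType d) (R : realType) (W : probability T R).
Context dS (S : measurableType dS) (N : nat).
Variables (X : nat -> T -> measurableTypeR R) (nu : nat -> probability (measurableTypeR R) R).
Variables (phi : nat -> S * measurableTypeR R -> S) (z0 : S).
Hypothesis mX : forall j, measurable_fun setT (X j).
Hypothesis mphi : forall j, measurable_fun setT (phi j).
Hypothesis X_law : forall j B, (j < N)%N -> measurable B -> W (X j @^-1` B) = nu j B.
Hypothesis X_indep : forall B, (forall i, measurable (B i)) ->
  W (\bigcap_(i < N) (X i @^-1` B i)) = \prod_(i < N) W (X i @^-1` B i).

Fixpoint trajectory j w : S :=
  if j is i.+1 then phi i (trajectory i w, X i w) else z0.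

Definition tail_event j (B : nat -> set (measurableTypeR R)) : set T :=
  \bigcap_(i in [set i | (j <= i < N)%N]) (X i @^-1` B i).

Lemma measurable_trajectory j : measurable_fun setT (trajectory j).
Proof.
elim: j => [|j IH]; first exact: measurable_cst.
by apply: (measurableT_comp (mphi j)); exact: measurable_fun_pair.
Qed.

Lemma measurable_joint j : measurable_fun setT (fun w => (trajectory j w, X j w)).
Proof. by apply: measurable_fun_pair => //; exact: measurable_trajectory. Qed.

Lemma measurable_preim d' (S' : measurableType d') (f : T -> S') (B : set S') :
  measurable_fun setT f -> measurable B -> measurable (f @^-1` B).
Proof. by move=> mf mB; rewrite -[X in measurable X]setTI; exact: mf. Qed.

Lemma measurable_tail_event j B : (forall i, measurable (B i)) -> measurable (tail_event j B).
Proof.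
by move=> mB; apply: bigcap_measurableType => i _; exact: measurable_preim.
Qed.

Lemma tail_eventS j B : (j < N)%N -> tail_event j B = X j @^-1` B j `&` tail_event j.+1 B.
Proof.
move=> jN; apply/seteqP; split => [w H|w [H1 H2] i /= /andP[ji iN]].
  split; first by apply: H; rewrite /= leqnn.
  by move=> i /= /andP[ji iN]; apply: H; rewrite /= iN (ltnW ji).
move: ji; rewrite leq_eqVlt => /orP[/eqP <-//|ji].
by apply: H2; rewrite /= ji iN.
Qed.

(** The past up to [j] against the whole block of later variables, not only against X j: this is the
    form that survives induction when only the joint law of the block is given. *)
Definition tail_independent j := forall A B, measurable A -> (forall i, measurable (B i)) ->
  W (trajectory j @^-1` A `&` tail_event j B) =
  W (trajectory j @^-1` A) * \prod_(j <= i < N) W (X i @^-1` B i).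

Lemma eq_tail_event j B B' : (forall i, (j <= i)%N -> B i = B' i) -> tail_event j B = tail_event j B'.
Proof.
by move=> BB; apply: eq_bigcapr => i /= /andP[ji _]; rewrite BB.
Qed.

(** The set [A2] is merged into the family [B] as its member of index [j]. *)
Lemma joint_rectangle j A1 A2 B : (j < N)%N -> tail_independent j -> measurable A1 -> measurable A2 ->
  (forall i, measurable (B i)) ->
  W ((fun w => (trajectory j w, X j w)) @^-1` (A1 `*` A2) `&` tail_event j.+1 B) =
  W (trajectory j @^-1` A1) * (W (X j @^-1` A2) * \prod_(j.+1 <= i < N) W (X i @^-1` B i)).
Proof.
move=> jN ind mA1 mA2 mB; pose B' i := if i == j then A2 else B i.
have mB' i : measurable (B' i) by rewrite /B'; case: ifP.
have -> : (fun w => (trajectory j w, X j w)) @^-1` (A1 `*` A2) `&` tail_event j.+1 B =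
    trajectory j @^-1` A1 `&` tail_event j B'.
  rewrite (tail_eventS _ jN) {1}/B' eqxx (@eq_tail_event j.+1 B' B); last first.
    by move=> i ji; rewrite /B' gtn_eqF.
  by rewrite setIA.
rewrite ind// big_ltn// {1}/B' eqxx; congr (_ * (_ * _)).
by apply: eq_big_nat => i /andP[ji _]; rewrite /B' gtn_eqF.
Qed.

Lemma prod_probability_ge0 j (B : nat -> set (measurableTypeR R)) : 0 <= \prod_(j <= i < N) W (X i @^-1` B i).
Proof. by elim/big_ind : _ => // x y x0 y0; exact: mule_ge0. Qed.

Lemma prod_probability_fin j (B : nat -> set (measurableTypeR R)) : (forall i, measurable (B i)) ->
  \prod_(j <= i < N) W (X i @^-1` B i) \is a fin_num.
Proof.
move=> mB; elim/big_ind : _ => //; first exact: fin_numM.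
by move=> i _; apply: fin_num_measure; exact: measurable_preim.
Qed.

(** For a fixed tail event both sides are finite measures in [C]: the image of W restricted to the
    event, and the joint law scaled by the probability of the event. They agree on rectangles. *)
Lemma joint_tail_independent j B C : (j < N)%N -> tail_independent j -> (forall i, measurable (B i)) ->
  measurable C ->
  W ((fun w => (trajectory j w, X j w)) @^-1` C `&` tail_event j.+1 B) =
  W ((fun w => (trajectory j w, X j w)) @^-1` C) * \prod_(j.+1 <= i < N) W (X i @^-1` B i).
Proof.
move=> jN ind mB mC; set q := \prod_(_ <= i < N) _.
have q0 : (0 <= fine q)%R by apply: fine_ge0; exact: prod_probability_ge0.
have qE : q = (fine q)%:E by rewrite fineK// prod_probability_fin.
have mG := measurable_tail_event j.+1 mB.
pose m1 : {measure set (S * measurableTypeR R) -> \bar R} :=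
  measure_function_pushforward__canonical__measure_function_Measure (mrestr W mG) (measurable_joint j).
pose m0 : {measure set (S * measurableTypeR R) -> \bar R} :=
  measure_function_pushforward__canonical__measure_function_Measure W (measurable_joint j).
pose m2 : {measure set (S * measurableTypeR R) -> \bar R} := mscale (NngNum q0) m0.
have : m1 C = m2 C.
  apply: finite_measure_prod_unique => //.
    rewrite /m1/= /pushforward /mrestr preimage_setT setTI.
    exact: le_lt_trans (probability_le1 W mG) (ltry _).
  move=> A1 A2 mA1 mA2; rewrite /m1/= /pushforward /mrestr joint_rectangle//.
  rewrite /m2/= /mscale/= /m0/= /pushforward -/q -qE.
  have := @joint_rectangle j A1 A2 (fun=> setT) jN ind mA1 mA2 (fun=> measurableT).
  rewrite (_ : tail_event _ _ = setT); last by apply/seteqP; split.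
  rewrite setIT => ->; rewrite big1 ?mule1; last by move=> i _; rewrite preimage_setT probability_setT.
  by rewrite [RHS]muleC muleA.
rewrite /m1/= /pushforward /mrestr /m2/= /mscale/= /m0/= /pushforward => ->.
by rewrite -qE muleC.
Qed.

Lemma trajectory_tail_independent j : (j <= N)%N -> tail_independent j.
Proof.
elim: j => [_|j IH jN] A B mA mB.
  have tE : tail_event 0 B = \bigcap_(i < N) (X i @^-1` B i) by [].
  have [Az|Az] := pselect (A z0).
    rewrite (_ : trajectory 0 @^-1` A = setT); last by apply/seteqP; split.
    by rewrite setTI probability_setT mul1e tE X_indep// big_mkord.
  rewrite (_ : trajectory 0 @^-1` A = set0); last by apply/seteqP; split.
  by rewrite set0I measure0 mul0e.
have := @joint_tail_independent j B (phi j @^-1` A) jN (IH (ltnW jN)) mB _; apply.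
by rewrite -[X in measurable X]setTI; exact: mphi.
Qed.

(** Rectangles with a trivial tail show that the joint law of state and next increment is a product;
    Tonelli then integrates out the increment. *)
Lemma trajectory_step_integral j (F : S * measurableTypeR R -> \bar R) : (j < N)%N ->
  measurable_fun setT F -> (forall z, 0 <= F z) ->
  \int[W]_w F (trajectory j w, X j w) = \int[W]_w \int[nu j]_x F (trajectory j w, x).
Proof.
move=> jN mF F0.
pose Z : {mfun T >-> S} := mfun_Sub (mem_set (measurable_trajectory j)).
pose ZX : {mfun T >-> (S * measurableTypeR R)%type} := mfun_Sub (mem_set (measurable_joint j)).
transitivity (\int[distribution W ZX]_z F z); first by rewrite ge0_integral_distribution.
transitivity (\int[distribution W Z \x nu j]_z F z).
  apply: eq_measure_integral => C mC _; apply/esym.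
  apply: product_measure_unique => // A B mA mB.
  rewrite /distribution /pushforward.
  have := @joint_rectangle j A B (fun=> setT) jN (trajectory_tail_independent (ltnW jN)) mA mB (fun=> measurableT).
  rewrite (_ : tail_event _ _ = setT); last by apply/seteqP; split.
  rewrite setIT big1 ?mule1; last by move=> i _; rewrite preimage_setT probability_setT.
  by rewrite (X_law jN mB).
rewrite fubini_tonelli1//.
rewrite ge0_integral_distribution//; first exact: measurable_fun_fubini_tonelli_F.
by move=> z; apply: integral_ge0.
Qed.

End markov_recursion.

(** * The walk, its running minimum and the telescoped weight *)

Section reflected_chain.
Context d (T : measurableType d) (R : realType) (W : probability T R) (N : nat).
Variables (X : nat -> T -> measurableTypeR R) (h K b : nat -> R).
Hypothesis mX : forall j, measurable_fun setT (X j).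
Hypothesis h_gt0 : forall j, (j < N)%N -> 0 < h j.
Hypothesis K_gt0 : forall j, (j < N)%N -> 0 < K j.
Hypothesis b_ge0 : forall j, (j < N)%N -> 0 <= b j.
Hypothesis K_S : forall j, (j < N)%N -> K j.+1 = K j - b j.
Hypothesis X_law : forall j B, (j < N)%N -> measurable B -> W (X j @^-1` B) = gauss (h j) B.
Hypothesis X_indep : forall B, (forall i, measurable (B i)) ->
  W (\bigcap_(i < N) (X i @^-1` B i)) = (\prod_(i < N) W (X i @^-1` B i))%E.
Local Notation r := ((Num.sqrt 2)^-1 : R).
Local Notation state := (measurableTypeR R * measurableTypeR R)%type.

(** The expected future weight as a function of the height, with [k] steps left from step [j]; the
    recursion runs on [k], while the coefficients depend on [j]. *)
Fixpoint backward j k : R -> R :=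
  if k is i.+1 then refl_step (K j) (h j) (fun y => expR (- (b j * y)) * backward j.+1 i y) else cst 1.

Lemma half_bounded_backward k j : (j + k <= N)%N -> half_bounded (backward j k).
Proof.
elim: k j => [|k IH] j jk; first by split; [exact: measurable_cst|exists 1 => // y _; rewrite normr1].
have jN : (j < N)%N by apply: leq_trans jk; rewrite addnS ltnS leq_addr.
apply: half_bounded_step; [exact: K_gt0|exact: h_gt0|apply: half_bounded_damp; [exact: b_ge0|apply: IH]].
by rewrite addSnnS.
Qed.

Lemma backward_ge0 k j y : (j + k <= N)%N -> 0 <= y -> 0 <= backward j k y.
Proof.
elim: k j y => [|k IH] j y jk y0 //.
have jN : (j < N)%N by apply: leq_trans jk; rewrite addnS ltnS leq_addr.
apply: Rintegral_ge0 => x _; have jk' : (j.+1 + k <= N)%N by rewrite addSnnS.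
rewrite /refl; case: ltP => z0; first by rewrite !mulr_ge0 ?expR_ge0// IH.
by rewrite mulr_ge0 ?expR_ge0// IH.
Qed.

(** The state consists of the accumulated weight and the height above the running minimum. *)
Definition advance j (s : state * measurableTypeR R) : state :=
  let z := s.1.2 + r * s.2 in
  (s.1.1 * (if z < 0 then expR (- (K j * z)) else 1) * expR (- (b j * Num.max 0 z)), Num.max 0 z).

Definition initial_state : state := (1, 0).

Lemma measurable_advance j : measurable_fun setT (advance j).
Proof.
have m1 : measurable_fun setT (fun s : state * measurableTypeR R => s.1.2).
  exact: (measurableT_comp measurable_snd measurable_fst).
have m2 : measurable_fun setT (fun s : state * measurableTypeR R => s.1.1).
  exact: (measurableT_comp measurable_fst measurable_fst).
have m3 : measurable_fun setT (fun s : state * measurableTypeR R => s.2) by exact: measurable_snd.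
have mz : measurable_fun setT (fun s : state * measurableTypeR R => s.1.2 + r * s.2).
  by apply: measurable_funD => //; exact: measurable_funM.
have mm : measurable_fun setT (fun s : state * measurableTypeR R => Num.max 0 (s.1.2 + r * s.2)).
  exact: measurable_maxr.
apply: measurable_fun_pair => //; apply: measurable_funM.
  apply: measurable_funM => //; apply: measurable_fun_ifT => //; first exact: measurable_fun_ltr.
  by apply: measurableT_comp => //; apply: measurableT_comp => //; exact: measurable_funM.
by apply: measurableT_comp => //; apply: measurableT_comp => //; exact: measurable_funM.
Qed.

Local Notation traj := (trajectory X advance initial_state).

Lemma trajectory_ge0 j w : 0 <= (traj j w).1 /\ 0 <= (traj j w).2.
Proof.
elim: j => [|j [IH1 IH2]]; first by split => /=.
split; rewrite /=; last by rewrite le_max lexx.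
by rewrite !mulr_ge0 ?expR_ge0//; case: ifP.
Qed.

Lemma integral_backward_step j k : (j + k.+1)%N = N ->
  (\int[W]_w ((traj j.+1 w).1 * backward j.+1 k (traj j.+1 w).2)%:E =
   \int[W]_w ((traj j w).1 * backward j k.+1 (traj j w).2)%:E)%E.
Proof.
move=> jk; have jN : (j < N)%N by rewrite -jk addnS ltnS leq_addr.
have jk' : (j.+1 + k <= N)%N by rewrite addSnnS jk.
have gb := half_bounded_damp (b_ge0 jN) (half_bounded_backward jk').
pose f y := expR (- (b j * y)) * backward j.+1 k y.
have f0 y : 0 <= y -> 0 <= f y by move=> y0; rewrite mulr_ge0 ?expR_ge0// backward_ge0.
(* Absolute values make [F] nonnegative on the whole state space, as Tonelli requires; along
   trajectories both factors are nonnegative already. *)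
pose F (s : state * measurableTypeR R) := (`|s.1.1| * `|refl (K j) f (s.1.2 + r * s.2)|)%:E.
have m1 : measurable_fun setT (fun s : state * measurableTypeR R => s.1.2).
  exact: (measurableT_comp measurable_snd measurable_fst).
have m2 : measurable_fun setT (fun s : state * measurableTypeR R => s.1.1).
  exact: (measurableT_comp measurable_fst measurable_fst).
have mz : measurable_fun setT (fun s : state * measurableTypeR R => s.1.2 + r * s.2).
  by apply: measurable_funD => //; apply: measurable_funM => //; exact: measurable_snd.
have mF : measurable_fun setT F.
  apply/measurable_EFinP; apply: measurable_funM; apply: measurableT_comp => //.
  by apply: measurableT_comp mz; apply: measurable_refl; exact: gb.1.
have F0 s : (0 <= F s)%E by rewrite lee_fin mulr_ge0.
have refl0 z : 0 <= refl (K j) f z.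
  by rewrite /refl; case: ltP => z0; [rewrite mulr_ge0 ?expR_ge0// f0|exact: f0].
have FE w x : F (traj j w, x) = ((traj j w).1 * refl (K j) f ((traj j w).2 + r * x))%:E.
  by rewrite /F /= ger0_norm ?(trajectory_ge0 j w).1// ger0_norm.
have := @trajectory_step_integral _ T R W _ state N X (fun j => gauss (h j)) advance initial_state
  mX measurable_advance X_law X_indep j F jN mF F0.
under eq_integral do rewrite FE.
under [RHS]eq_integral do under eq_integral do rewrite FE.
move=> E; transitivity (\int[W]_w ((traj j w).1 * refl (K j) f ((traj j w).2 + r * X j w))%:E)%E.
  apply: eq_integral => w _; congr (_%:E); rewrite /= /refl /f -[LHS]mulrA -[LHS]mulrA; congr (_ * _).
  by case: ltP => z0 //; rewrite mul1r.
rewrite {}E; apply: eq_integral => w _.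
have i := integrable_refl (traj j w).2 (h_gt0 jN) (ltW (K_gt0 jN)) gb.
rewrite /= -/f EFinM /refl_step (EFin_Rintegral measurableT i).
rewrite -ge0_integralZl//; last 3 first.
- by apply: (measurable_int _ i).
- by move=> x _; rewrite lee_fin.
- by rewrite lee_fin (trajectory_ge0 j w).1.
Qed.

Lemma integral_trajectory : (\int[W]_w (traj N w).1%:E = (backward 0 N 0)%:E)%E.
Proof.
have H k j : (j + k)%N = N ->
    (\int[W]_w ((traj j w).1 * backward j k (traj j w).2)%:E = \int[W]_w (traj N w).1%:E)%E.
  elim: k j => [|k IH] j jk.
    by rewrite addn0 in jk; rewrite jk; apply: eq_integral => w _; rewrite mulr1.
  by rewrite -integral_backward_step// IH// addSnnS.
rewrite -(H N 0%N)// (_ : (fun w => _) = cst (backward 0 N 0)%:E); last first.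
  by apply/funext => w; rewrite /= mul1r.
rewrite integral_cst//; transitivity ((backward 0 N 0)%:E * 1)%E; last by rewrite mule1.
by congr (_ * _)%E; exact: probability_setT.
Qed.

Definition walk j w : R := r * \sum_(i < j) X i w.

Fixpoint walk_min j w : R := if j is i.+1 then Num.min (walk_min i w) (walk j w) else 0.

(** Summation by parts. The weight of step [j] acts on walk - minimum; its minimum part lowers the
    rate of the minimum from K j to K j - b j = K j.+1, and only values of the walk remain in the
    sum. *)
Lemma trajectoryE j w : (j <= N)%N ->
  traj j w = (expR (- (K j * walk_min j w) + - (\sum_(i < j) b i * walk i.+1 w)) , walk j w - walk_min j w).
Proof.
elim: j => [|j IH] jN.
  by rewrite /= /walk !big_ord0 !mulr0 subr0 subrr oppr0 expR0.
rewrite [LHS]/= (IH (ltnW jN)) /advance /=; set m := walk_min j w; set p := walk j w.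
have pE : p - m + r * X j w = walk j.+1 w - m by rewrite /walk big_ord_recr/= mulrDr addrAC.
rewrite pE; set q := walk j.+1 w.
rewrite big_ord_recr/= -/q K_S//; congr pair.
  rewrite subr_lt0; have [qm|mq] := ltP q m.
    rewrite (_ : Num.max 0 (q - m) = 0); last by rewrite max_l// subr_le0 ltW.
    by rewrite mulr0 oppr0 expR0 mulr1 -expRD; congr expR; ring.
  rewrite (_ : Num.max 0 (q - m) = q - m); last by rewrite max_r// subr_ge0.
  by rewrite mulr1 -expRD; congr expR; ring.
have [qm|mq] := ltP q m.
  by rewrite max_l ?subr_le0 ?ltW// subrr.
by rewrite max_r ?subr_ge0.
Qed.

Lemma integral_walk : (\int[W]_w (expR (- (K N * walk_min N w) - \sum_(i < N) b i * walk i.+1 w))%:E =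
  (backward 0 N 0)%:E)%E.
Proof. by rewrite -integral_trajectory; apply: eq_integral => w _; rewrite trajectoryE. Qed.

End reflected_chain.

(** * Brownian paths on a grid *)

Section paths.
Context {R : realType}.
Implicit Types w : C01 R.
Local Notation I := (`[0%R, 1%R]%classic : set R).

Lemma path_at_val w (p : I01 R) : path_at w (\val p) = (w : path01 R) p.
Proof. by rewrite /path_at valKd. Qed.

Lemma path_at_continuous w : {within I, continuous (path_at w)}.
Proof.
apply/subspace_sigL_continuousP.
rewrite (_ : sigL I (path_at w) = ((w : path01 R) : I01 R -> R)).
  by apply: (@cts_fun (I01 R) R (w : path01 R)).
by apply/funext => p; rewrite /sigL /= -path_at_val.
Qed.

Lemma path_min_attained w : exists2 s, s \in `[0, 1] &
  path_min w = path_at w s /\ forall t, t \in `[0, 1] -> path_at w s <= path_at w t.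
Proof.
have [s sI sm] := EVT_min ler01 (@path_at_continuous w).
have sI' : s \in (`[0, 1]%classic : set R) by rewrite inE.
exists s => //; split => //; apply/eqP; rewrite eq_le; apply/andP; split.
  apply: ge_inf; first by exists (path_at w s) => _ [p _ <-]; rewrite -path_at_val; apply: sm; have := valP p; rewrite inE.
  by exists (exist _ s sI') => //; rewrite -path_at_val.
apply: lb_le_inf; first by exists ((w : path01 R) (I01_zero R)); exists (I01_zero R).
by move=> _ [p _ <-]; rewrite -path_at_val; apply: sm; have := valP p; rewrite inE.
Qed.

Lemma path_min_le w t : t \in `[0, 1] -> path_min w <= path_at w t.
Proof. by have [s _ [-> sm]] := path_min_attained w; exact: sm. Qed.

Lemma path_min_near w (e : R) : 0 < e -> exists s, exists2 dlt, s \in `[0, 1] /\ 0 < dlt &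
  forall t, t \in `[0, 1] -> `|s - t| <= dlt -> path_at w t <= path_min w + e.
Proof.
move=> e0; have [s sI [mE _]] := path_min_attained w.
have /subspace_continuousP/(_ s sI) := @path_at_continuous w.
move=> /cvgrPdist_le/(_ _ e0); rewrite near_withinE => /nbhs_ballP[dl /= dl0 H].
exists s, (dl / 2); first by split => //; rewrite divr_gt0.
move=> t tI st; have := H t; rewrite /ball/= => /(_ _ tI).
have : `|s - t| < dl by apply: le_lt_trans st _; rewrite gtr_pMr// invf_lt1// ltr1n.
move=> -> /(_ isT); rewrite mE ler_distlC => /andP[_].
by [].
Qed.

Lemma measurable_path_at t : measurable_fun setT (fun w => path_at w t).
Proof.
move=> _ B mB; rewrite setTI; apply: sub_sigma_algebra.
by exists (insubd (I01_zero R) t) => //; exists B.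
Qed.

Lemma measurable_increment s t : measurable_fun setT (increment s t : C01 R -> R).
Proof. by apply: measurable_funB; exact: measurable_path_at. Qed.

End paths.

Section grid_chain.
Context {R : realType}.
Variables (d : nat) (cf df : nat -> R) (A : R).
Local Notation r := ((Num.sqrt 2)^-1 : R).

(** A weight placed at a node adds its coefficient to the rate of the minimum on all earlier
    intervals; [A] is the rate that remains after the last node. *)
Definition front_rate i : R := A + \sum_(i <= k < d) cf k.

Definition rev_index (f : nat -> R) j : R := f (d.-1 - j)%N.

Definition grid_rate n j : R := front_rate (j %/ n.+1).
Definition grid_step n j : R := df (j %/ n.+1) / n.+1%:R.
(** Step [j] ends at grid point j + 1, hence the divisibility of [j.+1]: a weight acts only when a
    step arrives at a node. *)
Definition grid_weight n j : R := if (n.+1 %| j.+1)%N then cf (j %/ n.+1) else 0.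

Lemma front_rateS i : (i < d)%N -> front_rate i = front_rate i.+1 + cf i.
Proof. by move=> id; rewrite /front_rate big_ltn//; ring. Qed.

Lemma dvdn_lastE n j : (n.+1 %| j.+1)%N = (j %% n.+1 == n)%N.
Proof.
rewrite {1}(divn_eq j n.+1) -addnS dvdn_addr ?dvdn_mull//.
have := ltn_pmod j (ltn0Sn n); rewrite ltnS leq_eqVlt => /orP[/eqP ->|jn]; first by rewrite dvdnn eqxx.
by rewrite gtnNdvd// ltn_eqF.
Qed.

Lemma grid_rateS n j : (j < d * n.+1)%N -> grid_rate n j.+1 = grid_rate n j - grid_weight n j.
Proof.
move=> jd; have qd : (j %/ n.+1 < d)%N by rewrite ltn_divLR.
rewrite /grid_rate /grid_weight divnS//; case: ifP => _; last by rewrite subr0.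
by rewrite add1n (front_rateS qd) addrK.
Qed.

(** Before the last step of an interval the weight is 0 and the rate and length are constant, so the
    recursion is a plain iterate. The inner induction runs from the right end; its base case is the
    step carrying the weight of the node. *)
Lemma backward_interval n i k : (i < d)%N ->
  backward (grid_step n) (grid_rate n) (grid_weight n) (i * n.+1) (n.+1 + k) =
  iter n.+1 (refl_step (front_rate i) (df i / n.+1%:R))
    (fun y => expR (- (cf i * y)) * backward (grid_step n) (grid_rate n) (grid_weight n) (i.+1 * n.+1) k y).
Proof.
move=> id; suff H : forall m, (m <= n)%N ->
   backward (grid_step n) (grid_rate n) (grid_weight n) (i * n.+1 + (n - m)) (m.+1 + k) =
   iter m.+1 (refl_step (front_rate i) (df i / n.+1%:R))
    (fun y => expR (- (cf i * y)) * backward (grid_step n) (grid_rate n) (grid_weight n) (i.+1 * n.+1) k y).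
  by have := H n (leqnn n); rewrite subnn addn0.
have dq m : ((i * n.+1 + (n - m)) %/ n.+1)%N = i.
  by rewrite divnMDl// divn_small ?addn0// ltnS leq_subr.
have mq m : ((i * n.+1 + (n - m)) %% n.+1)%N = (n - m)%N.
  by rewrite modnMDl modn_small// ltnS leq_subr.
elim=> [_|m IH mn].
  rewrite [LHS]/= /grid_rate /grid_step /grid_weight dvdn_lastE dq mq subn0 eqxx.
  have e : (i * n.+1 + n).+1%N = (i.+1 * n.+1)%N by rewrite -addnS mulSn addnC.
  rewrite e; reflexivity.
rewrite iterS -(IH (ltnW mn)).
transitivity (refl_step (grid_rate n (i * n.+1 + (n - m.+1))) (grid_step n (i * n.+1 + (n - m.+1)))
  (fun y => expR (- (grid_weight n (i * n.+1 + (n - m.+1)) * y)) *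
    backward (grid_step n) (grid_rate n) (grid_weight n) (i * n.+1 + (n - m.+1)).+1 (m.+1 + k) y)).
  by rewrite addSn.
rewrite /grid_rate /grid_step /grid_weight dvdn_lastE dq mq.
rewrite ltn_eqF; last by rewrite ltn_subrL/= (leq_ltn_trans _ mn).
have -> : (i * n.+1 + (n - m.+1)).+1%N = (i * n.+1 + (n - m))%N by rewrite -addnS subnSK.
by congr (refl_step _ _ _); apply/funext => y; rewrite mul0r oppr0 expR0 mul1r.
Qed.

Lemma backward_chain n j : (j < d)%N ->
  backward (grid_step n) (grid_rate n) (grid_weight n) ((d.-1 - j) * n.+1) (j.+1 * n.+1) =
  iter n.+1 (refl_step (rev_index front_rate j) (rev_index df j / n.+1%:R))
    (chain_grid (rev_index front_rate) (rev_index cf) (rev_index df) n j).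
Proof.
elim: j => [|j +] jd.
  have id : (d.-1 < d)%N by rewrite prednK.
  have := backward_interval n 0 id; rewrite addn0 mul1n subn0 => ->.
  apply: (congr2 (iter n.+1)); first by rewrite /rev_index subn0.
  by apply/funext => y; rewrite /chain_grid /rev_index subn0.
have d0 : (0 < d)%N by exact: leq_ltn_trans jd.
have id : (d.-1 - j.+1 < d)%N by apply: leq_ltn_trans (leq_subr _ _) _; rewrite prednK.
have iE : (d.-1 - j.+1).+1%N = (d.-1 - j)%N by rewrite subnSK// -ltnS prednK//; exact: jd.
have := backward_interval n (j.+1 * n.+1) id; rewrite -mulSn => -> IH.
apply: (congr2 (iter n.+1)); first reflexivity.
apply/funext => y; rewrite iE (IH (ltnW jd)); reflexivity.
Qed.

End grid_chain.

(** * From the grid to the continuous path *)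

Section brownian_grid.
Context {R : realType} (W : probability (C01 R) R).
Hypothesis W_Bm : is_standard_Bm W.
Variables (d : nat) (x_ cf : nat -> R) (A : R).
Hypothesis d_gt0 : (0 < d)%N.
Hypothesis x_0 : x_ 0%N = 0.
Hypothesis x_incr : forall k, (k < d)%N -> x_ k < x_ k.+1.
Hypothesis x_d : x_ d = 1.
Hypothesis cf_gt0 : forall k, (k < d)%N -> 0 < cf k.
Hypothesis A_gt0 : 0 < A.
Implicit Types (n j k : nat) (w : C01 R).
Local Notation r := ((Num.sqrt 2)^-1 : R).

Definition lengths k : R := x_ k.+1 - x_ k.

Definition grid_time n j : R := x_ (j %/ n.+1)%N + (j %% n.+1)%:R * grid_step lengths n j.

Lemma grid_timeS n j : grid_time n j.+1 = grid_time n j + grid_step lengths n j.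
Proof.
rewrite /grid_time /grid_step divnS// modnS; have [jn|jn] := boolP (n.+1 %| j.+1)%N.
  move: jn; rewrite dvdn_lastE => /eqP ->; rewrite mul0r addr0 add1n -addrA -[X in _ + (_ + X)]mul1r.
  rewrite -mulrDl natr1 mulrCA divff ?pnatr_eq0// mulr1 /lengths; ring.
by rewrite add0n -natr1; ring.
Qed.

Lemma grid_time_mul n k : grid_time n (k * n.+1) = x_ k.
Proof. by rewrite /grid_time mulnK// modnMl mul0r addr0. Qed.

Lemma grid_step_gt0 n j : (j < d * n.+1)%N -> 0 < grid_step lengths n j.
Proof.
by move=> jd; rewrite divr_gt0// subr_gt0 x_incr// ltn_divLR.
Qed.

Lemma grid_time_le n i j : (i <= j)%N -> (j <= d * n.+1)%N -> grid_time n i <= grid_time n j.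
Proof.
move=> ij jd; elim: j ij jd => [|j IH]; first by rewrite leqn0 => /eqP ->.
rewrite leq_eqVlt => /orP[/eqP -> //|ij] jd.
by rewrite grid_timeS (le_trans (IH ij (ltnW jd)))// lerDl ltW// grid_step_gt0.
Qed.

Lemma grid_time0 n : grid_time n 0 = 0.
Proof. by rewrite -(mul0n n.+1) grid_time_mul. Qed.

Lemma grid_time_in n j : (j <= d * n.+1)%N -> 0 <= grid_time n j <= 1.
Proof.
move=> jd; rewrite -{1}(grid_time0 n) -x_d -(grid_time_mul n d).
by rewrite !grid_time_le.
Qed.

Definition grid_increment n j : C01 R -> measurableTypeR R := increment (grid_time n j) (grid_time n j.+1).

Lemma walk_increment n j w :
  walk (grid_increment n) j w = r * (path_at w (grid_time n j) - path_at w 0).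
Proof.
congr (_ * _); elim: j => [|j IH]; first by rewrite big_ord0 grid_time0 subrr.
by rewrite big_ord_recr/= IH /grid_increment /increment addrC subrKA.
Qed.

Lemma front_rate_gt0 i : 0 < front_rate d cf A i.
Proof.
rewrite ltr_pwDl// big_nat_cond sumr_ge0// => k; rewrite andbT => /andP[_ kd].
exact/ltW/cf_gt0.
Qed.

(** Increments from time 0 are used because the walk starts at 0 for every path, while
    [path_at w 0 = 0] holds only almost surely. *)
Definition endpoint_sum w : R := \sum_(i < d) cf i * (r * (path_at w (x_ i.+1) - path_at w 0)).

Lemma grid_weight_sum n k (g : nat -> R) :
  \sum_(i < k * n.+1) grid_weight cf n i * g i.+1 = \sum_(i < k) cf i * g (i.+1 * n.+1)%N.
Proof.
elim: k => [|k IH]; first by rewrite mul0n !big_ord0.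
rewrite [RHS]big_ord_recr/= -IH -!(big_mkord xpredT (fun i => grid_weight cf n i * g i.+1)).
rewrite (@big_cat_nat _ _ _ (k * n.+1)%N)//=; last by rewrite leq_mul2r leqnSn orbT.
congr (_ + _); rewrite -{1}[(k * n.+1)%N]add0n big_addn mulSn addnK big_nat_recr//=.
rewrite big_nat_cond big1 ?add0r.
  rewrite /grid_weight dvdn_lastE addnC modnMDl modn_small// eqxx divnMDl// divn_small// addn0.
  by rewrite -addnS addnC.
move=> i; rewrite andbT => /andP[_ ilt].
rewrite /grid_weight dvdn_lastE addnC modnMDl modn_small ?ltn_eqF ?mul0r//.
exact: ltnW.
Qed.

Definition grid_min n w : R := walk_min (grid_increment n) (d * n.+1) w.

(** Grid increments of Brownian motion satisfy the hypotheses of the abstract chain; at the final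
    index no weight is left ahead, so the rate of the minimum there is [A]. *)
Lemma grid_expectation n :
  (\int[W]_w (expR (- (A * grid_min n w) - endpoint_sum w))%:E =
   (chain_value (rev_index d (front_rate d cf A)) (rev_index d cf) (rev_index d lengths) n d.-1)%:E)%E.
Proof.
have tn : grid_time n (d * n.+1) = 1 by rewrite grid_time_mul.
have [_ lawW indW] := W_Bm.
have := @integral_walk _ (C01 R) R W (d * n.+1)%N (grid_increment n) (grid_step lengths n)
  (grid_rate d cf A n) (grid_weight cf n).
move=> /(_ (fun j => measurable_increment _ _) (@grid_step_gt0 n)).
move=> /(_ (fun j _ => front_rate_gt0 _)).
have b0 j : (j < d * n.+1)%N -> 0 <= grid_weight cf n j.
  by move=> jd; rewrite /grid_weight; case: ifP => // _; rewrite ltW// cf_gt0// ltn_divLR.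
move=> /(_ b0 (@grid_rateS R d cf A n)).
have Xlaw j B : (j < d * n.+1)%N -> measurable B ->
    W (grid_increment n j @^-1` B) = gauss (grid_step lengths n j) B.
  move=> jd mB; have /andP[t0 _] := grid_time_in (ltnW jd); have /andP[_ t1] := grid_time_in jd.
  have tt : grid_time n j < grid_time n j.+1 by rewrite grid_timeS ltrDl grid_step_gt0.
  rewrite (lawW _ _ t0 tt t1 B mB) /gauss (grid_timeS n j) addrAC subrr add0r.
  reflexivity.
move=> /(_ Xlaw).
have Xind B : (forall i, measurable (B i)) ->
    W (\bigcap_(i < d * n.+1) (grid_increment n i @^-1` B i)) =
    (\prod_(i < d * n.+1) W (grid_increment n i @^-1` B i))%E.
  move=> mB; apply: (indW (d * n.+1)%N (grid_time n) B) => //.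
  - by rewrite grid_time0.
  - by move=> i id; rewrite grid_timeS ltrDl grid_step_gt0.
  - by rewrite tn.
move=> /(_ Xind) E.
have -> : chain_value (rev_index d (front_rate d cf A)) (rev_index d cf) (rev_index d lengths) n d.-1 =
    backward (grid_step lengths n) (grid_rate d cf A n) (grid_weight cf n) 0 (d * n.+1) 0.
  have dd : (d.-1 < d)%N by rewrite prednK.
  have := backward_chain cf lengths A n dd; rewrite subnn mul0n prednK// => ->.
  reflexivity.
have EA : grid_rate d cf A n (d * n.+1) = A.
  by rewrite /grid_rate mulnK// /front_rate big_geq// addr0.
have ES w : \sum_(i < d * n.+1) grid_weight cf n i * walk (grid_increment n) i.+1 w = endpoint_sum w.
  rewrite (grid_weight_sum n d (fun j => walk (grid_increment n) j w)).
  by apply: eq_bigr => i _; rewrite walk_increment grid_time_mul.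
by rewrite -E; apply: eq_integral => w _; rewrite EA ES.
Qed.

Lemma walk_min_le (X : nat -> C01 R -> measurableTypeR R) i j w : (i <= j)%N -> walk_min X j w <= walk X i w.
Proof.
elim: j => [|j IH]; first by rewrite leqn0 => /eqP ->; rewrite /walk big_ord0 mulr0.
rewrite leq_eqVlt => /orP[/eqP ->|ij]; first by rewrite /= ge_min lexx orbT.
by rewrite /= ge_min IH.
Qed.

Lemma walk_min_ge (X : nat -> C01 R -> measurableTypeR R) j w c :
  (forall i, (i <= j)%N -> c <= walk X i w) -> c <= walk_min X j w.
Proof.
elim: j => [|j IH] H; first by have := H 0%N (leqnn 0); rewrite /walk big_ord0 mulr0.
by rewrite /= le_min IH ?H// => i ij; apply: H; exact: leqW.
Qed.

Lemma lengths_le1 k : (k < d)%N -> lengths k <= 1.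
Proof.
move=> kd; have kd1 : (k * 1 <= d * 1)%N by rewrite !muln1 ltnW.
have /andP[x0 _] := grid_time_in kd1; have kd2 : (k.+1 * 1 <= d * 1)%N by rewrite !muln1.
have /andP[_ x1] := grid_time_in kd2.
rewrite !grid_time_mul in x0 x1; rewrite /lengths; lra.
Qed.

(** Each interval has length at most 1 and is cut into n + 1 cells, whence the uniform mesh 1/(n +
    1). *)
Lemma grid_cover n s : s \in `[0, 1] -> exists2 j, (j <= d * n.+1)%N & `|s - grid_time n j| <= n.+1%:R^-1.
Proof.
rewrite in_itv/= => /andP[s0 s1].
suff H J : (J <= d * n.+1)%N -> s <= grid_time n J ->
    exists2 j, (j <= d * n.+1)%N & grid_time n j <= s <= grid_time n j + n.+1%:R^-1.
  have [|j jd /andP[l u]] := H (d * n.+1)%N (leqnn _); first by rewrite grid_time_mul x_d.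
  by exists j => //; rewrite ger0_norm ?subr_ge0// lerBlDl.
elim: J => [_|J IH Jd sJ].
  by rewrite grid_time0 => s0'; exists 0%N => //; rewrite grid_time0 s0 add0r (le_trans s0').
have [sJ'|sJ'] := leP s (grid_time n J); first exact: IH (ltnW Jd) sJ'.
exists J; first exact: ltnW.
rewrite (ltW sJ')/=; apply: (le_trans sJ); rewrite grid_timeS lerD2l /grid_step.
have n0 : 0 <= n.+1%:R^-1 :> R by rewrite invr_ge0.
by rewrite -[leRHS]mul1r; apply: ler_wpM2r => //; apply: lengths_le1; rewrite ltn_divLR.
Qed.

Lemma grid_min_ge n w : r * (path_min w - path_at w 0) <= grid_min n w.
Proof.
apply: walk_min_ge => i id; rewrite walk_increment; apply: ler_wpM2l; first exact: sqrt2V_ge0.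
by rewrite lerD2r; apply: path_min_le; rewrite in_itv/=; exact: grid_time_in.
Qed.

Lemma grid_min_cvg w : grid_min n w @[n --> \oo] --> r * (path_min w - path_at w 0).
Proof.
apply/cvgrPdist_le => e e0; have [s [dl [sI dl0] H]] := path_min_near w e0.
near=> n; rewrite distrC ger0_norm; last by rewrite subr_ge0 grid_min_ge.
have [j jd sj] := grid_cover n sI.
have sd : `|s - grid_time n j| <= dl.
  apply: (le_trans sj); rewrite invf_ple ?posrE ?ltr0n//; apply: (@le_trans _ _ n%:R); last by rewrite ler_nat.
  by near: n; exact: nbhs_infty_ger.
have tI : grid_time n j \in `[0, 1] by rewrite in_itv/=; exact: grid_time_in.
have wl : grid_min n w <= walk (grid_increment n) j w by exact: walk_min_le.
rewrite walk_increment in wl; have Hj := H _ tI sd.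
rewrite lerBlDl; apply: (le_trans wl).
apply: (@le_trans _ _ (r * (path_min w + e - path_at w 0))).
  by apply: ler_wpM2l; [exact: sqrt2V_ge0|rewrite lerD2r].
rewrite addrAC mulrDr lerD2l ler_piMl//; [exact: ltW|exact: sqrt2V_le1].
Unshelve. all: by end_near. Qed.

Lemma measurable_grid_min n : measurable_fun setT (grid_min n).
Proof.
have mw j : measurable_fun setT (walk (grid_increment n) j).
  rewrite (_ : walk _ j = fun w => r * (path_at w (grid_time n j) - path_at w 0)).
    by apply: measurable_funM => //; exact: measurable_increment.
  by apply/funext => w; exact: walk_increment.
rewrite /grid_min; elim: (_ * _)%N => [|j IH]; first exact: measurable_cst.
exact: measurable_minr.
Qed.

(** An infimum over uncountably many times, obtained as the limit of grid minima, each of which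
    involves finitely many evaluations. *)
Lemma measurable_path_min : measurable_fun setT (@path_min R).
Proof.
have r0 : r != 0 by rewrite invr_eq0 gt_eqF// sqrtr_gt0.
have m1 : measurable_fun setT (fun w : C01 R => r * (path_min w - path_at w 0)).
  by apply: (measurable_fun_cvg measurable_grid_min) => w _; exact: grid_min_cvg.
rewrite (_ : @path_min R = fun w => r^-1 * (r * (path_min w - path_at w 0)) + path_at w 0).
  by apply: measurable_funD; [exact: measurable_funM|exact: measurable_path_at].
by apply/funext => w; rewrite mulrA mulVf// mul1r subrK.
Qed.

Lemma measurable_endpoint_sum : measurable_fun setT endpoint_sum.
Proof.
apply: measurable_sum => i; apply: measurable_funM => //; apply: measurable_funM => //.
exact: measurable_increment.
Qed.

Definition tilt w : R := expR (- (A * (r * (path_min w - path_at w 0))) - endpoint_sum w).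

Lemma measurable_tilt : measurable_fun setT tilt.
Proof.
apply: measurableT_comp => //; apply: measurable_funB; last exact: measurable_endpoint_sum.
apply: measurableT_comp => //; apply: measurable_funM => //; apply: measurable_funM => //.
by apply: measurable_funB; [exact: measurable_path_min|exact: measurable_path_at].
Qed.

(** Fatou gives the upper bound on the integral. The lower one holds because a grid minimum lies
    above the minimum of the path and A > 0, so each grid integrand is below the tilt. The
    successive grids are not nested, so the integrands need not increase with n. *)
Lemma tilt_expectation (V : R) :
  chain_value (rev_index d (front_rate d cf A)) (rev_index d cf) (rev_index d lengths) n d.-1 @[n --> \oo] --> V ->
  (\int[W]_w (tilt w)%:E = V%:E)%E.
Proof.
set v := fun n => chain_value _ _ _ n _ => vV.
pose f n w := (expR (- (A * grid_min n w) - endpoint_sum w))%:E.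
have Ef n : (\int[W]_w f n w = (v n)%:E)%E by exact: grid_expectation.
have vVE : (v n)%:E @[n --> \oo] --> V%:E by apply: cvg_EFin => //; exact: nearW.
have mf n : measurable_fun setT (f n).
  apply/measurable_EFinP; apply: measurableT_comp => //; apply: measurable_funB; last exact: measurable_endpoint_sum.
  by apply: measurableT_comp => //; apply: measurable_funM => //; exact: measurable_grid_min.
have f0 n w : (0 <= f n w)%E by rewrite lee_fin expR_ge0.
have mt : measurable_fun setT (fun w => (tilt w)%:E) by apply/measurable_EFinP; exact: measurable_tilt.
have fc w : f n w @[n --> \oo] --> (tilt w)%:E.
  apply: cvg_EFin; first exact: nearW.
  apply: (@continuous_cvg _ _ _ _ _ _ expR); first exact: continuous_expR.
  apply: cvgB; last exact: cvg_cst.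
  by apply: cvgN; apply: cvgM; [exact: cvg_cst|exact: grid_min_cvg].
apply/eqP; rewrite eq_le; apply/andP; split.
  have := @fatou _ _ _ W setT measurableT f mf (fun n w _ => f0 n w).
  rewrite (_ : (fun n => _) = fun n => (v n)%:E); last by apply/funext => n; exact: Ef.
  rewrite (cvg_limn_einf_sup vVE).1 => H; apply: le_trans H.
  rewrite le_eqVlt; apply/orP; left; apply/eqP; apply: eq_integral => w _.
  by apply/esym; exact: (cvg_limn_einf_sup (fc w)).1.
apply: (cvge_to_le vVE); apply: nearW => n; rewrite -Ef; apply: ge0_le_integral => //.
move=> w _; rewrite lee_fin ler_expR lerD2r lerN2; apply: ler_wpM2l; first exact: ltW.
exact: grid_min_ge.
Qed.

End brownian_grid.

(** * The integrals Phi_(d,l) *)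

Section tuple_integral.
Context {R : realType}.
Local Open Scope ereal_scope.
Notation mu := (@lebesgue_measure R).
Notation oray := (`]0%R, +oo[%classic : set (measurableTypeR R)).
Local Notation mR := (measurableTypeR R).

Lemma measurable_pos_orthant n : measurable (@pos_orthant R n).
Proof.
rewrite (_ : @pos_orthant R n = \bigcap_(i in [set i | (i < n)%N]) ((fun u : n.-tuple mR => nth 0%R u i) @^-1` oray)).
  apply: bigcap_measurableType => i /= iN; rewrite -[X in measurable X]setTI.
  rewrite (_ : (fun u : n.-tuple mR => nth 0%R u i) = (@tnth n mR)^~ (Ordinal iN)).
    by apply: measurable_tnth.
  by apply/funext => u; rewrite (tnth_nth 0%R).
apply/seteqP; split => [u up i /= iN|u up i].
  by rewrite in_itv/= andbT; have := up (Ordinal iN); rewrite (tnth_nth 0%R).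
by have := up i (ltn_ord i); rewrite /= in_itv/= andbT (tnth_nth 0%R).
Qed.

Lemma pos_orthant_cons n (z : mR * n.-tuple mR) :
  pos_orthant (cons_pair z) <-> oray z.1 /\ pos_orthant z.2.
Proof.
split => [H|[H1 H2] i].
  split; first by have := H ord0; rewrite /= in_itv/= andbT.
  by move=> i; have := H (lift ord0 i); rewrite (tnth_nth 0%R)/= -tnth_nth.
rewrite /= in_itv/= andbT in H1; rewrite (tnth_nth 0%R); case: i => -[|i] iN //=.
by have := H2 (Ordinal (iN : (i < n)%N)); rewrite (tnth_nth 0%R).
Qed.

Lemma lebesgue_tupleS n (f : n.+1.-tuple mR -> \bar R) : measurable_fun setT f -> (forall u, 0 <= f u) ->
  \int[lebesgue_tuple R n.+1]_(u in @pos_orthant R n.+1) f u =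
  \int[mu]_(v in oray) \int[lebesgue_tuple R n]_(t in @pos_orthant R n) f (cons_pair (v, t)).
Proof.
move=> mf f0; have mo := measurable_pos_orthant.
have mc := @measurable_cons_pair R n.
rewrite integral_mkcond.
pose g : n.+1.-tuple mR -> \bar R := f \_ (@pos_orthant R n.+1).
have mg : measurable_fun setT g by exact: ((measurable_restrictT f (mo n.+1)).1 (measurable_funTS mf)).
have g0 u : 0 <= g u by rewrite /g patchE; case: ifP.
transitivity (\int[pushforward (mu \x lebesgue_tuple R n) (@cons_pair R n)]_u g u).
  exact: eq_measure_integral.
rewrite ge0_integral_pushforward// preimage_setT.
have mgc : measurable_fun setT (g \o @cons_pair R n) by exact: measurableT_comp.
rewrite fubini_tonelli1//; last by move=> z; exact: g0.
rewrite [RHS]integral_mkcond; apply: eq_integral => v _; rewrite patchE; case: ifPn => vo.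
  rewrite [RHS]integral_mkcond; apply: eq_integral => t _; rewrite /= /g !patchE.
  have [to|to] := boolP (t \in @pos_orthant R n).
    rewrite mem_set//; apply/pos_orthant_cons; split; exact/set_mem.
  rewrite memNset// => /pos_orthant_cons[_ /mem_set]; exact/negP.
rewrite /fubini_F integral0_eq// => t _; rewrite /= /g patchE memNset// => /pos_orthant_cons[/mem_set vo' _].
by move: vo; rewrite vo'.
Qed.

End tuple_integral.

Section tuple_chain.
Context {R : realType}.
Notation mu := (@lebesgue_measure R).
Notation oray := (`]0%R, +oo[%classic : set (measurableTypeR R)).
Local Notation mR := (measurableTypeR R).
Variables (d : nat) (kap_ c_ D_ : nat -> R).
Hypothesis c_gt0 : forall j, (j < d)%N -> 0 < c_ j.
Hypothesis D_gt0 : forall j, (j < d)%N -> 0 < D_ j.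
Hypothesis kap_0 : c_ 0%N < kap_ 0%N.
Hypothesis kap_S : forall j, (j.+1 < d)%N -> kap_ j.+1 = kap_ j + c_ j.+1.

Let moray : measurable oray. Proof. by []. Qed.

(** The integrand of Phi without the factor attached to the first variable. The head of [u] belongs
    to the earliest interval involved, and [j] counts the intervals after it. *)
Fixpoint chain_density j (u : seq R) : R := expR (- (nth 0 u 0 * D_ j / 4)) *
  (if j is i.+1 then pkern (c_ j) (nth 0 u 0) (nth 0 u 1) * chain_density i (behead u)
   else 1 / (c_ 0%N ^+ 2 + nth 0 u 0)).

Lemma measurable_nth n i : (i < n)%N -> measurable_fun setT (fun u : n.-tuple mR => nth (0 : R) u i).
Proof.
move=> iN; rewrite (_ : (fun u : n.-tuple mR => nth (0 : R) u i) = (@tnth n mR)^~ (Ordinal iN)).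
  exact: measurable_tnth.
by apply/funext => u; rewrite (tnth_nth (0 : R)).
Qed.

Lemma measurable_chain_density j : measurable_fun setT (fun u : j.+1.-tuple mR => chain_density j u).
Proof.
elim: j => [|j IH].
  have m0 := @measurable_nth 1 0 isT.
  apply: measurable_funM; first by apply: (measurableT_comp (measurable_decay (D_ 0%N)) m0).
  by apply: measurable_funM => //; apply: (measurableT_comp measurable_inv); exact: measurable_funD.
have m0 := @measurable_nth j.+2 0 isT; have m1 := @measurable_nth j.+2 1 isT.
apply: measurable_funM; first by apply: (measurableT_comp (measurable_decay (D_ j.+1)) m0).
apply: measurable_funM.
  have mpair : measurable_fun setT (fun u : j.+2.-tuple mR => (nth (0 : R) u 0 : mR, nth (0 : R) u 1 : mR)).
    exact: measurable_fun_pair.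
  exact: (measurableT_comp (measurable_pkern (c_ j.+1)) mpair).
have mb : measurable_fun setT (fun u : j.+2.-tuple mR => [tuple of behead u]) by exact: measurable_behead.
exact: (measurableT_comp IH mb).
Qed.

Lemma chain_weight_ge0 j v : (j < d)%N -> 0 < v -> 0 <= chain_weight c_ D_ 1 j v.
Proof.
elim: j v => [|j IH] v jd v0; first by rewrite /= divr_ge0// addr_ge0 ?sqr_ge0// ltW.
apply: Rintegral_ge0 => x /mem_set/orayP x0; apply: mulr_ge0.
  by apply: pkern_ge0; [exact: c_gt0|exact: ltW|exact: ltW].
by apply: mulr_ge0; [exact: IH (ltnW jd) x0|exact: expR_ge0].
Qed.

(** The arbitrary factor [H] drives the induction: for a fixed head v, the integral over the tail is
    the same statement with [H] replaced by the kernel started at v. Absolute values allow Tonelli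
    throughout. *)
Lemma tuple_chain_integral j (H : R -> R) : (j < d)%N -> measurable_fun setT H ->
  (\int[lebesgue_tuple R j.+1]_(u in @pos_orthant R j.+1) (`|H (nth 0 u 0) * chain_density j u|)%:E =
   \int[mu]_(v in oray) (`|H v * damped_weight (D_ j) (chain_weight c_ D_ 1 j) v|)%:E)%E.
Proof.
elim: j H => [|j IH] H jd mH; rewrite lebesgue_tupleS//.
- apply: eq_integral => v /orayP v0.
  (* In dimension 0 the measure is a Dirac mass and the positivity condition is empty. *)
  rewrite (_ : @pos_orthant R 0 = setT); last by apply/seteqP; split => // u _ [].
  rewrite integral_dirac//= diracT mul1e; congr ((`| _ * _|)%:E).
  by rewrite /damped_weight mulrC.
- apply/measurable_EFinP; apply: measurableT_comp => //; apply: measurable_funM; last exact: measurable_chain_density.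
  by apply: (measurableT_comp mH); exact: measurable_nth.
- have jd' := ltnW jd.
  apply: eq_integral => v /orayP v0.
  have mp : measurable_fun setT (pkern (c_ j.+1) v) by exact: measurable_fun_pair2 (measurable_pkern _).
  transitivity (\int[lebesgue_tuple R j.+1]_(t in @pos_orthant R j.+1)
     (`|H v * expR (- (v * D_ j.+1 / 4))|%:E * (`|pkern (c_ j.+1) v (nth 0 t 0) * chain_density j t|)%:E))%E.
    apply: eq_integral => t _; rewrite -EFinM -normrM; congr (`|_|%:E); exact: mulrA.
  rewrite ge0_integralZl//; last 2 first.
  + exact: measurable_pos_orthant.
  + apply: measurable_funTS; apply/measurable_EFinP; apply: measurableT_comp => //.
    apply: measurable_funM; last exact: measurable_chain_density.
    by apply: (measurableT_comp mp); exact: measurable_nth.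
  rewrite (IH _ jd' mp).
  have mw : measurable_fun setT (damped_weight (D_ j) (chain_weight c_ D_ 1 j)).
    by apply: measurable_funM; [exact: (admissible_chain c_gt0 D_gt0 kap_0 kap_S 1 jd').1|exact: measurable_decay].
  have i := integrable_pkern_weight (c_gt0 jd) v0 mw (integrable_chain c_gt0 D_gt0 kap_0 kap_S 1 jd').
  transitivity (`|H v * expR (- (v * D_ j.+1 / 4))|%:E * (shift_weight (c_ j.+1) (D_ j) (chain_weight c_ D_ 1 j) v)%:E)%E.
    congr (_ * _)%E; rewrite /shift_weight (EFin_Rintegral moray i); apply: eq_integral => x /orayP x0.
    congr (_%:E); rewrite ger0_norm//; apply: mulr_ge0.
      by apply: pkern_ge0; [exact: c_gt0|exact: ltW|exact: ltW].
    by apply: mulr_ge0; [exact: (chain_weight_ge0 jd' x0)|exact: expR_ge0].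
  have w0 : 0 <= shift_weight (c_ j.+1) (D_ j) (chain_weight c_ D_ 1 j) v by exact: (chain_weight_ge0 jd v0).
  rewrite -EFinM -[X in _ * X](ger0_norm w0) -normrM /damped_weight /=.
  by congr ((`|_|)%:E); ring.
- apply/measurable_EFinP; apply: measurableT_comp => //; apply: measurable_funM; last exact: measurable_chain_density.
  by apply: (measurableT_comp mH); exact: measurable_nth.
Qed.

End tuple_chain.

(** * Identification of the terms with spectral coefficients *)

Section Phi_chain.
Context {R : realType}.
Notation mu := (@lebesgue_measure R).
Notation oray := (`]0%R, +oo[%classic : set (measurableTypeR R)).
Local Notation mR := (measurableTypeR R).
Variables (a c : R) (d : nat) (x_ c_ : nat -> R).
Hypothesis d_ge1 : (1 <= d)%N.
Hypothesis c_gt0 : forall k, (1 <= k <= d)%N -> 0 < c_ k.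
Hypothesis acd : - c_ d < a.
Hypothesis ac : a < - c.
Hypothesis x_incr : forall k, (k < d)%N -> x_ k < x_ k.+1.

Let moray : measurable oray. Proof. by []. Qed.

(* The factor e^(-a * omega_1) is merged into the last weight c_d. *)
Definition end_weight i : R := c_ i.+1 + (if i.+1 == d then a else 0).

Definition rev_kap := rev_index d (front_rate d end_weight (- (a + c))).
Definition rev_c := rev_index d end_weight.
Definition rev_len := rev_index d (lengths x_).

Lemma end_weight_gt0 i : (i < d)%N -> 0 < end_weight i.
Proof.
move=> id; rewrite /end_weight; case: eqP => [->|_]; first by move: acd; lra.
by rewrite addr0 c_gt0.
Qed.

Lemma back_lt j : (d.-1 - j < d)%N.
Proof. by apply: leq_ltn_trans (leq_subr _ _) _; rewrite prednK. Qed.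

Lemma rev_c_gt0 j : (j < d)%N -> 0 < rev_c j.
Proof. by move=> _; apply: end_weight_gt0; exact: back_lt. Qed.

Lemma rev_len_gt0 j : (j < d)%N -> 0 < rev_len j.
Proof. by move=> _; rewrite /rev_len /rev_index /lengths subr_gt0 x_incr// back_lt. Qed.

Lemma rev_kapS j : (j.+1 < d)%N -> rev_kap j.+1 = rev_kap j + rev_c j.+1.
Proof.
move=> jd; rewrite /rev_kap /rev_c /rev_index front_rateS ?back_lt//.
by rewrite subnSK// -ltnS prednK.
Qed.

Lemma front_rate_end : front_rate d end_weight (- (a + c)) d = - (a + c).
Proof. by rewrite /front_rate big_geq// addr0. Qed.

Lemma rev_kap0E : rev_kap 0%N = rev_c 0%N - (a + c).
Proof.
rewrite /rev_kap /rev_c /rev_index subn0 front_rateS ?prednK//.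
by rewrite front_rate_end addrC.
Qed.

Lemma rev_kap0 : rev_c 0%N < rev_kap 0%N.
Proof. by rewrite rev_kap0E; move: ac; lra. Qed.

Lemma rev_c0E : rev_c 0%N = a + tail_sum d c_ d.
Proof. by rewrite /rev_c /rev_index subn0 /end_weight prednK// eqxx /tail_sum big_nat1 addrC. Qed.

(** The [a] merged into the last weight cancels the one in - (a + c). The inner statement counts
    from the end; its exceptional case k = 0 lies past the last node, where nothing has cancelled
    yet. *)
Lemma front_rate_tail i : (i < d)%N ->
  front_rate d end_weight (- (a + c)) i = tail_sum d c_ i.+1 - c.
Proof.
move=> id; have H k : (k <= d)%N -> front_rate d end_weight (- (a + c)) (d - k) =
   tail_sum d c_ (d - k).+1 - c - (if k == 0%N then a else 0).
  elim: k => [_|k IH kd].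
    by rewrite subn0 front_rate_end /tail_sum big_geq//= sub0r opprD addrC.
  have kE : (d - k.+1).+1%N = (d - k)%N by rewrite subnSK.
  have kd' : (d - k.+1 < d)%N by rewrite -{2}(subn0 d) ltn_sub2l// (leq_ltn_trans _ kd).
  rewrite front_rateS// kE (IH (ltnW kd)) /= /tail_sum (@big_ltn _ _ _ (d - k)); last by rewrite ltnS leq_subr.
  rewrite /end_weight kE.
  have -> : (d - k == d)%N = (k == 0)%N.
    case: k {IH kE kd'} kd => [|k] kd; first by rewrite subn0 !eqxx.
    by rewrite ltn_eqF// -{2}(subn0 d) ltn_sub2l// (leq_ltn_trans _ kd).
  by case: ifP => _; ring.
have := H (d - i)%N (leq_subr _ _); rewrite subKn ?(ltnW id)// => ->.
by rewrite subn_eq0 leqNgt id subr0.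
Qed.

(** Translates absolute indices k into positions k - l - 1 of the tuple; the induction peels off
    interval l + 1, which is the head. *)
Lemma chain_density_Phi l j (u : seq R) : (l + j).+1%N = d ->
  expR (- 4^-1 * \sum_(l.+1 <= k < d.+1) step_size x_ k * nth 0 u (k - l.+1)) *
  (\prod_(l.+2 <= k < d.+1) pkern (c_ k.-1) (nth 0 u (k.-1 - l.+1)) (nth 0 u (k - l.+1))) *
  ((a + tail_sum d c_ d) ^+ 2 + nth 0 u (d - l.+1))^-1 =
  chain_density rev_c rev_len j u.
Proof.
have backE (f : nat -> R) l' j' : (l' + j').+1%N = d -> rev_index d f j' = f l'.
  by move=> <-; rewrite /rev_index /= addnK.
elim: j l u => [|j IH] l u ljd.
  have ld : l.+1 = d by rewrite -ljd addn0.
  rewrite ld big_nat1 big_geq// subnn mulr1 /= rev_c0E div1r; congr (expR _ * _).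
  by rewrite /rev_len (backE _ _ _ ljd) /step_size /lengths -ld /=; ring.
have ljd' : (l.+1 + j).+1%N = d by rewrite addSnnS.
have ld : (l.+2 <= d)%N by rewrite -ljd' !ltnS leq_addr.
have ld1 : (l.+1 < d)%N by exact: ld.
have s1 : \sum_(l.+2 <= k < d.+1) step_size x_ k * nth 0 u (k - l.+1) =
    \sum_(l.+2 <= k < d.+1) step_size x_ k * nth 0 (behead u) (k - l.+2).
  apply: eq_big_nat => k /andP[lk _]; rewrite nth_behead; congr (_ * nth _ _ _).
  by rewrite subnSK.
have s2 : \prod_(l.+3 <= k < d.+1) pkern (c_ k.-1) (nth 0 u (k.-1 - l.+1)) (nth 0 u (k - l.+1)) =
    \prod_(l.+3 <= k < d.+1) pkern (c_ k.-1) (nth 0 (behead u) (k.-1 - l.+2)) (nth 0 (behead u) (k - l.+2)).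
  apply: eq_big_nat => k /andP[lk _]; rewrite !nth_behead.
  rewrite (@subnSK l.+1 k); last by exact: ltnW.
  by case: k lk => // k lk; rewrite /= subnSK.
have S1 : \sum_(l.+1 <= k < d.+1) step_size x_ k * nth 0 u (k - l.+1) =
    step_size x_ l.+1 * nth 0 u 0 + \sum_(l.+2 <= k < d.+1) step_size x_ k * nth 0 (behead u) (k - l.+2).
  by rewrite big_ltn ?ltnS ?(ltnW ld1)// subnn s1.
have S2 : \prod_(l.+2 <= k < d.+1) pkern (c_ k.-1) (nth 0 u (k.-1 - l.+1)) (nth 0 u (k - l.+1)) =
    pkern (c_ l.+1) (nth 0 u 0) (nth 0 u 1) *
    \prod_(l.+3 <= k < d.+1) pkern (c_ k.-1) (nth 0 (behead u) (k.-1 - l.+2)) (nth 0 (behead u) (k - l.+2)).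
  by rewrite big_ltn// subnn subSnn s2.
rewrite S1 S2 [RHS]/= -(IH l.+1 (behead u) ljd') nth_behead (subnSK ld1).
have -> : rev_c j.+1 = c_ l.+1.
  by rewrite /rev_c (backE _ _ _ ljd) /end_weight ltn_eqF// addr0.
have -> : - (nth 0 u 0 * rev_len j.+1 / 4) = - 4^-1 * (step_size x_ l.+1 * nth 0 u 0).
  by rewrite /rev_len (backE _ _ _ ljd) /step_size /lengths /=; ring.
have E (e1 e2 p q v : R) : e1 * e2 * (p * q) * v = e1 * (p * (e2 * q * v)) by ring.
by rewrite mulrDr expRD; exact: E.
Qed.

Local Notation scale := ((a + c) / pi).
Local Notation weight j := (chain_weight rev_c rev_len scale j).

Lemma chain_scaleE : chain_scale rev_kap rev_c = scale.
Proof. by rewrite /chain_scale rev_kap0E opprB addrC subrK. Qed.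

Lemma chain_density_ge0 j (u : seq R) : (j < d)%N -> (forall i, (i <= j)%N -> 0 < nth 0 u i) ->
  0 <= chain_density rev_c rev_len j u.
Proof.
elim: j u => [|j IH] u jd u0; apply: mulr_ge0; rewrite ?expR_ge0//.
  by rewrite divr_ge0// addr_ge0 ?sqr_ge0// ltW// u0.
apply: mulr_ge0; first by apply: pkern_ge0; [exact: rev_c_gt0|exact/ltW/u0|exact/ltW/u0].
by apply: IH; [exact: ltnW|move=> i ij; rewrite nth_behead; exact: u0].
Qed.

(** All factors are nonnegative on the orthant, so the absolute values of [tuple_chain_integral] can
    be removed. *)
Lemma tuple_chain_Rintegral n j (F : seq R -> R) (H : R -> R) : (j < d)%N -> n = j.+1 ->
  measurable_fun setT H -> (forall v, 0 < v -> 0 <= H v) ->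
  (forall u : seq R, F u = H (nth 0 u 0) * chain_density rev_c rev_len j u) ->
  \int[lebesgue_tuple R n]_(u in @pos_orthant R n) F u =
  \int[mu]_(v in oray) (H v * damped_weight (rev_len j) (chain_weight rev_c rev_len 1 j) v).
Proof.
move=> jd -> mH H0 FE.
have T := tuple_chain_integral rev_c_gt0 rev_len_gt0 rev_kap0 rev_kapS jd mH.
rewrite /Rintegral; congr fine.
transitivity (\int[lebesgue_tuple R j.+1]_(u in @pos_orthant R j.+1)
    (`|H (nth 0 u 0) * chain_density rev_c rev_len j u|)%:E)%E.
  apply: eq_integral => u /set_mem up; rewrite FE; congr (_%:E).
  have up' i : (i <= j)%N -> 0 < nth (0 : R) u i.
    by move=> ij; have := up (Ordinal (ij : (i < j.+1)%N)); rewrite (tnth_nth (0 : R)).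
  by rewrite ger0_norm// mulr_ge0//; [apply: H0; exact: up'|exact: chain_density_ge0].
rewrite T; apply: eq_integral => v /orayP v0; congr (_%:E).
have w0 := chain_weight_ge0 rev_len rev_c_gt0 jd v0.
by rewrite ger0_norm//; apply: mulr_ge0; [exact: H0|apply: mulr_ge0; [exact: w0|exact: expR_ge0]].
Qed.

Lemma rev_kapE p j : (p + j).+1%N = d -> rev_kap j = tail_sum d c_ p.+1 - c.
Proof.
move=> pj; have pd : (p < d)%N by rewrite -pj ltnS leq_addr.
by rewrite -front_rate_tail// /rev_kap /rev_index; congr front_rate; rewrite -pj /= addnK.
Qed.

Lemma rev_lenE p j : (p + j).+1%N = d -> rev_len j = step_size x_ p.+1.
Proof. by move=> pj; rewrite /rev_len /rev_index /lengths /step_size -pj /= addnK. Qed.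

Lemma rev_cE p j : (p + j.+1).+1%N = d -> rev_c j.+1 = c_ p.+1.
Proof.
move=> pj; rewrite /rev_c /rev_index /end_weight -{1 2}pj /= addnK -{1}pj ltn_eqF ?addr0//.
by rewrite ltnS addnS ltnS leq_addr.
Qed.

(** At height 0 a Robin function equals sqrt v / (kap^2 + v); with kap = s_1 - c this is the factor
    of u_1 in the integrand. *)
Lemma Phi_bot_chain : Phi_bot a c d x_ c_ =
  \int[mu]_(v in oray) (weight d.-1 v * expR (- (v * rev_len d.-1 / 4)) *
    robin (rev_kap d.-1) (Num.sqrt v) 0).
Proof.
have dd : (d.-1 < d)%N by rewrite prednK.
have pd : (0 + d.-1).+1%N = d by rewrite add0n prednK.
have k0 := chain_kap_gt0 rev_c_gt0 rev_kap0 rev_kapS dd.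
pose H v := robin (rev_kap d.-1) (Num.sqrt v) 0.
have mH : measurable_fun setT H.
  by apply: measurable_robin => //; exact: measurable_sqrt.
have HE v : 0 < v -> H v = Num.sqrt v / ((c - tail_sum d c_ 1) ^+ 2 + v).
  move=> v0; rewrite /H /robin mulr0 cos0 sin0 mulr1 mulr0 subr0 sqr_sqrtr ?(ltW v0)//.
  by rewrite (rev_kapE pd) -sqrrN opprB.
rewrite /Phi_bot.
have -> : \int[lebesgue_tuple R d]_(u in @pos_orthant R d)
    (let u_ k := nth 0 u k.-1 in
     expR (- 4^-1 * \sum_(1 <= k < d.+1) u_ k * step_size x_ k) *
     (Num.sqrt (u_ 1%N) / ((c - tail_sum d c_ 1) ^+ 2 + u_ 1%N)) *
     ((a + tail_sum d c_ d) ^+ 2 + u_ d)^-1 *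
     \prod_(2 <= k < d.+1) pkern (c_ k.-1) (u_ k.-1) (u_ k)) =
   \int[mu]_(v in oray) (Num.sqrt v / ((c - tail_sum d c_ 1) ^+ 2 + v) *
     damped_weight (rev_len d.-1) (chain_weight rev_c rev_len 1 d.-1) v).
  have nd : d = d.-1.+1 by rewrite prednK.
  pose H0 v := Num.sqrt v / ((c - tail_sum d c_ 1) ^+ 2 + v).
  have mH0 : measurable_fun setT H0.
    apply: measurable_funM; first exact: measurable_sqrt.
    by apply: (measurableT_comp measurable_inv); exact: measurable_funD.
  have H00 v : 0 < v -> 0 <= H0 v.
    by move=> v0; rewrite divr_ge0 ?sqrtr_ge0// addr_ge0 ?sqr_ge0// ltW.
  apply: (tuple_chain_Rintegral dd nd mH0 H00 (F := fun u : seq R =>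
     let u_ k := nth 0 u k.-1 in
     expR (- 4^-1 * \sum_(1 <= k < d.+1) u_ k * step_size x_ k) *
     (Num.sqrt (u_ 1%N) / ((c - tail_sum d c_ 1) ^+ 2 + u_ 1%N)) *
     ((a + tail_sum d c_ d) ^+ 2 + u_ d)^-1 *
     \prod_(2 <= k < d.+1) pkern (c_ k.-1) (u_ k.-1) (u_ k))).
  move=> u; rewrite -(chain_density_Phi u pd) /= subn1.
  have -> : \sum_(1 <= k < d.+1) nth 0 u k.-1 * step_size x_ k =
      \sum_(1 <= k < d.+1) step_size x_ k * nth 0 u (k - 1).
    by apply: eq_bigr => k _; rewrite subn1 mulrC.
  have -> : \prod_(2 <= k < d.+1) pkern (c_ k.-1) (nth 0 u k.-1.-1) (nth 0 u k.-1) =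
      \prod_(2 <= k < d.+1) pkern (c_ k.-1) (nth 0 u (k.-1 - 1)) (nth 0 u (k - 1)).
    by apply: eq_bigr => k _; rewrite !subn1.
  have E (e h v q : R) : e * h * v * q = h * (e * q * v) by ring.
  exact: E.
have a1 := admissible_chain rev_c_gt0 rev_len_gt0 rev_kap0 rev_kapS 1 dd.
have i := integrable_spectral_term 0 k0 (ltW (rev_len_gt0 dd)) a1.
transitivity (scale * \int[mu]_(v in oray) (chain_weight rev_c rev_len 1 d.-1 v *
   expR (- (v * rev_len d.-1 / 4)) * robin (rev_kap d.-1) (Num.sqrt v) 0)).
  congr (_ * _); apply: eq_Rintegral => v /orayP v0.
  by rewrite -(HE _ v0) /H /damped_weight mulrC.
rewrite -(RintegralZl _ moray i); apply: eq_Rintegral => v /orayP v0.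
by rewrite (chain_weightZ rev_c_gt0 rev_len_gt0 rev_kap0 rev_kapS scale dd v0) !mulrA.
Qed.

(** With l = p + 1 the rational factor is [capture] for kap = s_l - c and c_l = s_l - s_(l+1), both
    differences being taken with the opposite sign. The exponential in front is the growth of the
    bound state over the first l intervals. *)
Lemma Phi_mid_chain p j : (p + j.+1).+1%N = d -> Phi_mid a c d x_ c_ p.+1 =
  expR (4^-1 * \sum_(1 <= k < p.+2) step_size x_ k * (tail_sum d c_ k - c) ^+ 2) *
  \int[mu]_(v in oray) (capture (rev_kap j + rev_c j.+1) (rev_c j.+1) v * damped_weight (rev_len j) (weight j) v).
Proof.
move=> pj; have jd : (j < d)%N by rewrite -pj ltnS (leq_trans (leqnSn j))// leq_addl.
have jd1 : (j.+1 < d)%N by rewrite -pj ltnS leq_addl.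
have pd : (p.+1 + j).+1%N = d by rewrite addSnnS.
have cj0 := rev_c_gt0 jd1; have k0 := chain_kap_gt0 rev_c_gt0 rev_kap0 rev_kapS jd.
set S := expR _; pose H v := S * capture (rev_kap j + rev_c j.+1) (rev_c j.+1) v.
have HE v : H v = S * (Num.sqrt v * (4 * (c - tail_sum d c_ p.+1) * (tail_sum d c_ p.+2 - tail_sum d c_ p.+1) /
    (((c - tail_sum d c_ p.+2) ^+ 2 + v) * ((c - 2 * tail_sum d c_ p.+1 + tail_sum d c_ p.+2) ^+ 2 + v)))).
  have sE : tail_sum d c_ p.+1 = c_ p.+1 + tail_sum d c_ p.+2.
    have pl : (p.+1 < d.+1)%N by rewrite ltnS -pd ltnW// ltnS leq_addr.
    by rewrite /tail_sum big_ltn.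
  rewrite /H /capture (rev_kapE pd) (rev_cE pj) sE addrK.
  move: (tail_sum _ _ _) (c_ _) (Num.sqrt v) => t e q; congr (_ * _).
  (* The quantity kap + c_l is the opposite of c - 2 s_l + s_(l+1); only squares of these occur. *)
  have -> : t - c + e + e = - (c - 2 * (e + t) + t) by ring.
  have -> : t - c = - (c - t) by ring.
  by rewrite !sqrrN; move: ((_ + v) * (_ + v))^-1 => iv; ring.
have mH : measurable_fun setT H by apply: measurable_funM => //; exact: measurable_capture.
have H0 v : 0 < v -> 0 <= H v.
  move=> v0; apply: mulr_ge0; first exact: expR_ge0.
  have kc0 : 0 < rev_kap j + rev_c j.+1 by exact: addr_gt0.
  apply: divr_ge0.
    apply: mulr_ge0; last exact: sqrtr_ge0.
    by apply: mulr_ge0; [apply: mulr_ge0 => //; exact: ltW|exact: ltW].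
  by apply: mulr_ge0; (apply: addr_ge0; [exact: sqr_ge0|exact: ltW]).
have nd : (d - p.+1)%N = j.+1 by rewrite -pd -addnS addKn.
rewrite /Phi_mid.
have -> : \int[lebesgue_tuple R (d - p.+1)]_(u in @pos_orthant R (d - p.+1))
    (let u_ k := nth 0 u (k - p.+2) in
     expR (- 4^-1 * \sum_(p.+2 <= k < d.+1) step_size x_ k * u_ k +
           4^-1 * \sum_(1 <= k < p.+2) step_size x_ k * (tail_sum d c_ k - c) ^+ 2) *
     (\prod_(p.+3 <= k < d.+1) pkern (c_ k.-1) (u_ k.-1) (u_ k)) *
     (Num.sqrt (u_ p.+2) / ((a + tail_sum d c_ d) ^+ 2 + u_ d)) *
     (4 * (c - tail_sum d c_ p.+1) * (tail_sum d c_ p.+2 - tail_sum d c_ p.+1) /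
      (((c - tail_sum d c_ p.+2) ^+ 2 + u_ p.+2) *
       ((c - 2 * tail_sum d c_ p.+1 + tail_sum d c_ p.+2) ^+ 2 + u_ p.+2)))) =
   \int[mu]_(v in oray) (H v * damped_weight (rev_len j) (chain_weight rev_c rev_len 1 j) v).
  apply: (tuple_chain_Rintegral jd nd mH H0 (F := fun u : seq R =>
    let u_ k := nth 0 u (k - p.+2) in
     expR (- 4^-1 * \sum_(p.+2 <= k < d.+1) step_size x_ k * u_ k +
           4^-1 * \sum_(1 <= k < p.+2) step_size x_ k * (tail_sum d c_ k - c) ^+ 2) *
     (\prod_(p.+3 <= k < d.+1) pkern (c_ k.-1) (u_ k.-1) (u_ k)) *
     (Num.sqrt (u_ p.+2) / ((a + tail_sum d c_ d) ^+ 2 + u_ d)) *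
     (4 * (c - tail_sum d c_ p.+1) * (tail_sum d c_ p.+2 - tail_sum d c_ p.+1) /
      (((c - tail_sum d c_ p.+2) ^+ 2 + u_ p.+2) *
       ((c - 2 * tail_sum d c_ p.+1 + tail_sum d c_ p.+2) ^+ 2 + u_ p.+2))))).
  move=> u; rewrite -(chain_density_Phi u pd) HE /= subnn expRD.
  have E (e s q r v h : R) : e * s * q * (r * v) * h = s * (r * h) * (e * q * v) by ring.
  exact: E.
have a1 := admissible_chain rev_c_gt0 rev_len_gt0 rev_kap0 rev_kapS 1 jd.
have i1 := integrable_chain rev_c_gt0 rev_len_gt0 rev_kap0 rev_kapS 1 jd.
have m1 : measurable_fun setT (damped_weight (rev_len j) (chain_weight rev_c rev_len 1 j)).
  by apply: measurable_funM; [exact: a1.1|exact: measurable_decay].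
have i := integrable_capture k0 cj0 m1 i1.
have iS : mu.-integrable oray (EFin \o (fun v => S * (capture (rev_kap j + rev_c j.+1) (rev_c j.+1) v *
    damped_weight (rev_len j) (chain_weight rev_c rev_len 1 j) v))).
  exact: eq_integrable (integrableZl moray S i).
transitivity (scale * (S * \int[mu]_(v in oray) (capture (rev_kap j + rev_c j.+1) (rev_c j.+1) v *
    damped_weight (rev_len j) (chain_weight rev_c rev_len 1 j) v))).
  congr (_ * _); rewrite -(RintegralZl _ moray i); apply: eq_Rintegral => v _.
  by rewrite /H mulrA.
rewrite mulrCA -(RintegralZl _ moray i); congr (_ * _); apply: eq_Rintegral => v /orayP v0.
rewrite /damped_weight (chain_weightZ rev_c_gt0 rev_len_gt0 rev_kap0 rev_kapS scale jd v0).
have E (s q w e : R) : s * (q * (w * e)) = q * (s * w * e) by ring.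
exact: E.
Qed.

(** Unfolding one [shift_bound] splits off the term l = p + 1, namely what the continuum contributes
    at x_l. The rest is the older bound state, to which the induction applies. *)
Lemma Phi_tail_sum j p : (p + j).+1%N = d ->
  expR (4^-1 * \sum_(1 <= k < p.+1) step_size x_ k * (tail_sum d c_ k - c) ^+ 2) *
  (chain_bound rev_kap rev_c rev_len j * expR (rev_kap j ^+ 2 * rev_len j / 4)) =
  \sum_(p.+1 <= l < d.+1) Phi a c d x_ c_ l.
Proof.
have expS q : expR (4^-1 * \sum_(1 <= k < q.+2) step_size x_ k * (tail_sum d c_ k - c) ^+ 2) =
    expR (4^-1 * \sum_(1 <= k < q.+1) step_size x_ k * (tail_sum d c_ k - c) ^+ 2) *
    expR ((tail_sum d c_ q.+1 - c) ^+ 2 * step_size x_ q.+1 / 4).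
  by rewrite -expRD; congr expR; rewrite big_nat_recr//=; ring.
elim: j p => [|j IH] p pj.
  have pd : p.+1 = d by rewrite -pj addn0.
  rewrite pd big_nat1 /Phi eqxx /Phi_top (rev_kapE pj) (rev_lenE pj) pd.
  rewrite mulrCA mulrC; congr (_ * _).
    by have := expS p; rewrite pd => ->.
  (* With kap_0 = s_d - c and c_0 = a + s_d, the coefficient 2 kap_0 / (kap_0 + c_0) is the fraction
     of [Phi_top], numerator and denominator both changing sign. *)
  rewrite /= rev_kap0E rev_c0E; have t0 : 0 < a + tail_sum d c_ d by rewrite -rev_c0E rev_c_gt0.
  have n1 : c - 2 * tail_sum d c_ d - a != 0 by rewrite lt_eqF//; move: ac t0; lra.
  have n2 : a + tail_sum d c_ d - (a + c) + (a + tail_sum d c_ d) != 0 by rewrite gt_eqF//; move: ac t0; lra.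
  by field; rewrite n1 n2.
have pj' : (p.+1 + j).+1%N = d by rewrite addSnnS.
have pd : (p.+1 < d)%N by rewrite -pj' ltnS leq_addr.
rewrite [in RHS]big_ltn; last by rewrite ltnS ltnW.
rewrite -(IH _ pj') /Phi ltn_eqF//= (Phi_mid_chain pj) /shift_bound chain_scaleE.
rewrite (rev_kapE pj) (rev_lenE pj) expS.
have E (e q b i : R) : e * ((b + i) * q) = e * q * i + e * q * b by ring.
exact: E.
Qed.

(** At height 0 the bound state equals 1 and its coefficient collects the terms l >= 1; the
    continuous part is the term l = 0. *)
Lemma Phi_sum : \sum_(0 <= l < d.+1) Phi a c d x_ c_ l =
  spectral_fun (rev_kap d.-1) (chain_bound rev_kap rev_c rev_len d.-1)
    (chain_weight rev_c rev_len (chain_scale rev_kap rev_c) d.-1) (rev_len d.-1) 0.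
Proof.
have pd : (0 + d.-1).+1%N = d by rewrite add0n prednK.
rewrite big_ltn// -(Phi_tail_sum pd) big_geq// mulr0 expR0 mul1r.
rewrite {1}/Phi ltn_eqF//= Phi_bot_chain chain_scaleE /spectral_fun mulr0 oppr0 expR0 mulr1 addrC.
by [].
Qed.

End Phi_chain.

Lemma endpoint_sum_end_weight (R : realType) (a : R) (d : nat) (x_ c_ : nat -> R) (w : C01 R) :
  (0 < d)%N -> x_ d = 1 -> path_at w 0 = 0 ->
  endpoint_sum d x_ (end_weight a d c_) w =
  (Num.sqrt 2)^-1 * \sum_(1 <= k < d.+1) c_ k * path_at w (x_ k) + (Num.sqrt 2)^-1 * a * path_at w 1.
Proof.
case: d => // n _ xd w0; rewrite /endpoint_sum big_ord_recr/= /end_weight eqxx xd w0 subr0.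
rewrite big_nat_recr//= xd big_add1/= big_mkord mulrDr mulr_sumr.
rewrite (eq_bigr (fun i : 'I_n => (Num.sqrt 2)^-1 * (c_ i.+1 * path_at w (x_ i.+1)))); last first.
  by move=> i _; rewrite eqSS ltn_eqF// addr0 subr0 mulrCA.
by ring.
Qed.

Theorem proposition4p10 (R : realType)
  (W : probability (C01 R) R) (W_Bm : is_standard_Bm W)
  (d : nat) (a c : R) (x_ c_ : nat -> R)
  (d_ge1 : (1 <= d)%N)
  (c_gt0 : forall k, (1 <= k <= d)%N -> 0 < c_ k)
  (ac : - c_ d < a /\ a < - c)
  (x_0 : x_ 0%N = 0)
  (x_incr : forall k, (k < d)%N -> x_ k < x_ k.+1)
  (x_d : x_ d = 1)
  (disp : measure_display) (Omega : measurableType disp)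
  (P : probability Omega R) (eta : {mfun Omega >-> C01 R})
  (eta_law : is_eta W (a / Num.sqrt 2) (c / Num.sqrt 2) P eta) :
  ((calH W (a / Num.sqrt 2) (c / Num.sqrt 2))^-1 *
     \sum_(0 <= l < d.+1) Phi a c d x_ c_ l)%:E =
  'E_P[fun w => expR (- (Num.sqrt 2)^-1 *
     \sum_(1 <= k < d.+1) c_ k * path_at (eta w) (x_ k))]%E.
Proof.
have [acd ac'] := ac; have A0 : 0 < - (a + c) by lra.
have cf0 := end_weight_gt0 c_gt0 acd.
have dd : (d.-1 < d)%N by rewrite prednK.
set r := (Num.sqrt 2)^-1.
(* The rate - (a + c) is the opposite of the coefficient of the minimum in the density, once the
   common factor 1/sqrt 2 is taken out. *)
pose T := tilt d x_ (end_weight a d c_) (- (a + c)) : C01 R -> R.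
have ET : (\int[W]_w (T w)%:E = (\sum_(0 <= l < d.+1) Phi a c d x_ c_ l)%:E)%E.
  apply: (tilt_expectation W_Bm d_ge1 x_0 x_incr x_d cf0 A0).
  rewrite (Phi_sum d_ge1 c_gt0 acd ac' x_incr).
  apply: chain_value_cvg dd.
  - exact: rev_c_gt0.
  - exact: rev_len_gt0.
  - exact: rev_kap0.
  - exact: rev_kapS.
pose H := calH W (a / Num.sqrt 2) (c / Num.sqrt 2).
have mmin : measurable_fun setT (@path_min R) by exact: (measurable_path_min x_0 x_incr x_d).
have mweight : measurable_fun setT (eta_weight (a / Num.sqrt 2) (c / Num.sqrt 2)).
  apply: measurableT_comp => //; apply: measurable_funB; apply: measurable_funM => //.
  exact: measurable_path_at.
(* The normalisation is carried along as a nonnegative scalar, the same in the density and in the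
   claim. *)
have H0 : 0 <= H by apply: fine_ge0; apply: expectation_ge0 => w; exact: expR_ge0.
have HV0 : 0 <= H^-1 by rewrite invr_ge0.
pose g (w : C01 R) := expR (- r * \sum_(1 <= k < d.+1) c_ k * path_at w (x_ k)).
have mg : measurable_fun setT g.
  apply: measurableT_comp => //; apply: measurable_funM => //; apply: measurable_sum => k.
  by apply: measurable_funM => //; exact: measurable_path_at.
(* For paths starting at 0 the increments from time 0 in the tilt are the values that occur in the
   density and in the functional. *)
have gT w : path_at w 0 = 0 -> g w * eta_weight (a / Num.sqrt 2) (c / Num.sqrt 2) w = T w.
  move=> w0; rewrite -expRD /T /tilt w0 endpoint_sum_end_weight// -/r; congr expR.
  by rewrite -/r; ring.
rewrite expectation.unlock.
transitivity (\int[distribution P eta]_w (g w)%:E)%E; last first.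
  have mgE : measurable_fun setT (EFin \o g) by apply/measurable_EFinP.
  have gE0 w : (0 <= (EFin \o g) w)%E by rewrite lee_fin expR_ge0.
  exact: (ge0_integral_distribution eta mgE gE0).
pose wt (w : C01 R) := eta_weight (a / Num.sqrt 2) (c / Num.sqrt 2) w / H.
have mwt : measurable_fun setT wt by exact: measurable_funM.
have wt0 w : 0 <= wt w by rewrite mulr_ge0// expR_ge0.
rewrite (integral_density mwt wt0 eta_law); last 2 first.
- exact/measurable_EFinP.
- by move=> w; rewrite lee_fin expR_ge0.
transitivity (\int[W]_w (H^-1%:E * (T w)%:E))%E.
  rewrite ge0_integralZl//.
  - by rewrite ET.
  - apply/measurable_EFinP; exact: (measurable_tilt _ _ x_0 x_incr x_d).
  - by move=> w _; rewrite lee_fin expR_ge0.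
have mT : measurable_fun setT T by exact: (measurable_tilt _ _ x_0 x_incr x_d).
(* The two integrands agree off the event that the path does not start at 0, which is null for
   Brownian motion. *)
apply: ge0_ae_eq_integral => //.
- by apply: emeasurable_funM => //; exact/measurable_EFinP.
- by apply: emeasurable_funM; exact/measurable_EFinP.
- by move=> w _; rewrite -EFinM lee_fin mulr_ge0// expR_ge0.
- by move=> w _; rewrite -EFinM lee_fin mulr_ge0// expR_ge0.
have m0 : measurable [set w : C01 R | path_at w 0 = 0].
  by have := @measurable_path_at R 0 measurableT [set 0] (measurable_set1 0); rewrite setTI.
exists (~` [set w : C01 R | path_at w 0 = 0]); split; first exact: measurableC.
  have [W0 _ _] := W_Bm; apply: etrans (probability_setC W m0) _.
  by rewrite [X in (_ - X)%E]W0 subee.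
move=> w /= H1 w0; apply: H1 => _; rewrite -!EFinM; congr (_%:E).
by rewrite -(gT w w0) /wt; ring.
Qed.
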